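(* Let $\omega$ and $\eta$ be two weight functions on $\mathbb{R}^d$ satisfying $(\alpha)$. In what follows, $[\cdot]$ stands throughout either for $(\cdot)$ (Beurling case) or throughout for $\{\cdot\}$ (Roumieu case); the quantifier on $\lambda$ is ''for all $\lambda>0$'' in the Beurling case and ''there exists $\lambda>0$'' in the Roumieu case. Suppose that $\mathcal{S}^{[\omega]}_{[\eta]}(\mathbb{R}^d)\neq\{0\}$. Then, in each of the two cases, the following statements are equivalent: (i) $\omega$ and $\eta$ satisfy $[\gamma]$. (ii) $\mathcal{S}^{[\omega]}_{[\eta]}(\mathbb{R}^d)=\widetilde{\mathcal{S}}^{[\omega]}_{[\eta]}(\mathbb{R}^d)$ as locally convex spaces. (iii) $\mathcal{S}^{[\omega]}_{[\eta]}(\mathbb{R}^d)$ equals the set of all $\varphi\in\mathcal{S}'(\mathbb{R}^d)$ such that for all $\lambda>0$ (there exists $\lambda>0$ such that) for all $\alpha\in\mathbb{N}^d$: $$\sup_{x\in\mathbb{R}^d}|x^\alpha\varphi(x)|e^{\lambda\eta(x)}<\infty\quad\text{and}\quad \sup_{\xi\in\mathbb{R}^d}|\xi^\alpha\widehat\varphi(\xi)|e^{\lambda\omega(\xi)}<\infty.$$ (iv) $\mathcal{S}^{[\omega]}_{[\eta]}(\mathbb{R}^d)$ equals the set of all $\varphi\in\mathcal{S}'(\mathbb{R}^d)$ such that for all $\lambda>0$ (there exists $\lambda>0$ such that) for all $\alpha\in\mathbb{N}^d$: $$\int_{\mathbb{R}^d}|\varphi^{(\alpha)}(x)|e^{\lambda\eta(x)}\,dx<\infty\quad\text{and}\quad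 \int_{\mathbb{R}^d}|\widehat\varphi^{(\alpha)}(\xi)|e^{\lambda\omega(\xi)}\,d\xi<\infty.$$ (v) $\mathcal{S}^{[\omega]}_{[\eta]}(\mathbb{R}^d)\subseteq\mathcal{S}(\mathbb{R}^d)$.
   Context: $\mathcal{S}(\mathbb{R}^d)$ and $\mathcal{S}'(\mathbb{R}^d)$ denote the Schwartz space and the space of tempered distributions; $\mathbb{N}=\{0,1,2,\dots\}$. A weight function on $\mathbb{R}^d$ is a non-negative, measurable, locally bounded function. Conditions on a weight function $\omega$: - $(\alpha)$: there are $L,C>0$ such that $\omega(x+y)\le L(\omega(x)+\omega(y))+\log C$ for all $x,y\in\mathbb{R}^d$. - $(\gamma)$: there are $A,B>0$ such that $A\log(1+|x|)\le \omega(x)+\log B$ for all $x\in\mathbb{R}^d$. - $\{\gamma\}$: $\lim_{|x|\to\infty}\omega(x)/\log|x|=\infty$. The Fourier transform is $\widehat{\varphi}(\xi)=\int_{\mathbb{R}^d}\varphi(t)e^{-2\pi i\xi\cdot t}\,dt$, extended to $\mathcal{S}'(\mathbb{R}^d)$ as usual. For $\lambda>0$ put $\|\varphi\|_{\omega,\lambda}=\sup_{x\in\mathbb{R}^d}|\varphi(x)|e^{\lambda\omega(x)}$. For weight functions $\eta,\omega$, let $\mathcal{S}^{\lambda}_{\eta,\omega}(\mathbb{R}^d)$ be the Banach space of all $\varphi\in\mathcal{S}'(\mathbb{R}^d)$ such that $\|\varphi\|_{\mathcal{S}^\lambda_{\eta,\omega}}:=\|\varphi\|_{\eta,\lambda}+\|\widehat\varphi\|_{\omega,\lambda}<\infty$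 (finiteness of such suprema or integrals includes the requirement that the distributions involved are given by functions; derivatives are in the distributional sense). Define, as locally convex spaces, $$\mathcal{S}^{(\omega)}_{(\eta)}(\mathbb{R}^d)=\varprojlim_{\lambda\to\infty}\mathcal{S}^{\lambda}_{\eta,\omega}(\mathbb{R}^d),\qquad \mathcal{S}^{\{\omega\}}_{\{\eta\}}(\mathbb{R}^d)=\varinjlim_{\lambda\to0^+}\mathcal{S}^{\lambda}_{\eta,\omega}(\mathbb{R}^d).$$ For $k,l\in\mathbb{N}$ and $\lambda>0$ put $\|\varphi\|_{\omega,k,l,\lambda}=\max_{|\alpha|\le k}\max_{|\beta|\le l}\sup_{x\in\mathbb{R}^d}|x^\beta\varphi^{(\alpha)}(x)e^{\lambda\omega(x)}|$. Let $\widetilde{\mathcal{S}}^{\lambda}_{\eta,\omega}(\mathbb{R}^d)$ be the Fréchet space of all $\varphi\in\mathcal{S}(\mathbb{R}^d)$ such that $\|\varphi\|_{\eta,k,k,\lambda}+\|\widehat\varphi\|_{\omega,k,k,\lambda}<\infty$ for all $k\in\mathbb{N}$, topologized by these norms. Define, as locally convex spaces, $$\widetilde{\mathcal{S}}^{(\omega)}_{(\eta)}(\mathbb{R}^d)=\varprojlim_{\lambda\to\infty}\widetilde{\mathcal{S}}^{\lambda}_{\eta,\omega}(\mathbb{R}^d),\qquad \widetilde{\mathcal{S}}^{\{\omega\}}_{\{\eta\}}(\mathbb{R}^d)=\varinjlim_{\lambda\to0^+}\widetilde{\mathcal{S}}^{\lambda}_{\eta,\omega}(\mathbb{R}^d).$$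 Here $\varprojlim$ is the projective limit (intersection over all $\lambda>0$) and $\varinjlim$ the locally convex inductive limit (union over all $\lambda>0$). *)

(* Defs.v *)
From HB Require Import structures.
From mathcomp Require Import all_boot all_order all_algebra.
From mathcomp Require Import all_classical all_reals all_analysis.
From mathcomp Require Import complex.

Set Implicit Arguments.
Unset Strict Implicit.
Unset Printing Implicit Defensive.

Import Order.TTheory GRing.Theory Num.Theory numFieldNormedType.Exports.

Local Open Scope classical_set_scope.
Local Open Scope ring_scope.

(* Borel sets of R^d, as the product sigma-algebra on row vectors. *)
Section euclidean_measurable.
Variables (R : realType) (d : nat).

Definition coord (i : 'I_d) (x : 'rV[R]_d) : measurableTypeR R := x ord0 i.

Let rV_set0 : g_sigma_preimage coord set0.
Proof. exact: sigma_algebra0. Qed.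

Let rV_setC A : g_sigma_preimage coord A -> g_sigma_preimage coord (~` A).
Proof. exact: sigma_algebraC. Qed.

Let rV_bigcup (F : _^nat) : (forall i, g_sigma_preimage coord (F i)) ->
  g_sigma_preimage coord (\bigcup_i (F i)).
Proof. exact: sigma_algebra_bigcup. Qed.

HB.instance Definition _ := @isMeasurable.Build default_measure_display
  'rV[R]_d (g_sigma_preimage coord) rV_set0 rV_setC rV_bigcup.

End euclidean_measurable.

Lemma measurable_coord (R : realType) (d : nat) (i : 'I_d) :
  measurable_fun setT (@coord R d i).
Proof.
move=> _ Y mY; rewrite setTI; apply: sub_sigma_algebra => /=.
rewrite -bigcup_seq/=; exists i => /=; first by rewrite mem_index_enum.
by exists Y => //; rewrite setTI.
Qed.

Lemma measurable_fun_rV (R : realType) (d : nat) dT (T : measurableType dT)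
    (f : T -> 'rV[R]_d) :
  (forall i, measurable_fun setT (coord i \o f)) -> measurable_fun setT f.
Proof.
move=> mf.
suff : g_sigma_preimage (fun i => @coord R d i \o f) `<=` measurable.
  rewrite g_sigma_preimage_comp => H _ A mA; apply: H; exists A => //.
apply: smallest_sub; first exact: sigma_algebra_measurable.
rewrite -bigcup_seq; apply: bigcup_sub => i _ A [B mB <-].
exact: mf.
Qed.

(* Lebesgue measure on R^d: the unit mass for d = 0, and the image of the
   product measure under R * R^d ~ R^(d+1) afterwards. *)
Section euclidean_lebesgue.
Variable R : realType.

Definition rV_cons (d : nat) (p : measurableTypeR R * 'rV[R]_d) : 'rV[R]_d.+1 :=
  \row_i (if unlift ord0 i is Some j then p.2 ord0 j else p.1).

Definition rV_uncons (d : nat) (x : 'rV[R]_d.+1) :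
    measurableTypeR R * 'rV[R]_d :=
  (x ord0 ord0, \row_j x ord0 (lift ord0 j)).

Lemma rV_consK d : cancel (@rV_cons d) (@rV_uncons d).
Proof.
move=> [a x]; rewrite /rV_uncons /rV_cons mxE unlift_none /=; congr pair.
by apply/rowP => j; rewrite !mxE liftK.
Qed.

Lemma rV_unconsK d : cancel (@rV_uncons d) (@rV_cons d).
Proof.
move=> x; apply/rowP => i; rewrite mxE /=.
by case: unliftP => [j ->|->]; rewrite ?mxE.
Qed.

Lemma measurable_rV_cons d : measurable_fun setT (@rV_cons d).
Proof.
apply: measurable_fun_rV => i.
rewrite (_ : _ \o _ = fun p => if unlift ord0 i is Some j
    then coord j p.2 else p.1); last first.
  by apply/funext => p; rewrite /coord /= mxE.
case: (unlift ord0 i) => [j|]; last exact: measurable_fst.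
by apply: measurableT_comp measurable_snd; exact: measurable_coord.
Qed.

Lemma measurable_rV_uncons d : measurable_fun setT (@rV_uncons d).
Proof.
apply: measurable_fun_pair; first exact: (measurable_coord ord0).
apply: measurable_fun_rV => j.
rewrite (_ : _ \o _ = coord (lift ord0 j)); first exact: measurable_coord.
by apply/funext => x; rewrite /coord /= mxE.
Qed.

Section step.
Variables (d : nat) (mu : {sigma_finite_measure set 'rV[R]_d -> \bar R}).
Local Open Scope ereal_scope.

Definition lebesgue_step : set 'rV[R]_d.+1 -> \bar R :=
  pushforward (@lebesgue_measure R \x mu) (@rV_cons d).

Let measurable_preimage_cons (A : set 'rV[R]_d.+1) :
  measurable A -> measurable (@rV_cons d @^-1` A).
Proof. by move=> mA; rewrite -[X in measurable X]setTI; exact: measurable_rV_cons. Qed.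

Let lebesgue_step0 : lebesgue_step set0 = 0.
Proof. by rewrite /lebesgue_step /pushforward preimage_set0 measure0. Qed.

Let lebesgue_step_ge0 A : 0 <= lebesgue_step A.
Proof. by rewrite /lebesgue_step /pushforward; exact: measure_ge0. Qed.

Let lebesgue_step_sigma_additive : semi_sigma_additive lebesgue_step.
Proof.
move=> F mF tF mUF; rewrite /lebesgue_step /pushforward preimage_bigcup.
apply: measure_semi_sigma_additive.
- by move=> n; exact: measurable_preimage_cons.
- apply/trivIsetP => /= i j _ _ ij; rewrite -preimage_setI.
  by move/trivIsetP : tF => /(_ _ _ _ _ ij) ->//; rewrite preimage_set0.
- by rewrite -preimage_bigcup; exact: measurable_preimage_cons.
Qed.

HB.instance Definition _ := isMeasure.Build _ _ _ lebesgue_step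
  lebesgue_step0 lebesgue_step_ge0 lebesgue_step_sigma_additive.

Let lebesgue_step_sigma_finite : sigma_finite setT lebesgue_step.
Proof.
have /sigma_finiteP[F [TF ndF Foo]] := sigma_finiteT (@lebesgue_measure R).
have /sigma_finiteP[G [TG ndG Goo]] := sigma_finiteT mu.
have mFG n : measurable (F n `*` G n).
  by apply: measurableX; [exact: (Foo n).1|exact: (Goo n).1].
exists (fun n => @rV_uncons d @^-1` (F n `*` G n)).
  rewrite -preimage_bigcup (_ : \bigcup_i _ = setT) ?preimage_setT//.
  rewrite -setXTT TF TG predeqE => -[x y]; split.
    by move=> [n _ []/= ? ?]; split; exists n.
  move=> [/= [n _ Fnx] [k _ Gky]]; exists (maxn n k) => //; split.
  - by move: x Fnx; exact/subsetPset/ndF/leq_maxl.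
  - by move: y Gky; exact/subsetPset/ndG/leq_maxr.
move=> n; split.
  by rewrite -[X in measurable X]setTI; apply: measurable_rV_uncons.
rewrite /lebesgue_step /pushforward -comp_preimage.
rewrite (_ : _ \o _ = idfun); last first.
  by apply/funext => p /=; rewrite rV_consK.
have [? ?] := Foo n; have [? ?] := Goo n.
by rewrite preimage_id product_measure1E// lte_mul_pinfty// ge0_fin_numE.
Qed.

HB.instance Definition _ := Measure_isSigmaFinite.Build _ _ _ lebesgue_step
  lebesgue_step_sigma_finite.

End step.

Section unit_mass.
Definition mass0 : set 'rV[R]_0 -> \bar R := dirac (0 : 'rV[R]_0).
Let mass0_sigma_finite : sigma_finite setT mass0.
Proof.
exists (fun=> setT) => [|_]; first by rewrite bigcup_const//; exists 0%N.
by split; [exact: measurableT|rewrite /mass0 diracT ltry].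
Qed.
HB.instance Definition _ := Measure.copy mass0 (dirac (0 : 'rV[R]_0)).
HB.instance Definition _ := Measure_isSigmaFinite.Build _ _ _ mass0
  mass0_sigma_finite.
Definition unit_mass : {sigma_finite_measure set 'rV[R]_0 -> \bar R} := mass0.
End unit_mass.

Fixpoint lebesgue_rV (d : nat) : {sigma_finite_measure set 'rV[R]_d -> \bar R} :=
  if d is d'.+1 then lebesgue_step (lebesgue_rV d') else unit_mass.

Lemma lebesgue_rV_box (d : nat) (A : 'I_d -> set (measurableTypeR R)) :
  (forall i, measurable (A i)) ->
  lebesgue_rV d [set x | forall i, A i (coord i x)] =
  (\prod_(i < d) lebesgue_measure (A i))%E.
Proof.
elim: d A => [|d IH] A mA.
  rewrite big_ord0 (_ : [set x | _] = setT); last first.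
    by apply/seteqP; split=> // x _ [].
  by rewrite /= /unit_mass /= /mass0 diracT.
have mbox : measurable [set x | forall i, A (lift ord0 i) (@coord R d i x)].
  rewrite (_ : [set x | _] =
      \bigcap_(i in [set: 'I_d]) (@coord R d i @^-1` A (lift ord0 i))).
    apply: fin_bigcap_measurable => // i _.
    by rewrite -[X in measurable X]setTI; exact: measurable_coord.
  by apply/seteqP; split => [x H i _|x H i]; exact: H.
rewrite big_ord_recl -IH// /= /lebesgue_step /pushforward.
rewrite -product_measure1E//; congr (_ _); apply/seteqP; split => -[a x] /=.
  move=> H; split; first by have := H ord0; rewrite /coord /rV_cons mxE unlift_none.
  by move=> i; have := H (lift ord0 i); rewrite /coord /rV_cons mxE liftK.
move=> [Aa Ax] i; rewrite /coord /rV_cons mxE.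
by case: unliftP => [j ->|->] //=; exact: Ax.
Qed.

End euclidean_lebesgue.

(* Locally convex spaces are described inside an ambient vector space by their
   carrier and a base of neighbourhoods of 0. The base is not canonical, so
   spaces are compared by lcs_eq, i.e. by carriers and open sets. *)
Section locally_convex.
Variables (R : realType) (K : numFieldType) (V : lmodType K).

Record lcs := Lcs { lcs_carrier : set V ; lcs_base0 : set (set V) }.

Definition lcs_open (E : lcs) : set (set V) :=
  [set U | U `<=` lcs_carrier E /\
    forall x, U x -> exists2 N, lcs_base0 E N & forall v, N v -> U (x + v)].

Definition lcs_eq (E F : lcs) : Prop :=
  lcs_carrier E = lcs_carrier F /\ lcs_open E = lcs_open F.

Definition seminorm_lcs (I : choiceType) (D : set V) (p : I -> V -> \bar R) :
    lcs :=
  let E := [set v | D v /\ forall i, (p i v < +oo)%E] in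
  Lcs E [set N | exists s : seq I, exists2 e : R, 0 < e &
    N = [set v | E v /\ forall i, i \in s -> (p i v < e%:E)%E]].

(* Intersection, with the coarsest topology making every inclusion into E i
   continuous. *)
Definition projlim (I : choiceType) (P : set I) (E : I -> lcs) : lcs :=
  let C := [set v | forall i, P i -> lcs_carrier (E i) v] in
  Lcs C [set N | exists (s : seq I) (M : I -> set V),
    (forall i, i \in s -> P i /\ lcs_base0 (E i) (M i)) /\
    N = [set v | C v /\ forall i, i \in s -> M i v]].

Definition absolutely_convex (W : set V) : Prop :=
  forall (a b : K) (x y : V), W x -> W y -> `|a| + `|b| <= 1 ->
    W (a *: x + b *: y).

(* Union, with the finest locally convex topology making every inclusion of
   E i continuous. *)
Definition indlim (I : choiceType) (P : set I) (E : I -> lcs) : lcs :=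
  let C := [set v | exists2 i, P i & lcs_carrier (E i) v] in
  Lcs C [set W | [/\ W `<=` C, absolutely_convex W &
    forall i, P i -> exists2 N, lcs_base0 (E i) N & N `<=` W]].

Definition continuous_linear (E : lcs) (u : V -> K) : Prop :=
  (forall (a : K) x y, lcs_carrier E x -> lcs_carrier E y ->
     u (a *: x + y) = a * u x + u y) /\
  (forall (e : K) x, 0 < e -> lcs_carrier E x ->
     exists2 N, lcs_base0 E N & forall v, N v -> `|u (x + v) - u x| < e).

End locally_convex.

Section schwartz.
Variables (R : realType) (d : nat).
Local Notation Rd := 'rV[R]_d.
Local Notation C := R[i].
Local Notation mu := (lebesgue_rV R d).

Definition cmod (z : C) : R := ComplexField.Normc.normc z.

Definition enorm (x : Rd) : R := Num.sqrt (\sum_i x ord0 i ^+ 2).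
Definition dotp (x y : Rd) : R := \sum_i x ord0 i * y ord0 i.

Definition cmeasurable (f : Rd -> C) : Prop :=
  measurable_fun setT (fun x => complex.Re (f x)) /\
  measurable_fun setT (fun x => complex.Im (f x)).

Definition cintegrable (f : Rd -> C) : Prop :=
  mu.-integrable setT (fun x => (complex.Re (f x))%:E) /\
  mu.-integrable setT (fun x => (complex.Im (f x))%:E).

Definition cintegral (f : Rd -> C) : C :=
  Complex (\int[mu]_(x in setT) complex.Re (f x))
          (\int[mu]_(x in setT) complex.Im (f x)).

Definition fourier (f : Rd -> C) (xi : Rd) : C :=
  cintegral (fun t => f t *
    Complex (cos (- (2 * pi * dotp xi t))) (sin (- (2 * pi * dotp xi t)))).

Definition multiindex := 'I_d -> nat.
Definition mlen (a : multiindex) : nat := \sum_i a i.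
Definition monomial (a : multiindex) (x : Rd) : R := \prod_i x ord0 i ^+ a i.

Definition partial (i : 'I_d) (f : Rd -> C) (x : Rd) : C :=
  Complex ('D_(delta_mx ord0 i) (fun y => complex.Re (f y) : R) x)
          ('D_(delta_mx ord0 i) (fun y => complex.Im (f y) : R) x).

Definition mderiv (a : multiindex) (f : Rd -> C) : Rd -> C :=
  foldr (fun i g => iter (a i) (partial i) g) f (enum 'I_d).

Definition smooth (f : Rd -> C) : Prop :=
  forall (s : seq 'I_d) (x : Rd),
    differentiable (fun y => complex.Re (foldr partial f s y) : R) x /\
    differentiable (fun y => complex.Im (foldr partial f s y) : R) x.

Definition wnorm (w : Rd -> R) (k l : nat) (lambda : R) (f : Rd -> C) : \bar R :=
  ereal_sup [set r | exists (a b : multiindex) (x : Rd),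
    [/\ (mlen a <= k)%N, (mlen b <= l)%N &
     r = (`|monomial b x| * cmod (mderiv a f x) * expR (lambda * w x))%:E]].

Definition schwartz_space : lcs (Rd -> C) :=
  seminorm_lcs smooth (fun k : nat => wnorm (fun=> 0) k k 1).

Definition schwartz : set (Rd -> C) := lcs_carrier schwartz_space.

(* Functionals are total on Rd -> C; those on the Schwartz space are extended
   by 0, so that Leibniz equality is equality on the Schwartz space. *)
Definition functional := (Rd -> C) -> C.

Definition on_schwartz (u : functional) : functional :=
  fun f => if `[< schwartz f >] then u f else 0.

Definition tempered : set functional :=
  [set u | continuous_linear schwartz_space u /\ u = on_schwartz u].

Definition regular (f : Rd -> C) : functional :=
  on_schwartz (fun g => cintegral (fun x => f x * g x)).

Definition schwartz_distr : set functional := regular @` schwartz.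

Definition td_fourier (u : functional) : functional :=
  on_schwartz (fun g => u (fourier g)).

Definition td_deriv (a : multiindex) (u : functional) : functional :=
  on_schwartz (fun g => (-1) ^+ mlen a * u (mderiv a g)).

Definition given_by (u : functional) (f : Rd -> C) : Prop :=
  cmeasurable f /\ forall g, schwartz g ->
    cintegrable (fun x => f x * g x) /\ u g = cintegral (fun x => f x * g x).

(* sup |x^a u(x)| e^{lambda w(x)}: a distribution determines its function only
   almost everywhere, so the supremum is minimised over all representatives
   (this is the essential supremum). It is +oo if u is not a function. *)
Definition dsup (a : multiindex) (w : Rd -> R) (lambda : R) (u : functional) :
    \bar R :=
  ereal_inf [set r | exists2 f, given_by u f &
    r = ereal_sup [set (`|monomial a x| * cmod (f x) *
                        expR (lambda * w x))%:E | x in setT]].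

(* The integral of u against e^{lambda w}, in absolute value; again +oo if u is
   not a function, and the same for all representatives otherwise. The
   integrand need not be Borel, but the integral of a non-negative function is
   the supremum over the simple functions below it, which is the Lebesgue
   integral for every Lebesgue measurable integrand. *)
Definition dint (w : Rd -> R) (lambda : R) (u : functional) : \bar R :=
  ereal_inf [set r | exists2 f, given_by u f &
    r = (\int[mu]_(x in setT) (cmod (f x) * expR (lambda * w x))%:E)%E].

Definition lebesgue_measurable (w : Rd -> R) : Prop :=
  exists2 g : Rd -> R, measurable_fun setT g &
    {ae mu, forall x, w x = g x}.

Definition weight (w : Rd -> R) : Prop :=
  [/\ forall x, 0 <= w x, lebesgue_measurable w &
   forall x : Rd, exists M : R, \forall y \near x, w y <= M].

Definition cond_alpha (w : Rd -> R) : Prop :=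
  exists L K : R, [/\ 0 < L, 0 < K &
    forall x y, w (x + y) <= L * (w x + w y) + ln K].

Definition cond_gamma_beurling (w : Rd -> R) : Prop :=
  exists A B : R, [/\ 0 < A, 0 < B &
    forall x, A * ln (1 + enorm x) <= w x + ln B].

Definition cond_gamma_roumieu (w : Rd -> R) : Prop :=
  forall M : R, exists r : R, forall x, r < enorm x ->
    M <= w x / ln (enorm x).

Variant regime := Beurling | Roumieu.

Definition cond_gamma (c : regime) : (Rd -> R) -> Prop :=
  match c with
  | Beurling => cond_gamma_beurling
  | Roumieu => cond_gamma_roumieu
  end.

Definition quant (c : regime) (P : R -> Prop) : Prop :=
  match c with
  | Beurling => forall lambda, 0 < lambda -> P lambda
  | Roumieu => exists2 lambda, 0 < lambda & P lambda
  end.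

Definition regime_lim (c : regime) (E : R -> lcs functional) : lcs functional :=
  match c with
  | Beurling => projlim [set lambda | 0 < lambda] E
  | Roumieu => indlim [set lambda | 0 < lambda] E
  end.

Definition mindex0 : multiindex := fun=> 0%N.

Definition GS_step (eta omega : Rd -> R) (lambda : R) : lcs functional :=
  seminorm_lcs tempered (fun (_ : unit) u =>
    dsup mindex0 eta lambda u + dsup mindex0 omega lambda (td_fourier u))%E.

Definition GS (c : regime) (eta omega : Rd -> R) : lcs functional :=
  regime_lim c (GS_step eta omega).

(* The spaces of Schwartz functions are embedded in the tempered distributions
   by regular, which is injective on the Schwartz space; the infimum below is
   over a single value. *)
Definition GSt_seminorm (eta omega : Rd -> R) (lambda : R) (k : nat)
    (u : functional) : \bar R :=
  ereal_inf [set r | exists f, [/\ schwartz f, u = regular f &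
    r = (wnorm eta k k lambda f + wnorm omega k k lambda (fourier f))%E]].

Definition GSt_step (eta omega : Rd -> R) (lambda : R) : lcs functional :=
  seminorm_lcs schwartz_distr (GSt_seminorm eta omega lambda).

Definition GSt (c : regime) (eta omega : Rd -> R) : lcs functional :=
  regime_lim c (GSt_step eta omega).

End schwartz.

(* Main.v *)
Require Import Defs.
From HB Require Import structures.
From mathcomp Require Import all_boot all_order all_algebra.
From mathcomp Require Import all_classical all_reals all_analysis.
From mathcomp Require Import measurable_realfun complex.
From mathcomp Require Import ring lra.

Set Implicit Arguments.
Unset Strict Implicit.
Unset Printing Implicit Defensive.

Import Order.TTheory GRing.Theory Num.Theory numFieldNormedType.Exports.

Local Open Scope classical_set_scope.
Local Open Scope ring_scope.


(** The equivalence follows from (i) => (ii), (iii), (iv), from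
    (ii), (iii), (iv) => (v), and from (v) => (i).

    (i) => (ii), (iii), (iv). Let u and its Fourier transform be represented by
    functions decaying like e^(- lam eta) and e^(- lam omega). By (gamma) these
    decays beat the powers of |x| that are needed for u to have a Lipschitz
    representative F, the inverse transform of the function representing the
    transform of u (canon_exists). Comparing F with its means against narrow
    Gaussians makes the essential bounds pointwise ones, and replaces lam by
    lam / L, because (alpha) makes the weight comparable to itself on a small ball
    (given_by_lipschitz_bound). Fourier inversion bounds every derivative of F by
    a constant, and an interpolation inequality of Landau-Kolmogorov type, with
    finite differences of step e^(- c eta(x)) at x, turns this into decay of the
    derivatives at a rate which is a fixed fraction of lam, the same for all orders
    (interp_mderiv). All these bounds are linear in the norm of u (gs_norm_wnorm),
    so the two spaces have the same elements and the same topology (GS_eq_GSt); the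
    weighted estimates in (iii) and (iv) follow for all elements. Conversely an
    integral bound gives a supremum bound, by taking the means at x against a
    Gaussian of width e^(- c eta(x)) (integral_to_sup).

    (ii), (iii), (iv) => (v). Under (ii) the space consists of Schwartz functions by
    definition. Under (iii) or (iv), for distinct powers x^a the functions representing x^a u
    are unrelated a priori. However, for p = 1 + x_1^(2N) + .. + x_d^(2N) there is a bounded
    b with u (p g) = int b g for all g, and g / p is a Schwartz function when g is;
    so b / p represents u, and decays like |x|^(- 2N) (given_by_decays). As N is
    arbitrary, and the transform of u can be treated in the same way, u is a
    Schwartz function (rapid_schwartz).

    (v) => (i). Let phi be a nonzero element of the space. If (gamma) fails for eta
    there are very sparse points y_n such that e^(lam eta(y_n)) 4^n = O(|y_n|), for
    every lam or for some lam according to the case. The function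
    F = sum_n 2^n (1 + |y_n|)^(-1) phi(. - y_n) then has the decay required by the
    space, by (alpha), and its transform is that of phi multiplied by a bounded
    function. So F is in the space, but |x| F(x) is of order 2^n near y_n, and F is
    not a Schwartz function (train_not_schwartz). If (gamma) fails for omega the
    same sum is formed with the transform of phi (gamma_frequency). *)

Local Notation Re := complex.Re.
Local Notation Im := complex.Im.

(** * Lebesgue measure on row vectors *)

Section measure_on_rV.
Variable R : realType.

Lemma coord_le_norm d (x : 'rV[R]_d) i : `|x ord0 i| <= `|x|.
Proof.
rewrite [leRHS]/Num.norm/= mx_normrE.
exact: (le_bigmax _ (fun ij : 'I_1 * 'I_d => `|x ij.1 ij.2|) (ord0, i)).
Qed.

Lemma norm_rV_le d (x : 'rV[R]_d) (c : R) : 0 <= c ->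
  (forall i, `|x ord0 i| <= c) -> `|x| <= c.
Proof.
move=> c0 H; rewrite [leLHS]/Num.norm/= mx_normrE.
apply/bigmax_leP; split => // -[i j] _ /=; rewrite (ord1 i); exact: H.
Qed.

Lemma norm_rV_lt d (x : 'rV[R]_d) (c : R) : 0 < c ->
  (forall i, `|x ord0 i| < c) -> `|x| < c.
Proof.
move=> c0 H; rewrite [ltLHS]/Num.norm/= mx_normrE.
apply/bigmax_ltP; split => // -[i j] _ /=; rewrite (ord1 i); exact: H.
Qed.

(** The sigma-algebra is generated by the coordinates, so an open set has to be
exhibited as a countable union of boxes: those with rational centre and radius
suffice. *)
Lemma open_measurable_rV d (U : set 'rV[R]_d) : open U -> measurable U.
Proof.
move=> oU.
pose B (p : 'rV[rat]_d * rat) : set 'rV[R]_d :=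
  [set x | forall i, (Defs.coord i x - ratr (p.1 ord0 i) \in `]- ratr p.2, ratr p.2[)].
have -> : U = \bigcup_(p in [set p | B p `<=` U]) B p.
  apply/seteqP; split => [x Ux|x [p /= pU]]; last exact: pU.
  have /nbhs_ballP[e /= e0 eU] : nbhs x U by exact: open_nbhs_nbhs.
  have [q /andP[q0 qe]] : exists q : rat, 0 < (ratr q : R) < e / 2.
    have /rat_in_itvoo[q] : 0 < e / 2 by rewrite divr_gt0.
    by rewrite in_itv/=; exists q.
  have /choice[r rP] : forall i, exists q' : rat, `|x ord0 i - ratr q'| < ratr q.
    move=> i; have /rat_in_itvoo[q'] : x ord0 i - ratr q < x ord0 i + ratr q by lra.
    rewrite in_itv/= => H; exists q'; rewrite ltr_norml; lra.
  exists (\row_i r i, q) => /=; last first.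
    by move=> i; rewrite in_itv/= mxE -ltr_norml; exact: rP.
  move=> y /= By; apply: eU; rewrite mx_norm_ball /ball_/=.
  apply: norm_rV_lt => // i; rewrite !mxE.
  have := By i; rewrite in_itv/= mxE -ltr_norml /Defs.coord => yi.
  rewrite (_ : _ - _ = (x ord0 i - ratr (r i)) - (y ord0 i - ratr (r i))); last ring.
  rewrite (le_lt_trans (ler_normB _ _))//.
  have := rP i; lra.
rewrite bigcup_mkcond; apply: countable_bigcupT_measurable => // p.
case: ifPn => // _.
rewrite (_ : B p = \bigcap_(i in [set: 'I_d])
  (@Defs.coord R d i @^-1` [set t | t - ratr (p.1 ord0 i) \in `]- ratr p.2, ratr p.2[])).
  apply: fin_bigcap_measurable => // i _.
  rewrite -[X in measurable X]setTI; apply: measurable_coord => //.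
  rewrite (_ : [set _ | _] = `]ratr (p.1 ord0 i) - ratr p.2, ratr (p.1 ord0 i) + ratr p.2[%classic).
    exact: measurable_itv.
  by apply/seteqP; split => t/=; rewrite !in_itv/=; lra.
by apply/seteqP; split => [x H i _|x H i]; exact: H.
Qed.

Lemma continuous_measurable_rV d (f : 'rV[R]_d -> R) :
  continuous f -> measurable_fun setT f.
Proof.
move=> cf; apply: (measurability _ (measurable_realfun.RGenOpens.measurableE R)).
move=> _ [_ [a [b ->]] <-]; rewrite setTI; apply: open_measurable_rV.
by move/continuousP : cf; apply; exact: interval_open.
Qed.

Local Open Scope ereal_scope.

Lemma integral_rV0 (f : 'rV[R]_0 -> \bar R) :
  \int[lebesgue_rV R 0]_x f x = f (0%R : 'rV[R]_0).
Proof.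
rewrite (_ : f = cst (f (0%R : 'rV[R]_0))); last first.
  by apply/funext => x; rewrite /cst (_ : x = 0%R)//; apply/rowP => -[].
by rewrite integral_cst//= /unit_mass /mass0/= diracT mule1.
Qed.

(** Tonelli for the recursive definition of the measure; all integrals over R^d
below are reduced to dimension one by induction with it. *)
Lemma ge0_integral_rVS d (f : 'rV[R]_d.+1 -> \bar R) :
  measurable_fun setT f -> (forall x, 0 <= f x) ->
  \int[lebesgue_rV R d.+1]_x f x =
  \int[lebesgue_measure]_a \int[lebesgue_rV R d]_y f (rV_cons (a, y)).
Proof.
move=> mf f0; rewrite /=.
rewrite [LHS](_ : _ = \int[pushforward (@lebesgue_measure R \x lebesgue_rV R d) (@rV_cons R d)]_x f x)//.
rewrite ge0_integral_pushforward//; last exact: measurable_rV_cons.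
rewrite preimage_setT fubini_tonelli1//=.
by apply: measurableT_comp => //; exact: measurable_rV_cons.
Qed.

Lemma ge0_integral_translate_R (f : measurableTypeR R -> \bar R) (a : R) :
  measurable_fun setT f -> (forall x, 0 <= f x) ->
  \int[lebesgue_measure]_x f (x + a)%R = \int[lebesgue_measure]_x f x.
Proof.
move=> mf f0.
have mphi : measurable_fun setT (fun x : measurableTypeR R => (x + a)%R : measurableTypeR R).
  by apply: measurable_funD => //; exact: measurable_id.
pose mixin := isMeasurableFun.Build _ _ _ _ _ mphi.
pose phi : {mfun measurableTypeR R >-> measurableTypeR R} := HB.pack (fun x => (x + a)%R) mixin.
transitivity (\int[pushforward (@lebesgue_measure R) phi]_x f x).
  by rewrite ge0_integral_pushforward.
apply: eq_measure_integral => A mA _.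
apply/esym; apply: lebesgue_measure_unique => //= X [[u v] _ <-].
rewrite /pushforward /=.
rewrite (_ : _ @^-1` _ = `](u - a)%R, (v - a)%R]%classic); last first.
  by apply/seteqP; split => x/=; rewrite !in_itv/= ltrBlDr lerBrDr.
rewrite !lebesgue_measure_itv/= !lte_fin ltrD2r.
by case: ifPn => // _; rewrite -!EFinD; congr EFin; ring.
Qed.

Lemma rV_consD d (a b : R) (x y : 'rV[R]_d) :
  rV_cons ((a + b)%R : measurableTypeR R, (x + y)%R) =
  (rV_cons ((a : measurableTypeR R), x) + rV_cons ((b : measurableTypeR R), y))%R.
Proof.
by apply/rowP => i; rewrite !mxE /=; case: unlift => // j; rewrite mxE.
Qed.

Lemma measurable_translate d (y : 'rV[R]_d) :
  measurable_fun setT (fun x : 'rV[R]_d => (x + y)%R).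
Proof.
apply: measurable_fun_rV => i.
rewrite (_ : _ \o _ = fun x => (Defs.coord i x + y ord0 i)%R); last first.
  by apply/funext => x; rewrite /= /Defs.coord mxE.
by apply: measurable_funD => //; exact: measurable_coord.
Qed.

(** Induction on the dimension, translating the first coordinate and the others
separately. *)
Lemma ge0_integral_translate d (f : 'rV[R]_d -> \bar R) (y : 'rV[R]_d) :
  measurable_fun setT f -> (forall x, 0 <= f x) ->
  \int[lebesgue_rV R d]_x f (x + y)%R = \int[lebesgue_rV R d]_x f x.
Proof.
elim: d f y => [|d IH] f y mf f0.
  by rewrite !integral_rV0 (_ : y = 0%R) ?addr0//; apply/rowP => -[].
apply: (etrans (ge0_integral_rVS (measurableT_comp mf (measurable_translate y))
  (fun=> f0 _))).
apply/esym; apply: (etrans (ge0_integral_rVS mf f0)); apply/esym => /=.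
have [b [z ->]] : exists (b : measurableTypeR R) z, y = rV_cons (b, z).
  by exists (rV_uncons y).1, (rV_uncons y).2; rewrite -surjective_pairing rV_unconsK.
have mfc : measurable_fun setT (f \o @rV_cons R d).
  by apply: measurableT_comp => //; exact: measurable_rV_cons.
transitivity (\int[lebesgue_measure]_a
    \int[lebesgue_rV R d]_t f (rV_cons ((a + b)%R : measurableTypeR R, t))).
  apply: eq_integral => a _.
  under eq_integral do rewrite -rV_consD.
  apply: (IH (fun t => f (rV_cons ((a + b)%R : measurableTypeR R, t))) z) => //.
  exact: (measurableT_comp mfc (pair1_measurable _)).
apply: (ge0_integral_translate_R (f := fun a => \int[lebesgue_rV R d]_t f (rV_cons (a, t)))).
  have /= H := @measurable_fun_fubini_tonelli_F _ _ _ _ R (lebesgue_rV R d) _ mfc.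
  by apply: H => x; exact: f0.
by move=> a; apply: integral_ge0.
Qed.

Lemma integral_translate d (f : 'rV[R]_d -> \bar R) (y : 'rV[R]_d) :
  measurable_fun setT f ->
  \int[lebesgue_rV R d]_x f (x + y)%R = \int[lebesgue_rV R d]_x f x.
Proof.
move=> mf; rewrite [LHS]integralE [RHS]integralE.
rewrite -(ge0_integral_translate y (measurable_funepos mf))//.
rewrite -(ge0_integral_translate y (measurable_funeneg mf))//.
by congr (_ - _); apply: eq_integral => x _; rewrite ?funeposE ?funenegE.
Qed.

Lemma ge0_integral_rV_prod d (g : R -> R) :
  measurable_fun setT g -> (forall x, 0 <= g x)%R ->
  \int[lebesgue_rV R d]_x (\prod_i g (x ord0 i))%:E =
  (\int[lebesgue_measure]_t (g t)%:E) ^+ d.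
Proof.
move=> mg g0; elim: d => [|d IH].
  by rewrite integral_rV0 big_ord0 expe0.
have mp n : measurable_fun setT (fun x : 'rV[R]_n => (\prod_i g (x ord0 i))%:E).
  apply/measurable_EFinP; apply: measurable_prod => i _ /=.
  by apply: measurableT_comp => //; exact: measurable_coord.
have p0 n (x : 'rV[R]_n) : 0 <= (\prod_i g (x ord0 i))%:E.
  by rewrite lee_fin; apply: prodr_ge0.
rewrite ge0_integral_rVS// expeS -IH.
rewrite -ge0_integralZr//=; [|exact/measurable_EFinP|by move=> t _; rewrite lee_fin|by apply: integral_ge0 => x _; exact: p0].
apply: eq_integral => a _.
rewrite -ge0_integralZl//=; [|exact: mp|by move=> x _; exact: p0|by rewrite lee_fin].
apply: eq_integral => x _; rewrite big_ord_recl -EFinM !mxE unlift_none.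
by congr (EFin (_ * _)%R); apply: eq_bigr => i _; rewrite mxE liftK.
Qed.

Lemma integral_inv1DXX : \int[@lebesgue_measure R]_t ((1 + t ^+ 2)^-1)%:E < +oo.
Proof.
have c0 : continuous (fun t : R => (1 + t ^+ 2)^-1%R).
  move=> t; apply: cvgV; first by rewrite gt_eqF// ltr_pwDl// sqr_ge0.
  apply: cvgD; first exact: cvg_cst.
  exact: exprn_continuous.
rewrite ge0_symfun_integralT//; last 2 first.
- by move=> t; rewrite invr_ge0 addr_ge0// sqr_ge0.
- by move=> t; rewrite /= sqrrN.
rewrite -set_itvcy (@ge0_continuous_FTC2y _ _ (@atan R) 0 (pi / 2)).
- by rewrite -EFinB -EFinM ltry.
- by move=> x _; rewrite invr_ge0 addr_ge0// sqr_ge0.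
- exact: continuous_subspaceT.
- exact: cvgy_atan.
- by move=> x _; exact: derivable_atan.
- apply: cvg_at_right_filter; exact: continuous_atan.
- by move=> x _; rewrite derive1_atan.
Qed.

End measure_on_rV.

(** * Complex-valued integrals and powers of 1 + |x| *)

Section complex_parts.
Variable R : realType.
Implicit Types z w : R[i].

Lemma ReD z w : Re (z + w) = Re z + Re w. Proof. by case: z w => [a b] [u v]. Qed.
Lemma ImD z w : Im (z + w) = Im z + Im w. Proof. by case: z w => [a b] [u v]. Qed.
Lemma ReN z : Re (- z) = - Re z. Proof. by case: z. Qed.
Lemma ImN z : Im (- z) = - Im z. Proof. by case: z. Qed.
Lemma ReM z w : Re (z * w) = Re z * Re w - Im z * Im w.
Proof. by case: z w => [a b] [u v]. Qed.
Lemma ImM z w : Im (z * w) = Re z * Im w + Im z * Re w.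
Proof. by case: z w => [a b] [u v]. Qed.

Lemma complex_ext z w : Re z = Re w -> Im z = Im w -> z = w.
Proof. by case: z w => [a b] [u v] /= -> ->. Qed.

(** The l^1 norm of C = R^2: equivalent to the modulus and submultiplicative, but
additive over real and imaginary parts, so that real estimates add up. *)
Definition n1 z : R := `|Re z| + `|Im z|.

Lemma n1_ge0 z : 0 <= n1 z. Proof. by rewrite addr_ge0. Qed.

Lemma n10 : n1 0 = 0. Proof. by rewrite /n1 /= normr0 addr0. Qed.

Lemma n1_eq0 z : n1 z <= 0 -> z = 0.
Proof.
move=> h; have : n1 z == 0 by rewrite eq_le h n1_ge0.
by rewrite paddr_eq0// !normr_eq0 => /andP[/eqP a /eqP b]; apply: complex_ext.
Qed.

Lemma n1D z w : n1 (z + w) <= n1 z + n1 w.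
Proof.
by rewrite /n1 ReD ImD addrACA lerD// ler_normD.
Qed.

Lemma n1N z : n1 (- z) = n1 z.
Proof. by rewrite /n1 ReN ImN !normrN. Qed.

Lemma n1B z w : n1 (z - w) <= n1 z + n1 w.
Proof. by rewrite -(n1N w) n1D. Qed.

Lemma n1M z w : n1 (z * w) <= n1 z * n1 w.
Proof.
rewrite /n1 ReM ImM; case: z w => [a b] [u v] /=.
have := ler_normB (a * u) (b * v); have := ler_normD (a * v) (b * u).
rewrite !normrM; nra.
Qed.

Lemma n1_real (a : R) z : n1 (Complex a 0 * z) = `|a| * n1 z.
Proof.
by rewrite /n1 ReM ImM /= !mul0r subr0 addr0 !normrM mulrDr.
Qed.

Lemma n1_sum (I : Type) (r : seq I) (F : I -> R[i]) :
  n1 (\sum_(i <- r) F i) <= \sum_(i <- r) n1 (F i).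
Proof.
elim/big_ind2 : _ => //; first by rewrite n10.
by move=> z a w b za wb; exact: le_trans (n1D _ _) (lerD za wb).
Qed.

Lemma Re_sum (I : Type) (r : seq I) (F : I -> R[i]) :
  Re (\sum_(i <- r) F i) = \sum_(i <- r) Re (F i).
Proof. by elim/big_rec2 : _ => // i z w _ <-; rewrite ReD. Qed.

Lemma Im_sum (I : Type) (r : seq I) (F : I -> R[i]) :
  Im (\sum_(i <- r) F i) = \sum_(i <- r) Im (F i).
Proof. by elim/big_rec2 : _ => // i z w _ <-; rewrite ImD. Qed.

Lemma Re_le_n1 z : `|Re z| <= n1 z. Proof. by rewrite lerDl. Qed.
Lemma Im_le_n1 z : `|Im z| <= n1 z. Proof. by rewrite lerDr. Qed.

Lemma cmod_ge0 z : 0 <= cmod z.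
Proof. by case: z => a b; rewrite /cmod /= sqrtr_ge0. Qed.

Lemma cmod_le_n1 z : cmod z <= n1 z.
Proof.
case: z => a b; rewrite /cmod /n1 /=.
rewrite -[leRHS]ger0_norm ?addr_ge0// -sqrtr_sqr ler_wsqrtr//.
rewrite -(real_normK (num_real a)) -(real_normK (num_real b)).
have := normr_ge0 a; have := normr_ge0 b; nra.
Qed.

Lemma n1_le_cmod z : n1 z <= 2 * cmod z.
Proof.
case: z => a b; rewrite /cmod /n1 /= mulr_natl mulr2n lerD//.
  rewrite -sqrtr_sqr ler_wsqrtr// lerDl sqr_ge0//.
by rewrite -sqrtr_sqr ler_wsqrtr// lerDr sqr_ge0.
Qed.

Definition cis (t : R) : R[i] := Complex (cos t) (sin t).

Lemma cisD s t : cis (s + t) = cis s * cis t.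
Proof.
apply: complex_ext; rewrite ?ReM ?ImM /=; first exact: cosD.
by rewrite sinD addrC.
Qed.

Lemma cis0 : cis 0 = 1.
Proof. by rewrite /cis cos0 sin0. Qed.

Lemma n1_cis t : n1 (cis t) <= 2.
Proof. by rewrite /n1 /=; have := cos_max t; have := sin_max t; lra. Qed.

Lemma n1_sign (k : nat) z : n1 ((-1) ^+ k * z) = n1 z.
Proof.
elim: k => [|k IH]; first by rewrite expr0 mul1r.
by rewrite exprS -mulrA mulN1r n1N.
Qed.

End complex_parts.

Section integration.
Variables (R : realType) (d : nat).
Local Notation Rd := 'rV[R]_d.
Local Notation C := R[i].
Local Notation mu := (lebesgue_rV R d).
Implicit Types (f g : Rd -> C) (h k : Rd -> R).

Definition rintegrable h := mu.-integrable setT (EFin \o h).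

Lemma rintegrable_dom h k : measurable_fun setT h -> rintegrable k ->
  (forall x, `|h x| <= k x) -> rintegrable h.
Proof.
move=> mh ik hk; apply: (le_integrable _ _ _ ik) => //.
  exact/measurable_EFinP.
by move=> x _; rewrite /= lee_fin (le_trans (hk x))// ler_norm.
Qed.

Lemma rintegrable_measurable h : rintegrable h -> measurable_fun setT h.
Proof. by move=> /measurable_int /measurable_EFinP. Qed.

Lemma rintegrableZ (c : R) h : rintegrable h -> rintegrable (fun x => c * h x).
Proof.
by move=> ih; have := integrableZl measurableT c ih; apply: eq_integrable.
Qed.

Lemma rintegrableD h k : rintegrable h -> rintegrable k ->
  rintegrable (fun x => h x + k x).
Proof.
by move=> ih ik; have := integrableD measurableT ih ik; apply: eq_integrable.
Qed.

Lemma rintegrable_ge0P h : (forall x, 0 <= h x) -> measurable_fun setT h ->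
  (\int[mu]_x (h x)%:E < +oo)%E -> rintegrable h.
Proof.
move=> h0 mh ioo; apply/integrableP; split; first exact/measurable_EFinP.
by under eq_integral do rewrite /= ger0_norm//.
Qed.

Lemma measurable_norm_rV : measurable_fun setT (fun x : Rd => `|x|).
Proof. by apply: continuous_measurable_rV; exact: norm_continuous. Qed.

(** The growth scale of all polynomial estimates; it is submultiplicative (jbD),
unlike |x|. *)
Definition jb (x : Rd) : R := 1 + `|x|.

Lemma jb_ge1 x : 1 <= jb x. Proof. by rewrite lerDl. Qed.
Lemma jb_gt0 x : 0 < jb x. Proof. exact: lt_le_trans (jb_ge1 x). Qed.
Lemma jb_ge0 x : 0 <= jb x. Proof. exact/ltW/jb_gt0. Qed.
Lemma norm_le_jb x : `|x| <= jb x. Proof. by rewrite lerDr. Qed.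
Lemma coord_le_jb (x : Rd) i : `|x ord0 i| <= jb x.
Proof. exact: le_trans (coord_le_norm _ _) (norm_le_jb _). Qed.
Hint Resolve jb_gt0 jb_ge0 jb_ge1 : core.

Lemma jbX_ge1 x n : 1 <= jb x ^+ n. Proof. exact: exprn_ege1. Qed.
Lemma jbX_gt0 x n : 0 < jb x ^+ n. Proof. exact: exprn_gt0. Qed.
Hint Resolve jbX_ge1 jbX_gt0 : core.

Lemma jbX_mono x n m : (n <= m)%N -> jb x ^+ n <= jb x ^+ m.
Proof. by move=> nm; rewrite ler_weXn2l. Qed.

Lemma jbD x y : jb (x + y) <= jb x * jb y.
Proof.
rewrite /jb; have := ler_normD x y; have := normr_ge0 x; have := normr_ge0 y.
nra.
Qed.

Lemma jbN x : jb (- x) = jb x. Proof. by rewrite /jb normrN. Qed.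

Lemma measurable_jb : measurable_fun setT jb.
Proof. by apply: measurable_funD => //; exact: measurable_norm_rV. Qed.

(** The decay scale dual to jb; kept as a function of its own because jbi n is
both a bound in sup norms and, for n >= 2 d, an integrable majorant. *)
Definition jbi (n : nat) (x : Rd) : R := (jb x ^+ n)^-1.

Lemma jbi_gt0 n x : 0 < jbi n x. Proof. by rewrite invr_gt0. Qed.
Lemma jbi_ge0 n x : 0 <= jbi n x. Proof. exact/ltW/jbi_gt0. Qed.
Hint Resolve jbi_gt0 jbi_ge0 : core.

Lemma jbi_mono n m x : (n <= m)%N -> jbi m x <= jbi n x.
Proof. by move=> nm; rewrite /jbi lef_pV2 ?posrE// jbX_mono. Qed.

Lemma jbi_le1 n x : jbi n x <= 1.
Proof. by rewrite /jbi invf_le1. Qed.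

Lemma jbiD n m x : jbi (n + m) x = jbi n x * jbi m x.
Proof. by rewrite /jbi exprD invfM. Qed.

Lemma jbi_jb n m x : (n <= m)%N -> jb x ^+ n * jbi m x = jbi (m - n) x.
Proof.
move=> nm; rewrite -{1}(subnK nm) jbiD mulrCA /jbi divff ?mulr1//.
exact: lt0r_neq0.
Qed.

Lemma measurable_jbi n : measurable_fun setT (jbi n).
Proof.
apply: continuous_measurable_rV => x.
have jn0 : jb x ^+ n != 0 by rewrite lt0r_neq0.
apply: (@cvgV _ _ (nbhs x) _ (fun y : Rd => jb y ^+ n) (jb x ^+ n) jn0).
have cj : continuous (jb : Rd -> R).
  move=> y; apply: (@continuousD _ _ _ (cst 1 : Rd -> R) (fun y : Rd => `|y| : R) y).
    exact: cst_continuous.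
  exact: norm_continuous.
exact: (@continuous_comp Rd R R jb (fun t : R => t ^+ n) x (cj x) (@exprn_continuous R n _)).
Qed.

(** Since (1 + |x|)^2 >= 1 + x_i^2 for every i, jbi (2 d) is dominated by the
product of the one-dimensional functions 1 / (1 + t^2), whose primitive is atan. *)
Lemma rintegrable_jbi n : (d.*2 <= n)%N -> rintegrable (jbi n).
Proof.
move=> dn.
pose q (x : Rd) := \prod_(i < d) (1 + x ord0 i ^+ 2)^-1 : R.
have q1 (t : R) : 0 < 1 + t ^+ 2 by rewrite ltr_pwDl// sqr_ge0.
have mq1 : measurable_fun setT (fun t : R => (1 + t ^+ 2)^-1).
  apply: continuous_measurable_fun => t; apply: cvgV; first exact: lt0r_neq0.
  by apply: cvgD; [exact: cvg_cst|exact: exprn_continuous].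
apply: (@rintegrable_dom _ q); first exact: measurable_jbi.
- apply: rintegrable_ge0P.
  + by move=> x; apply: prodr_ge0 => i _; rewrite invr_ge0 ltW.
  + apply: measurable_prod => i _.
    exact: (measurableT_comp mq1 (@measurable_coord R d i)).
  + rewrite [X in (X < _)%E](ge0_integral_rV_prod d mq1); last first.
      by move=> t; rewrite invr_ge0 ltW.
    have := @integral_inv1DXX R.
    set I := (\int[_]_t _)%E => Ioo.
    have I0 : (0 <= I)%E by apply: integral_ge0 => t _; rewrite lee_fin invr_ge0 ltW.
    by rewrite -(@fineK _ I) ?ge0_fin_numE// -EFin_expe ltry.
move=> x; rewrite ger0_norm//; apply: (le_trans (jbi_mono x dn)).
rewrite /jbi /q prodfV lef_pV2 ?posrE//; last by apply: prodr_gt0.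
rewrite -mul2n exprM.
have -> : (jb x ^+ 2) ^+ d = \prod_(i < d) (jb x ^+ 2) by rewrite prodr_const card_ord.
apply: ler_prod => i _; rewrite ltW//=.
have := coord_le_norm x i; rewrite /jb -(real_normK (num_real (x ord0 i))).
have := normr_ge0 (x ord0 i); nra.
Qed.

Lemma cmeasurableD f g : cmeasurable f -> cmeasurable g ->
  cmeasurable (fun x => f x + g x).
Proof.
move=> [f1 f2] [g1 g2]; split.
  by under eq_fun do rewrite ReD; exact: measurable_funD.
by under eq_fun do rewrite ImD; exact: measurable_funD.
Qed.

Lemma cmeasurableM f g : cmeasurable f -> cmeasurable g ->
  cmeasurable (fun x => f x * g x).
Proof.
move=> [f1 f2] [g1 g2]; split.
  by under eq_fun do rewrite ReM; apply: measurable_funB; apply: measurable_funM.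
by under eq_fun do rewrite ImM; apply: measurable_funD; apply: measurable_funM.
Qed.

Lemma cmeasurable_cst (c : C) : cmeasurable (fun _ : Rd => c).
Proof. by split; exact: measurable_cst. Qed.

Lemma cmeasurableN f : cmeasurable f -> cmeasurable (fun x => - f x).
Proof.
move=> mf; under eq_fun do rewrite -mulN1r.
by apply: cmeasurableM => //; exact: cmeasurable_cst.
Qed.

Lemma cmeasurable_real h : measurable_fun setT h ->
  cmeasurable (fun x => Complex (h x) 0).
Proof. by move=> mh; split => //=; exact: measurable_cst. Qed.

Lemma measurable_n1 f : cmeasurable f -> measurable_fun setT (fun x => n1 (f x)).
Proof.
by move=> [f1 f2]; apply: measurable_funD; apply: measurableT_comp.
Qed.

Lemma measurable_dotp (xi : Rd) : measurable_fun setT (dotp xi).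
Proof.
apply: measurable_sum => i; apply: measurable_funM => //.
exact: measurable_coord.
Qed.

Lemma cmeasurable_cis h : measurable_fun setT h ->
  cmeasurable (fun x => cis (h x)).
Proof.
move=> mh; split => /=.
  apply: measurableT_comp mh; apply: continuous_measurable_fun.
  exact: continuous_cos.
apply: measurableT_comp mh; apply: continuous_measurable_fun.
exact: continuous_sin.
Qed.

Lemma cintegrable_dom f h : cmeasurable f -> rintegrable h ->
  (forall x, n1 (f x) <= h x) -> cintegrable f.
Proof.
move=> [f1 f2] ih fh; split.
  apply: rintegrable_dom ih _ => // x; exact: le_trans (Re_le_n1 _) (fh x).
apply: rintegrable_dom ih _ => // x; exact: le_trans (Im_le_n1 _) (fh x).
Qed.

Lemma cintegrable_measurable f : cintegrable f -> cmeasurable f.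
Proof.
by case=> [/measurable_int/measurable_EFinP f1 /measurable_int/measurable_EFinP f2].
Qed.

Lemma rintegrable_n1 f : cintegrable f -> rintegrable (fun x => n1 (f x)).
Proof.
by move=> [f1 f2]; apply: rintegrableD; apply: integrable_norm.
Qed.

Lemma eq_cintegral f g : f =1 g -> cintegral f = cintegral g.
Proof. by move=> /funext ->. Qed.

Lemma cintegrableD f g : cintegrable f -> cintegrable g ->
  cintegrable (fun x => f x + g x).
Proof.
move=> [f1 f2] [g1 g2]; split.
  by under eq_fun do rewrite ReD; exact: rintegrableD.
by under eq_fun do rewrite ImD; exact: rintegrableD.
Qed.

Lemma cintegralD f g : cintegrable f -> cintegrable g ->
  cintegral (fun x => f x + g x) = cintegral f + cintegral g.
Proof.
move=> [f1 f2] [g1 g2]; apply: complex_ext; rewrite ?ReD ?ImD /=.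
  by rewrite -RintegralD//; apply: eq_Rintegral => x _; rewrite ReD.
by rewrite -RintegralD//; apply: eq_Rintegral => x _; rewrite ImD.
Qed.

Lemma cintegrableZ (c : C) f : cintegrable f -> cintegrable (fun x => c * f x).
Proof.
move=> cf; apply: (@cintegrable_dom _ (fun x => n1 c * n1 (f x))).
- by apply: cmeasurableM; [exact: cmeasurable_cst|exact: cintegrable_measurable].
- exact/rintegrableZ/rintegrable_n1.
- by move=> x; exact: n1M.
Qed.

Lemma cintegralZ (c : C) f : cintegrable f ->
  cintegral (fun x => c * f x) = c * cintegral f.
Proof.
move=> [f1 f2]; apply: complex_ext; rewrite ?ReM ?ImM /=.
  rewrite -!RintegralZl//.
  rewrite -RintegralB//; [|exact: (rintegrableZ (Re c) f1)|exact: (rintegrableZ (Im c) f2)].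
  by apply: eq_Rintegral => x _; rewrite ReM.
rewrite -!RintegralZl//.
rewrite -RintegralD//; [|exact: (rintegrableZ (Re c) f2)|exact: (rintegrableZ (Im c) f1)].
by apply: eq_Rintegral => x _; rewrite ImM.
Qed.

Lemma cintegralN f : cintegrable f ->
  cintegral (fun x => - f x) = - cintegral f.
Proof.
by move=> cf; under eq_fun do rewrite -mulN1r; rewrite cintegralZ// mulN1r.
Qed.

Lemma cintegrableN f : cintegrable f -> cintegrable (fun x => - f x).
Proof.
by move=> cf; under eq_fun do rewrite -mulN1r; exact: cintegrableZ.
Qed.

Lemma cintegralB f g : cintegrable f -> cintegrable g ->
  cintegral (fun x => f x - g x) = cintegral f - cintegral g.
Proof.
move=> cf cg; rewrite cintegralD//; last exact: cintegrableN.
by rewrite cintegralN.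
Qed.

Lemma cintegral0 : cintegral (fun _ : Rd => 0 : C) = 0.
Proof.
by apply: complex_ext => /=; rewrite Rintegral_cst// mul0r.
Qed.

Lemma cintegrable0 : cintegrable (fun _ : Rd => 0 : C).
Proof. by split; exact: integrable0. Qed.

Lemma cintegral_sum (I : Type) (r : seq I) (F : I -> Rd -> C) :
  (forall i, cintegrable (F i)) ->
  cintegrable (fun x => \sum_(i <- r) F i x) /\
  cintegral (fun x => \sum_(i <- r) F i x) = \sum_(i <- r) cintegral (F i).
Proof.
move=> iF; elim: r => [|i r [IH1 IH2]].
  under eq_fun do rewrite big_nil; split; first exact: cintegrable0.
  by rewrite big_nil cintegral0.
under eq_fun do rewrite big_cons; split; first exact: cintegrableD.
by rewrite big_cons cintegralD// IH2.
Qed.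

Lemma n1_cintegral_le f h : cmeasurable f -> rintegrable h ->
  (forall x, n1 (f x) <= h x) -> n1 (cintegral f) <= \int[mu]_x h x.
Proof.
move=> mf ih fh; have [f1 f2] := cintegrable_dom mf ih fh.
apply: (@le_trans _ _ (\int[mu]_x n1 (f x))).
  rewrite /n1 RintegralD//; [|exact: integrable_norm|exact: integrable_norm].
  by apply: lerD; exact: le_normr_Rintegral.
apply: le_Rintegral => //; apply: rintegrable_n1; split => //.
Qed.

Lemma rintegral_ge0 h : (forall x, 0 <= h x) -> 0 <= \int[mu]_x h x.
Proof. by move=> h0; apply: Rintegral_ge0. Qed.

Lemma cintegral_translate f y : cmeasurable f ->
  cintegral (fun x => f (x + y)) = cintegral f.
Proof.
move=> [f1 f2]; apply: complex_ext; rewrite /= /Rintegral; congr fine.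
  exact: (@integral_translate R d (fun x => (Re (f x))%:E) y (measurableT_comp _ f1)).
exact: (@integral_translate R d (fun x => (Im (f x))%:E) y (measurableT_comp _ f2)).
Qed.

Lemma rintegrable_translate h y : rintegrable h -> rintegrable (fun x => h (x + y)).
Proof.
move=> /integrableP[mh hoo]; apply/integrableP; split.
  exact: (measurableT_comp mh (measurable_translate y)).
rewrite (_ : (\int[mu]_x _ = \int[mu]_x `|(EFin \o h) x|)%E)//.
apply: (@integral_translate R d (fun x => `|(EFin \o h) x|%E) y).
exact: measurableT_comp.
Qed.

Lemma rintegral_translate h y : measurable_fun setT h ->
  \int[mu]_x h (x + y) = \int[mu]_x h x.
Proof.
move=> mh; rewrite /Rintegral; congr fine.
by apply: (@integral_translate R d (EFin \o h) y); exact/measurable_EFinP.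
Qed.

Lemma cintegrable_translate f y : cintegrable f ->
  cintegrable (fun x => f (x + y)).
Proof.
by move=> [f1 f2]; split; [exact: (rintegrable_translate y f1)|exact: (rintegrable_translate y f2)].
Qed.

Let eq_refl_le (a b : R) : a = b -> a <= b. Proof. by move=> ->. Qed.

(** Domination by a product is the only form of integrability needed for the
Fourier kernel, and it makes Tonelli's condition explicit. *)
Lemma real_Fubini (K : Rd -> Rd -> R) h k :
  measurable_fun setT (fun p : Rd * Rd => K p.1 p.2) ->
  rintegrable h -> rintegrable k ->
  (forall x, 0 <= h x) -> (forall y, 0 <= k y) ->
  (forall x y, `|K x y| <= h x * k y) ->
  rintegrable (fun x => \int[mu]_y K x y) /\
      (\int[mu]_x \int[mu]_y K x y = \int[mu]_y \int[mu]_x K x y).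
Proof.
move=> mK ih ik h0 k0 Khk.
have mh := rintegrable_measurable ih; have mk := rintegrable_measurable ik.
have iK : (mu \x mu)%E.-integrable setT (EFin \o (fun p : Rd * Rd => K p.1 p.2)).
  apply/integrable12ltyP; first exact/measurable_EFinP.
  apply: (@le_lt_trans _ _ (\int[mu]_x \int[mu]_y (h x * k y)%:E)%E).
    apply: ge0_le_integral => //=.
    + by move=> x _; apply: integral_ge0.
    + apply: (@measurable_fun_fubini_tonelli_F _ _ _ _ R mu (fun p : Rd * Rd => `|(K p.1 p.2)%:E|%E)).
        by apply: measurableT_comp => //; exact/measurable_EFinP.
      by move=> p; exact: abse_ge0.
    + apply: (@measurable_fun_fubini_tonelli_F _ _ _ _ R mu (fun p : Rd * Rd => (h p.1 * k p.2)%:E)).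
        apply/measurable_EFinP; apply: measurable_funM.
          exact: (measurableT_comp mh measurable_fst).
        exact: (measurableT_comp mk measurable_snd).
      by move=> p; rewrite lee_fin mulr_ge0.
    + move=> x _; apply: ge0_le_integral => //=.
      * apply/measurable_EFinP; apply: measurableT_comp => //.
        exact: (measurableT_comp mK (pair1_measurable x)).
      * by apply/measurable_EFinP; apply: measurable_funM.
      * by move=> y _; rewrite lee_fin.
  have /integrableP[_ ahoo] := ih; have /integrableP[_ akoo] := ik.
  under eq_integral => x _.
    under eq_integral do rewrite EFinM.
    rewrite ge0_integralZl//; [|exact/measurable_EFinP|by move=> y _; rewrite lee_fin|by rewrite lee_fin].
    over.
  rewrite ge0_integralZr//; [|exact/measurable_EFinP|by move=> y _; rewrite lee_fin|by apply: integral_ge0 => y _; rewrite lee_fin].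
  have hE : (\int[mu]_x (h x)%:E = (\int[mu]_x h x)%:E)%E.
    by rewrite /Rintegral fineK//; exact: integrable_fin_num.
  have kE : (\int[mu]_x (k x)%:E = (\int[mu]_x k x)%:E)%E.
    by rewrite /Rintegral fineK//; exact: integrable_fin_num.
  by rewrite hE kE -EFinM ltry.
have E1 x : (\int[mu]_y (K x y)%:E = (\int[mu]_y K x y)%:E)%E.
  rewrite /Rintegral fineK//; apply: integrable_fin_num => //.
  apply: (@rintegrable_dom _ (fun y => h x * k y)) (rintegrableZ _ ik) (Khk x).
  exact: (measurableT_comp mK (pair1_measurable x)).
have E2 y : (\int[mu]_x (K x y)%:E = (\int[mu]_x K x y)%:E)%E.
  rewrite /Rintegral fineK//; apply: integrable_fin_num => //.
  apply: (@rintegrable_dom _ (fun x => k y * h x)) (rintegrableZ _ ih) _.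
    exact: (measurableT_comp mK (pair2_measurable y)).
  by move=> x; rewrite mulrC.
split.
- have := integrable_fubini_F iK; apply: eq_integrable => // x _.
  by rewrite /fubini_F /= E1.
- have /= := Fubini iK.
  under eq_integral do rewrite E1.
  under [X in _ = X -> _]eq_integral do rewrite E2.
  by rewrite /Rintegral => ->.
Qed.

Lemma complex_Fubini (K : Rd -> Rd -> C) h k :
  measurable_fun setT (fun p : Rd * Rd => Re (K p.1 p.2)) ->
  measurable_fun setT (fun p : Rd * Rd => Im (K p.1 p.2)) ->
  rintegrable h -> rintegrable k ->
  (forall x, 0 <= h x) -> (forall y, 0 <= k y) ->
  (forall x y, n1 (K x y) <= h x * k y) ->
  [/\ cintegrable (fun x => cintegral (K x)),
      cintegrable (fun y => cintegral (K^~ y)) &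
      cintegral (fun x => cintegral (K x)) = cintegral (fun y => cintegral (K^~ y))].
Proof.
move=> m1 m2 ih ik h0 k0 Khk.
have [a1 a3] := real_Fubini m1 ih ik h0 k0
  (fun x y => le_trans (Re_le_n1 _) (Khk x y)).
have [b1 b3] := real_Fubini m2 ih ik h0 k0
  (fun x y => le_trans (Im_le_n1 _) (Khk x y)).
have sw : measurable_fun setT (fun p : Rd * Rd => (p.2, p.1)).
  by apply: measurable_fun_pair; [exact: measurable_snd|exact: measurable_fst].
have [a2 _] := real_Fubini (measurableT_comp m1 sw) ik ih k0 h0
  (fun y x => le_trans (Re_le_n1 _) (le_trans (Khk x y) (eq_refl_le (mulrC _ _)))).
have [b2 _] := real_Fubini (measurableT_comp m2 sw) ik ih k0 h0
  (fun y x => le_trans (Im_le_n1 _) (le_trans (Khk x y) (eq_refl_le (mulrC _ _)))).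
by split; [split|split|apply: complex_ext].
Qed.

End integration.
#[global] Hint Extern 0 (is_true (@Order.lt _ _ _ (jb _))) => solve [apply: jb_gt0] : core.
#[global] Hint Extern 0 (is_true (@Order.le _ _ _ (jb _))) =>
  solve [apply: jb_ge0 | apply: jb_ge1] : core.
#[global] Hint Extern 0 (is_true (@Order.lt _ _ _ (@GRing.exp _ (jb _) _))) =>
  solve [apply: jbX_gt0] : core.
#[global] Hint Extern 0 (is_true (@Order.le _ _ _ (@GRing.exp _ (jb _) _))) =>
  solve [apply: jbX_ge1 | apply/ltW/jbX_gt0] : core.
#[global] Hint Extern 0 (is_true (@Order.lt _ _ _ (jbi _ _))) => solve [apply: jbi_gt0] : core.
#[global] Hint Extern 0 (is_true (@Order.le _ _ _ (jbi _ _))) => solve [apply: jbi_ge0] : core.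

(** * Partial derivatives *)

Section line_calculus.
Variables (R : realType).

(** The criterion used to differentiate under the integral sign: a quadratic
remainder gives the full differential at once, with no continuity of partial
derivatives to check. *)
Lemma real_taylor2_diff d (f : 'rV[R]_d -> R) (x : 'rV[R]_d) (a : 'I_d -> R) (M : R) :
  (forall h : 'rV[R]_d, `|f (x + h) - f x - \sum_i a i * h ord0 i| <= M * `|h| ^+ 2) ->
  differentiable f x /\ forall i, 'D_(delta_mx ord0 i) f x = a i.
Proof.
move=> H.
pose L0 (h : 'rV[R]_d) : R := \sum_i a i * h ord0 i.
have L0lin : linear L0.
  move=> k u v; rewrite /L0 /= scaler_sumr -big_split/=; apply: eq_bigr => i _.
  by rewrite !mxE mulrDr mulrCA.
pose L : {linear 'rV[R]_d -> R} := HB.pack L0 (GRing.isLinear.Build _ _ _ _ L0 L0lin).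
have cL : continuous (L : 'rV[R]_d -> R).
  move=> u; apply: differentiable_continuous.
  rewrite (_ : (L : 'rV[R]_d -> R) = \sum_(i < d) (cst (a i) * (fun h : 'rV[R]_d => h ord0 i))).
    apply: differentiable_sum => i; apply: differentiableM; first exact: differentiable_cst.
    exact: differentiable_coord.
  by apply/funext => h; rewrite fct_sumE.
have o : f \o shift x = cst (f x) + L +o_ (0 : 'rV[R]_d) id.
  apply/eqaddoP => e e0; near=> h.
  rewrite /= !fctE /= opprD addrA (addrC h).
  apply: (le_trans (H h)); apply: (@le_trans _ _ ((`|M| + 1) * `|h| ^+ 2)).
    by rewrite ler_wpM2r ?sqr_ge0// (le_trans (ler_norm _))// lerDl.
  rewrite expr2 mulrA ler_wpM2r// mulrC -ler_pdivlMr; last by rewrite ltr_wpDl.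
  near: h; apply: (@nbhs0_le R 'rV[R]_d (e / (`|M| + 1))).
  by rewrite divr_gt0// ltr_wpDl.
have dL : 'd f x = L :> ('rV[R]_d -> R) by exact: diff_unique.
have df : differentiable f x by apply/diff_locallyP; rewrite dL.
split=> // i; rewrite deriveE// dL /L /= /L0 (bigD1 i)//= big1 ?addr0.
  by rewrite mxE !eqxx mulr1.
by move=> j ji; rewrite mxE eqxx /= (negbTE ji) mulr0.
Unshelve. all: by end_near. Qed.

Lemma is_derive_line (V : normedModType R) (f : V -> R) (x v : V) (t : R) :
  differentiable f (x + t *: v) ->
  is_derive t 1 (fun s : R => f (x + s *: v)) ('D_v f (x + t *: v)).
Proof.
move=> df.
have E : (fun h : R => h^-1 *: ((fun s : R => f (x + s *: v)) (h *: 1 + t) - f (x + t *: v)))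
   = (fun h : R => h^-1 *: (f (h *: v + (x + t *: v)) - f (x + t *: v))).
  apply/funext => h; congr (_ *: (f _ - _)).
  have -> : h%:A = h :> R by rewrite /GRing.scale/= mulr1.
  by rewrite scalerDl addrCA.
have := @diff_derivable _ _ _ f _ v df; rewrite /derivable => dv.
by split; rewrite /derivable /derive /= E.
Qed.

Lemma real_MVT (f df : R -> R) (s : R) : 0 <= s ->
  (forall t : R, is_derive t 1 f (df t)) ->
  exists2 c, 0 <= c <= s & f s - f 0 = df c * s.
Proof.
move=> s0 H.
have H1 : forall t : R, t \in `]0, s[%R -> is_derive t 1 f (df t) by move=> t _; exact: H.
have H2 : {within `[0, s], continuous f}.
  apply: continuous_subspaceT => t.
  by apply/differentiable_continuous/derivable1_diffP; case: (H t).
have [c] := MVT_segment s0 H1 H2.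
by rewrite in_itv/= subr0 => cs E; exists c.
Qed.

Lemma dist_le_halves (e u v w w' : R) : w = w' ->
  `|u - w| <= e / 2 -> `|v - w'| <= e / 2 -> `|u - v| <= e.
Proof.
move=> <- h k; rewrite (_ : u - v = (u - w) - (v - w)); last by ring.
by rewrite (le_trans (ler_normB _ _))// [leRHS]splitr lerD.
Qed.

End line_calculus.

Section smooth_functions.
Variables (R : realType) (d : nat).
Local Notation Rd := 'rV[R]_d.
Local Notation C := R[i].
Local Notation e_ := (fun i : 'I_d => delta_mx ord0 i : Rd).
Implicit Types (f g : Rd -> C) (s : seq 'I_d) (i j : 'I_d).

(** Real differentiability of both parts. *)
Definition cdiff f := forall x : Rd,
  differentiable (fun y : Rd => Re (f y) : R) x /\
  differentiable (fun y : Rd => Im (f y) : R) x.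

Definition cx i (x : Rd) : C := Complex (x ord0 i) 0.

Lemma cdiff_measurable f : cdiff f -> cmeasurable f.
Proof.
by move=> df; split; apply: continuous_measurable_rV => x;
  apply: differentiable_continuous; case: (df x).
Qed.

Lemma cdiffD f g : cdiff f -> cdiff g -> cdiff (fun x => f x + g x).
Proof.
move=> df dg x; have [f1 f2] := df x; have [g1 g2] := dg x; split.
  by under eq_fun do rewrite ReD; exact: differentiableD.
by under eq_fun do rewrite ImD; exact: differentiableD.
Qed.

Lemma cdiffM f g : cdiff f -> cdiff g -> cdiff (fun x => f x * g x).
Proof.
move=> df dg x; have [f1 f2] := df x; have [g1 g2] := dg x; split.
  under eq_fun do rewrite ReM.
  by apply: differentiableB; apply: differentiableM.
under eq_fun do rewrite ImM.
by apply: differentiableD; apply: differentiableM.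
Qed.

Lemma cdiff_real (h : Rd -> R) : (forall x, differentiable h x) ->
  cdiff (fun x => Complex (h x) 0).
Proof. by move=> dh x; split => //=; exact: differentiable_cst. Qed.

Lemma cdiff_cst (c : C) : cdiff (fun _ : Rd => c).
Proof. by move=> x; split; exact: differentiable_cst. Qed.

Lemma cdiff_cx i : cdiff (cx i).
Proof. by apply: cdiff_real => x; exact: differentiable_coord. Qed.

Lemma partialD i f g : cdiff f -> cdiff g ->
  partial i (fun x => f x + g x) = fun x => partial i f x + partial i g x.
Proof.
move=> df dg; apply/funext => x; have [f1 f2] := df x; have [g1 g2] := dg x.
apply: complex_ext; rewrite ?ReD ?ImD /=.
  by under eq_fun do rewrite ReD; rewrite deriveD//; exact: diff_derivable.
by under eq_fun do rewrite ImD; rewrite deriveD//; exact: diff_derivable.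
Qed.

Lemma partialM i f g : cdiff f -> cdiff g ->
  partial i (fun x => f x * g x) =
  fun x => partial i f x * g x + f x * partial i g x.
Proof.
move=> df dg; apply/funext => x; have [f1 f2] := df x; have [g1 g2] := dg x.
apply: complex_ext; rewrite ?ReD ?ImD ?ReM ?ImM /=.
  under eq_fun do rewrite ReM.
  rewrite (deriveB (f := (fun y => Re (f y)) * (fun y => Re (g y)))
     (g := (fun y => Im (f y)) * (fun y => Im (g y))));
    try (by apply: derivableM; exact: diff_derivable).
  rewrite !deriveM; try exact: diff_derivable.
  rewrite /GRing.scale /=.
  move: (Re (f x)) (Im (f x)) (Re (g x)) (Im (g x)) ('D_(e_ i) (fun y => Re (f y)) x)
    ('D_(e_ i) (fun y => Im (f y)) x) ('D_(e_ i) (fun y => Re (g y)) x)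
    ('D_(e_ i) (fun y => Im (g y)) x) => a b a' b' p q r t; ring.
under eq_fun do rewrite ImM.
rewrite (deriveD (f := (fun y => Re (f y)) * (fun y => Im (g y)))
     (g := (fun y => Im (f y)) * (fun y => Re (g y))));
    try (by apply: derivableM; exact: diff_derivable).
rewrite !deriveM; try exact: diff_derivable.
rewrite /GRing.scale /=.
move: (Re (f x)) (Im (f x)) (Re (g x)) (Im (g x)) ('D_(e_ i) (fun y => Re (f y)) x)
  ('D_(e_ i) (fun y => Im (f y)) x) ('D_(e_ i) (fun y => Re (g y)) x)
  ('D_(e_ i) (fun y => Im (g y)) x) => a b a' b' p q r t; ring.
Qed.

Lemma partial_cst i (c : C) : partial i (fun _ : Rd => c) = fun=> 0.
Proof. by apply/funext => x; apply: complex_ext => /=; exact: derive_cst. Qed.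

Lemma partialZ i (c : C) f : cdiff f ->
  partial i (fun x => c * f x) = fun x => c * partial i f x.
Proof.
move=> df; rewrite (@partialM i (fun=> c) f (@cdiff_cst c) df).
by apply/funext => x; rewrite partial_cst mul0r add0r.
Qed.

Lemma partial_real i (h : Rd -> R) :
  partial i (fun x => Complex (h x) 0) = fun x => Complex ('D_(e_ i) h x) 0.
Proof. by apply/funext => x; apply: complex_ext => //=; exact: derive_cst. Qed.

Lemma real_diff_coord j (x : Rd) (k : 'I_d) :
  'D_(e_ k) (fun y : Rd => y ord0 j) x = (k == j)%:R.
Proof.
have [_ H] : differentiable (fun y : Rd => y ord0 j : R) x /\ forall i,
  'D_(e_ i) (fun y : Rd => y ord0 j) x = (fun i => (i == j)%:R : R) i.
  apply: (@real_taylor2_diff _ _ _ _ _ 0) => h.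
  rewrite (bigD1 j)//= big1 ?addr0.
    by rewrite eqxx mul1r mxE (_ : _ - _ = 0) ?normr0 ?mul0r//; ring.
  by move=> i /negbTE ->; rewrite mul0r.
exact: H.
Qed.

Lemma partial_cx i j : partial i (cx j) = fun=> Complex (i == j)%:R 0.
Proof. by rewrite partial_real; apply/funext => x; rewrite real_diff_coord. Qed.

(** Derivatives along a word of coordinates, rather than a multi-index: words
are what inductions on the order of derivation produce, and Dw_perm shows
that only the multi-index of the word matters. *)
Definition Dw s f := foldr (@partial R d) f s.

Lemma smooth_cdiff f s : smooth f -> cdiff (Dw s f).
Proof. by move=> sf x; exact: sf. Qed.

Lemma Dw_cat s t f : Dw (s ++ t) f = Dw s (Dw t f).
Proof. by rewrite /Dw foldr_cat. Qed.

Lemma smooth_Dw f s : smooth f -> smooth (Dw s f).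
Proof. by move=> sf t x; have := sf (t ++ s) x; rewrite foldr_cat. Qed.

(** The second difference of g over a square of side s, computed by two mean
value theorems. *)
Lemma real_mixed_partial_near (g : Rd -> R) i j (x : Rd) (s : R) : 0 < s ->
  (forall x, differentiable g x) ->
  (forall x, differentiable ('D_(e_ i) g) x) ->
  exists a b : R, [/\ 0 <= a <= s, 0 <= b <= s &
   g (x + s *: e_ i + s *: e_ j) - g (x + s *: e_ i) - (g (x + s *: e_ j) - g x) =
   s ^+ 2 * 'D_(e_ j) ('D_(e_ i) g) (x + a *: e_ i + b *: e_ j)].
Proof.
move=> s0 dg dgi.
pose phi (t : R) := g (x + s *: e_ j + t *: e_ i) - g (x + t *: e_ i).
have [t|a a_s phiE] := @real_MVT R phi
  (fun t => 'D_(e_ i) g (x + s *: e_ j + t *: e_ i) - 'D_(e_ i) g (x + t *: e_ i)) s (ltW s0).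
  by apply: is_deriveB; apply: is_derive_line.
have [t|b b_s psiE] := @real_MVT R (fun t => 'D_(e_ i) g (x + a *: e_ i + t *: e_ j))
  (fun t => 'D_(e_ j) ('D_(e_ i) g) (x + a *: e_ i + t *: e_ j)) s (ltW s0).
  by apply: is_derive_line.
exists a, b; split => //.
move: phiE; rewrite /phi !scale0r !addr0.
rewrite (addrAC x (s *: e_ j)) => ->.
rewrite (addrAC x (s *: e_ j)).
move: psiE; rewrite scale0r addr0 => ->; ring.
Qed.

(** Schwarz's theorem: the second difference is symmetric in the two directions,
and both mixed derivatives are continuous, so both are its limit. *)
Lemma real_mixed_partial (g : Rd -> R) i j :
  (forall x, differentiable g x) ->
  (forall x, differentiable ('D_(e_ i) g) x) ->
  (forall x, differentiable ('D_(e_ j) g) x) ->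
  (forall x, differentiable ('D_(e_ j) ('D_(e_ i) g)) x) ->
  (forall x, differentiable ('D_(e_ i) ('D_(e_ j) g)) x) ->
  'D_(e_ j) ('D_(e_ i) g) = 'D_(e_ i) ('D_(e_ j) g).
Proof.
move=> dg di dj dji dij; apply/funext => x; apply/eqP; rewrite -subr_eq0 -normr_le0; apply/ler_addgt0Pr => e e0; rewrite add0r.
have e20 : 0 < e / 2 by rewrite divr_gt0.
have /differentiable_continuous/cvgrPdist_le/(_ _ e20) c1 := dji x.
have /differentiable_continuous/cvgrPdist_le/(_ _ e20) c2 := dij x.
move: c1 => /nbhs_ballP[r1 /= r10 P1]; move: c2 => /nbhs_ballP[r2 /= r20 P2].
pose r := Num.min r1 r2; have r0 : 0 < r by rewrite lt_min r10.
have rr1 : r <= r1 by rewrite ge_min lexx.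
have rr2 : r <= r2 by rewrite ge_min lexx orbT.
pose s := r / 4.
have s0 : 0 < s by rewrite divr_gt0.
have inr (k l : 'I_d) (a b : R) : 0 <= a <= s -> 0 <= b <= s ->
    ball x r (x + a *: e_ k + b *: e_ l).
  move=> /andP[a0 as_] /andP[b0 bs].
  have en k' : `|e_ k'| <= 1.
    apply: norm_rV_le => // k''; rewrite mxE eqxx /=.
    by case: eqP; rewrite ?normr1 ?normr0.
  rewrite -ball_normE /ball_ /= -addrA opprD addrA subrr add0r normrN.
  rewrite (le_lt_trans (ler_normD _ _))// !normrZ !ger0_norm//.
  have := en k; have := en l; have := normr_ge0 (e_ k); have := normr_ge0 (e_ l).
  have : s = r / 4 by []. 
  nra.
have [a [b [a_s b_s E1]]] := real_mixed_partial_near j x s0 dg di.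
have [a' [b' [a_s' b_s' E2]]] := real_mixed_partial_near i x s0 dg dj.
have h1 := P1 _ (le_ball rr1 (inr i j a b a_s b_s)).
have h2 := P2 _ (le_ball rr2 (inr j i a' b' a_s' b_s')).
have E : 'D_(e_ j) ('D_(e_ i) g) (x + a *: e_ i + b *: e_ j) =
         'D_(e_ i) ('D_(e_ j) g) (x + a' *: e_ j + b' *: e_ i).
  have s20 : s ^+ 2 != 0 by rewrite expf_neq0// lt0r_neq0.
  apply: (mulfI s20); apply: (etrans (esym E1)); apply: (etrans _ E2).
  have -> : x + s *: e_ i + s *: e_ j = x + s *: e_ j + s *: e_ i by exact: addrAC.
  have sw (u v w t : R) : u - v - (w - t) = u - w - (v - t) by ring.
  exact: sw.
exact: dist_le_halves E h1 h2.
Qed.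

Lemma partialC f i j : smooth f -> partial j (partial i f) = partial i (partial j f).
Proof.
move=> sf; apply/funext => x; apply: complex_ext => /=.
  have H0 y : differentiable (fun y => Re (f y) : R) y by exact: (sf [::] y).1.
  have H1 y : differentiable ('D_(e_ i) (fun y => Re (f y) : R)) y by exact: (sf [:: i] y).1.
  have H2 y : differentiable ('D_(e_ j) (fun y => Re (f y) : R)) y by exact: (sf [:: j] y).1.
  have H3 y : differentiable ('D_(e_ j) ('D_(e_ i) (fun y => Re (f y) : R))) y.
    exact: (sf [:: j; i] y).1.
  have H4 y : differentiable ('D_(e_ i) ('D_(e_ j) (fun y => Re (f y) : R))) y.
    exact: (sf [:: i; j] y).1.
  exact: (congr1 (fun F : Rd -> R => F x) (real_mixed_partial H0 H1 H2 H3 H4)).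
have H0 y : differentiable (fun y => Im (f y) : R) y by exact: (sf [::] y).2.
have H1 y : differentiable ('D_(e_ i) (fun y => Im (f y) : R)) y by exact: (sf [:: i] y).2.
have H2 y : differentiable ('D_(e_ j) (fun y => Im (f y) : R)) y by exact: (sf [:: j] y).2.
have H3 y : differentiable ('D_(e_ j) ('D_(e_ i) (fun y => Im (f y) : R))) y.
  exact: (sf [:: j; i] y).2.
have H4 y : differentiable ('D_(e_ i) ('D_(e_ j) (fun y => Im (f y) : R))) y.
  exact: (sf [:: i; j] y).2.
exact: (congr1 (fun F : Rd -> R => F x) (real_mixed_partial H0 H1 H2 H3 H4)).
Qed.

Lemma Dw_perm f s t : smooth f -> perm_eq s t -> Dw s f = Dw t f.
Proof.
move=> sf; have mv i s1 s2 : Dw (s1 ++ i :: s2) f = Dw (i :: s1 ++ s2) f.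
  elim: s1 => //= j s1; rewrite -!/(Dw _ _) => ->.
  by rewrite /= partialC//; exact: smooth_Dw.
elim: s t => [|i s IH] t st; first by move: st; rewrite perm_sym => /perm_nilP ->.
have ti : i \in t by rewrite -(perm_mem st) mem_head.
case/splitPr: ti st => t1 t2 st.
rewrite mv /=; congr partial; apply: IH.
by move: st; rewrite perm_sym -cat1s perm_catCA /= perm_cons perm_sym.
Qed.

Definition word (a : multiindex d) : seq 'I_d := flatten [seq nseq (a i) i | i <- enum 'I_d].

Lemma mderiv_word a f : mderiv a f = Dw (word a) f.
Proof.
rewrite /mderiv /word; elim: (enum 'I_d) => //= i l ->.
by rewrite Dw_cat; elim: (a i) => //= n ->.
Qed.

Lemma count_word a i : count_mem i (word a) = a i.
Proof.
rewrite /word count_flatten -map_comp sumnE big_map big_enum /=.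
rewrite (bigD1 i)//= count_nseq /= eqxx mul1n big1 ?addn0// => j /negbTE ji.
by rewrite count_nseq /= ji mul0n.
Qed.

Lemma size_word a : size (word a) = mlen a.
Proof.
rewrite /word size_flatten /shape -map_comp sumnE big_map big_enum /mlen /=.
by apply: eq_bigr => i _; rewrite size_nseq.
Qed.

Lemma Dw_mderiv f s : smooth f -> exists2 a, mlen a = size s & Dw s f = mderiv a f.
Proof.
move=> sf; pose a i := count_mem i s.
have p : perm_eq s (word a) by apply/allP => i _ /=; rewrite count_word.
by exists a; [rewrite -size_word (perm_size p)|rewrite mderiv_word (Dw_perm sf p)].
Qed.

End smooth_functions.

(** * Schwartz functions *)

Section schwartz_class.
Variables (R : realType) (d : nat).
Local Notation Rd := 'rV[R]_d.
Local Notation C := R[i].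
Local Notation cx := (@cx R d).
Local Notation Dw := (@Dw R d).
Implicit Types (f g : Rd -> C) (s : seq 'I_d) (i j : 'I_d) (P : set (Rd -> C)).

(** A class of bounded functions stable under derivatives and multiplication by
coordinates consists of Schwartz functions (op_class_schwartz). Exhibiting
such a class replaces the Leibniz formula in every closure property below. *)
Definition op_class P := forall f, P f ->
  [/\ cdiff f, forall i, P (partial i f), forall i, P (fun x => cx i x * f x) &
      exists M, forall x, n1 (f x) <= M].

(** Powers of jb are controlled by powers of single coordinates: the sup norm is
attained at one of them. *)
Lemma jb_exp_le (x : Rd) N (c M : R) : 0 <= c -> c <= M ->
  (forall i, `|x ord0 i| ^+ N * c <= M) -> jb x ^+ N * c <= 2 ^+ N.+1 * M.
Proof.
move=> c0 cM H.
have [t [t0 tE tM]] : exists t : R, [/\ 0 <= t, jb x = 1 + t & t ^+ N * c <= M].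
  have [x0|x0] := eqVneq (mx_norm x) 0.
    exists 0; split => //; first by rewrite /jb [`|x|]x0.
    case: N {H} => [|N]; first by rewrite expr0 mul1r.
    by rewrite expr0n mul0r (le_trans c0).
  have [[u i] /= E] := mx_norm_neq0 x0.
  exists `|x|; split => //; rewrite [`|x|]E (ord1 u); exact: H.
have b : jb x ^+ N <= 2 ^+ N * (1 + t ^+ N).
  rewrite tE; have [t1|t1] := leP t 1.
    apply: (@le_trans _ _ (2 ^+ N)).
      by rewrite lerXn2r// ?nnegrE ?addr_ge0//; lra.
    by rewrite ler_peMr ?exprn_ge0// lerDl exprn_ge0.
  apply: (@le_trans _ _ ((2 * t) ^+ N)).
    by rewrite lerXn2r// ?nnegrE ?addr_ge0 ?mulr_ge0//; lra.
  by rewrite exprMn ler_wpM2l ?exprn_ge0// lerDr.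
apply: (le_trans (ler_wpM2r c0 b)).
by rewrite exprSr -!mulrA ler_wpM2l ?exprn_ge0// mulrDl mul1r; lra.
Qed.

Lemma op_class_decay P f N : op_class P -> P f ->
  exists2 M, 0 <= M & forall x, n1 (f x) <= M * jbi N x.
Proof.
move=> oP Pf.
have H i n : exists M, forall x : Rd, `|x ord0 i| ^+ n * n1 (f x) <= M.
  have [M HM] : exists M, forall x, n1 (cx i x ^+ n * f x) <= M.
    have : P (fun x => cx i x ^+ n * f x).
      elim: n => [|n IH]; first by under eq_fun do rewrite expr0 mul1r.
      have [_ _ /(_ i) + _] := oP _ IH.
      by under eq_fun do rewrite mulrA -exprS.
    by move=> /oP[].
  exists M => x; apply: le_trans (HM x).
  rewrite (_ : cx i x ^+ n = Complex (x ord0 i ^+ n) 0) ?n1_real ?normrX//.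
  elim: n {M HM} => [|n IH]; first by rewrite expr0.
  by rewrite exprS IH; apply: complex_ext => /=; rewrite ?mul0r ?mulr0 ?subr0 ?addr0 -?exprS.
have [M0 HM0] : exists M, forall x, n1 (f x) <= M by have [] := oP _ Pf.
have /choice[M HM] := fun i => H i N.
pose B := `|M0| + \sum_i `|M i|.
have B0 : 0 <= B by rewrite addr_ge0// sumr_ge0.
exists (2 ^+ N.+1 * B); first by rewrite mulr_ge0// exprn_ge0.
move=> x; rewrite /jbi ler_pdivlMr// mulrC; apply: jb_exp_le; first exact: n1_ge0.
  by rewrite (le_trans (HM0 x))// (le_trans (ler_norm _))// lerDl sumr_ge0.
move=> i; rewrite (le_trans (HM i x))// (le_trans (ler_norm _))//.
by rewrite /B (bigD1 i)//= addrA (addrC `|M0|) -addrA lerDl addr_ge0// sumr_ge0.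
Qed.

Lemma op_class_Dw P f s : op_class P -> P f -> P (Dw s f).
Proof. by move=> oP Pf; elim: s => //= i s IH; have [] := oP _ IH. Qed.

Lemma op_class_words P f k N : op_class P -> P f ->
  exists2 M, 0 <= M & forall s x, (size s <= k)%N -> n1 (Dw s f x) <= M * jbi N x.
Proof.
move=> oP; elim: k f => [|k IH] f Pf.
  have [M M0 HM] := op_class_decay N oP Pf; exists M => // s x.
  by rewrite leqn0 => /nilP ->; exact: HM.
have [M0 M00 HM0] := IH _ Pf.
have H i : exists M, 0 <= M /\ forall s x, (size s <= k)%N -> n1 (Dw s (partial i f) x) <= M * jbi N x.
  have Pif : P (partial i f) by have [] := oP _ Pf.
  by have [M ? ?] := IH _ Pif; exists M.
have /choice[M HM] := H.
exists (M0 + \sum_i M i); first by rewrite addr_ge0// sumr_ge0// => i _; case: (HM i).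
move=> s x; case/lastP: s => [_|s i].
  apply: le_trans (HM0 [::] x isT) _; rewrite ler_wpM2r// lerDl.
  by apply: sumr_ge0 => i _; case: (HM i).
rewrite size_rcons ltnS => sk; rewrite -cats1 Dw_cat /=.
have [M0i /(_ _ x sk) h] := HM i.
apply: le_trans h _; rewrite ler_wpM2r// (bigD1 i)//= addrCA lerDl addr_ge0//.
by apply: sumr_ge0 => j _; case: (HM j).
Qed.

Lemma monomial_le_jb (b : multiindex d) (x : Rd) : `|monomial b x| <= jb x ^+ mlen b.
Proof.
rewrite /monomial normr_prod /mlen expr_sum; apply: ler_prod => i _.
rewrite normr_ge0 normrX /=; apply: lerXn2r; rewrite ?nnegrE//; exact: coord_le_jb.
Qed.

Lemma wnorm_le (w : Rd -> R) k l lam f (M : R) :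
  (forall s x, (size s <= k)%N -> jb x ^+ l * n1 (Dw s f x) * expR (lam * w x) <= M) ->
  (wnorm w k l lam f <= M%:E)%E.
Proof.
move=> H; apply: ge_ereal_sup => _ [a [b [x [ak bl ->]]]]; rewrite lee_fin.
apply: le_trans (H (word a) x _); last by rewrite size_word.
rewrite mderiv_word ler_wpM2r ?expR_ge0// ler_pM ?cmod_ge0 ?cmod_le_n1//.
exact: le_trans (monomial_le_jb _ _) (jbX_mono _ _).
Qed.

Definition mono_pow i (n : nat) : multiindex d := fun j => if j == i then n else 0%N.

Lemma mlen_mono_pow i n : mlen (mono_pow i n) = n.
Proof.
rewrite /mlen (bigD1 i)//= /mono_pow eqxx big1 ?addn0// => j /negbTE -> //.
Qed.

Lemma monomial_mono_pow i n (x : Rd) : monomial (mono_pow i n) x = x ord0 i ^+ n.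
Proof.
rewrite /monomial (bigD1 i)//= /mono_pow eqxx big1 ?mulr1// => j /negbTE -> //.
Qed.

Lemma monomial0 (x : Rd) : monomial (@mindex0 d) x = 1.
Proof. by rewrite /monomial big1. Qed.

Lemma mlen0 : mlen (@mindex0 d) = 0%N.
Proof. by rewrite /mlen big1. Qed.

Lemma wnorm_bound (w : Rd -> R) k l lam f (M : R) :
  (wnorm w k l lam f < M%:E)%E -> forall (a : multiindex d) x, (mlen a <= k)%N ->
  jb x ^+ l * (n1 (mderiv a f x) * expR (lam * w x)) <= 2 ^+ l.+2 * M.
Proof.
move=> H a x ak.
have B (b : multiindex d) : (mlen b <= l)%N ->
    `|monomial b x| * (n1 (mderiv a f x) * expR (lam * w x)) <= 2 * M.
  move=> bl; have : (`|monomial b x| * cmod (mderiv a f x) * expR (lam * w x) <= M).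
    rewrite -lee_fin; apply: le_trans (ltW H); apply: ereal_sup_ubound.
    by exists a, b, x.
  move=> h; rewrite -(ler_pM2l (ltr0n R 2)) in h; apply: le_trans h.
  rewrite -!mulrA [leRHS]mulrCA ler_wpM2l// mulrA ler_wpM2r ?expR_ge0//.
  exact: n1_le_cmod.
have c0 : 0 <= n1 (mderiv a f x) * expR (lam * w x).
  by rewrite mulr_ge0 ?n1_ge0 ?expR_ge0.
rewrite (exprSr 2 l.+1) -mulrA; apply: jb_exp_le => //.
  by have := B (@mindex0 d); rewrite mlen0 monomial0 normr1 mul1r; exact.
by move=> i; have := B (mono_pow i l); rewrite mlen_mono_pow monomial_mono_pow normrX; exact.
Qed.

Lemma op_class_smooth P f : op_class P -> P f -> smooth f.
Proof.
by move=> oP Pf s x; have [+ _ _ _] := oP _ (op_class_Dw s oP Pf); exact.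
Qed.

Lemma op_class_schwartz P f : op_class P -> P f -> schwartz f.
Proof.
move=> oP Pf; split; first exact: op_class_smooth oP Pf.
move=> k; have [M M0 HM] := op_class_words k k oP Pf.
apply: (@le_lt_trans _ _ M%:E); last exact: ltry.
apply: wnorm_le => s x sk; rewrite mulr0 expR0 mulr1.
by rewrite mulrC -ler_pdivlMr//; exact: HM.
Qed.

(** The linear span, as a predicate: a generating family whose derivatives and
multiples by coordinates lie in its span yields a class as above. *)
Inductive hull (G : set (Rd -> C)) : set (Rd -> C) :=
| hull_gen g of G g : hull G g
| hull_add f g of hull G f & hull G g : hull G (fun x => f x + g x)
| hull_scale (c : C) f of hull G f : hull G (fun x => c * f x).

Lemma hull_op_class G :
  (forall g, G g -> [/\ cdiff g, forall i, hull G (partial i g),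
     forall i, hull G (fun x => cx i x * g x) & exists M, forall x, n1 (g x) <= M]) ->
  op_class (hull G).
Proof.
move=> H f; elim => [g /H//|{}f g _ [f1 f2 f3 [M f4]] _ [g1 g2 g3 [N g4]]|c {}f _ [f1 f2 f3 [M f4]]].
  split; first exact: cdiffD.
  - by move=> i; rewrite partialD//; exact: hull_add.
  - by move=> i; under eq_fun do rewrite mulrDr; exact: hull_add.
  - by exists (M + N) => x; exact: le_trans (n1D _ _) (lerD _ _).
split; first by apply: cdiffM => //; exact: cdiff_cst.
- by move=> i; rewrite partialZ//; exact: hull_scale.
- by move=> i; under eq_fun do rewrite mulrCA; exact: hull_scale.
- exists (n1 c * M) => x; apply: le_trans (n1M _ _) _.
  by rewrite ler_wpM2l ?n1_ge0.
Qed.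

Lemma hull_schwartz G :
  (forall g, G g -> [/\ cdiff g, forall i, hull G (partial i g),
     forall i, hull G (fun x => cx i x * g x) & exists M, forall x, n1 (g x) <= M]) ->
  forall g, G g -> schwartz g.
Proof.
by move=> H g Gg; apply: (op_class_schwartz (hull_op_class H)); exact: hull_gen.
Qed.

Definition cxs (m : seq 'I_d) (x : Rd) : C := \prod_(j <- m) cx j x.

Lemma cdiff_cxs m : cdiff (cxs m).
Proof.
elim: m => [|j m IH].
  rewrite (_ : cxs _ = fun=> 1); first exact: (cdiff_cst 1).
  by apply/funext => x; rewrite /cxs big_nil.
rewrite (_ : cxs _ = fun x => cx j x * cxs m x); first by apply: cdiffM => //; exact: cdiff_cx.
by apply/funext => x; rewrite /cxs big_cons.
Qed.

Lemma n1_cx i (x : Rd) : n1 (cx i x) = `|x ord0 i|.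
Proof. by rewrite /n1 /= normr0 addr0. Qed.

Lemma n1_cxs_le m (x : Rd) : n1 (cxs m x) <= jb x ^+ size m.
Proof.
rewrite /cxs; elim: m => [|j m IH].
  by rewrite big_nil expr0 /n1 /= normr1 normr0 addr0.
rewrite big_cons exprS (le_trans (n1M _ _))// ler_pM ?n1_ge0//.
by rewrite n1_cx coord_le_jb.
Qed.

Lemma hull_cx G i f : (forall j g, G g -> hull G (fun x => cx j x * g x)) ->
  hull G f -> hull G (fun x => cx i x * f x).
Proof.
move=> H; elim => [g /H//|{}f g _ IH1 _ IH2|c {}f _ IH].
  by under eq_fun do rewrite mulrDr; exact: hull_add.
by under eq_fun do rewrite mulrCA; exact: hull_scale.
Qed.

Lemma partial_cxs_hull G m s f : cdiff (Dw s f) ->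
  (forall m' t, G (fun x => cxs m' x * Dw t f x)) ->
  forall i, hull G (partial i (fun x => cxs m x * Dw s f x)).
Proof.
move=> ds HG i.
have mulx j g' : (exists m' t, g' = (fun x => cxs m' x * Dw t f x)) ->
    hull G (fun x => cx j x * g' x).
  move=> [m' [t ->]]; apply: hull_gen.
  rewrite (_ : (fun x => _) = (fun x => cxs (j :: m') x * Dw t f x)) //.
  by apply/funext => x; rewrite /cxs big_cons mulrA.
have E0 t : (fun x => cxs [::] x * Dw t f x) = Dw t f.
  by apply/funext => x; rewrite /cxs big_nil mul1r.
pose G' := [set g' | exists m' t, g' = (fun x => cxs m' x * Dw t f x)].
have sub g' : hull G' g' -> hull G g'.
  elim=> [h [m' [t ->]]|h k _ IH1 _ IH2|c h _ IH].
  - exact/hull_gen/HG.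
  - exact: hull_add.
  - exact: hull_scale.
apply: sub; elim: m => [|j m IH].
  by rewrite E0; apply: hull_gen; exists [::], (i :: s); rewrite E0.
rewrite (_ : (fun x => cxs (j :: m) x * _) = (fun x => cx j x * (cxs m x * Dw s f x))); last first.
  by apply/funext => x; rewrite /cxs big_cons mulrA.
rewrite partialM; [|exact: cdiff_cx|by apply: cdiffM => //; exact: cdiff_cxs].
rewrite partial_cx; apply: hull_add.
  by apply: hull_scale; apply: hull_gen; exists m, s.
apply: hull_cx IH => k _ [m' [t ->]]; apply: hull_gen; exists (k :: m'), t.
by apply/funext => x; rewrite /cxs big_cons mulrA.
Qed.

Lemma schwartz_words f k N : schwartz f ->
  exists2 M, 0 <= M & forall s x, (size s <= k)%N -> n1 (Dw s f x) <= M * jbi N x.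
Proof.
move=> [sf H]; pose n := maxn k N.
have [M HM] : exists M : R, (wnorm (fun=> 0%R) n n 1 f < M%:E)%E.
  have := H n; case: (wnorm _ _ _ _ _) => [r _|//|_].
    by exists (r + 1); rewrite lte_fin ltrDl.
  by exists 0; rewrite ltNyr.
have B := wnorm_bound HM.
have B' s x : (size s <= k)%N -> n1 (Dw s f x) <= (2 ^+ n.+2 * M) * jbi N x.
  move=> sk; rewrite /jbi ler_pdivlMr// mulrC.
  have [a as_ ->] := Dw_mderiv s sf.
  have := B a x; rewrite mulr0 expR0 mulr1 as_ (leq_trans sk) ?leq_maxl// => /(_ isT).
  apply: le_trans; rewrite ler_wpM2r ?n1_ge0//; apply: jbX_mono; exact: leq_maxr.
exists (2 ^+ n.+2 * M) => //.
have := le_trans (n1_ge0 _) (B' [::] 0 isT).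
by rewrite pmulr_lge0.
Qed.

(** The span of all x^m D^s f is stable under both operations and bounded, the
seminorms of f being what bounds its generators. *)
Lemma schwartz_op_class : op_class (@schwartz R d).
Proof.
move=> f Sf; pose G := [set g | exists m s, g = (fun x => cxs m x * Dw s f x)].
have HG m s : G (fun x => cxs m x * Dw s f x) by exists m, s.
have sf := Sf.1.
have oG : op_class (hull G).
  apply: hull_op_class => _ [m [s ->]]; split.
  - by apply: cdiffM; [exact: cdiff_cxs|exact: smooth_cdiff].
  - by apply: partial_cxs_hull => //; exact: smooth_cdiff.
  - move=> i; apply: hull_gen; exists (i :: m), s.
    by apply/funext => x; rewrite /cxs big_cons mulrA.
  - have [M M0 HM] := schwartz_words (size s) (size m) Sf.
    exists M => x; apply: le_trans (n1M _ _) _.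
    apply: le_trans (ler_pM (n1_ge0 _) (n1_ge0 _) (n1_cxs_le m x) (HM s x (leqnn _))) _.
    by rewrite mulrCA mulfV ?mulr1// lt0r_neq0.
have Gf : hull G f.
  have := hull_gen (HG [::] [::]); congr hull.
  by apply/funext => x; rewrite /cxs big_nil mul1r.
have [h1 h2 h3 h4] := oG _ Gf; split => //.
  by move=> i; exact: (op_class_schwartz oG (h2 i)).
by move=> i; exact: (op_class_schwartz oG (h3 i)).
Qed.

Lemma hull_schwartz_sub f : hull (@schwartz R d) f -> schwartz f.
Proof.
apply: op_class_schwartz; apply: hull_op_class => g /schwartz_op_class[g1 g2 g3 g4].
by split => // i; apply: hull_gen.
Qed.

Lemma schwartzD f g : schwartz f -> schwartz g -> schwartz (fun x => f x + g x).
Proof. by move=> sf sg; apply: hull_schwartz_sub; apply: hull_add; exact: hull_gen. Qed.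

Lemma schwartzZ (c : C) f : schwartz f -> schwartz (fun x => c * f x).
Proof. by move=> sf; apply: hull_schwartz_sub; apply: hull_scale; exact: hull_gen. Qed.

Lemma schwartz_partial i f : schwartz f -> schwartz (partial i f).
Proof. by move=> /schwartz_op_class[]. Qed.

Lemma schwartz_Dw s f : schwartz f -> schwartz (Dw s f).
Proof. by move=> sf; apply: op_class_Dw => //; exact: schwartz_op_class. Qed.

Lemma schwartz_cx i f : schwartz f -> schwartz (fun x => cx i x * f x).
Proof. by move=> /schwartz_op_class[]. Qed.

Lemma schwartz_cdiff f : schwartz f -> cdiff f.
Proof. by move=> /schwartz_op_class[]. Qed.

Lemma schwartz_cmeasurable f : schwartz f -> cmeasurable f.
Proof. by move=> /schwartz_cdiff/cdiff_measurable. Qed.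

Lemma schwartz_decay f N : schwartz f ->
  exists2 M, 0 <= M & forall x, n1 (f x) <= M * jbi N x.
Proof. exact: op_class_decay schwartz_op_class. Qed.

Lemma schwartz0 : schwartz (fun _ : Rd => 0 : C).
Proof.
apply: (@op_class_schwartz [set fun=> 0]) => //= _ ->; split.
- exact: (cdiff_cst 0).
- by move=> i; rewrite partial_cst.
- by move=> i; apply/funext => x; rewrite mulr0.
- by exists 0 => x; rewrite n10.
Qed.

Lemma schwartz_sum (I : Type) (r : seq I) (F : I -> Rd -> C) :
  (forall k, schwartz (F k)) -> schwartz (fun x => \sum_(i <- r) F i x).
Proof.
move=> sF; elim: r => [|i r IH]; first by under eq_fun do rewrite big_nil; exact: schwartz0.
by under eq_fun do rewrite big_cons; exact: schwartzD.
Qed.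

Lemma schwartz_cxX i n f : schwartz f -> schwartz (fun x => cx i x ^+ n * f x).
Proof.
move=> sf; elim: n => [|n IH]; first by under eq_fun do rewrite expr0 mul1r.
by under eq_fun do rewrite exprS -mulrA; exact: schwartz_cx.
Qed.

Lemma schwartzM f g : schwartz f -> schwartz g -> schwartz (fun x => f x * g x).
Proof.
move=> sf sg.
pose G := [set h | exists u v : Rd -> C, [/\ schwartz u, schwartz v & h = (fun x => u x * v x)]].
have GP (u v : Rd -> C) : schwartz u -> schwartz v -> G (fun x => u x * v x) by move=> ? ?; exists u, v.
apply: (@hull_schwartz G); last exact: GP.
move=> _ [u [v [su sv ->]]]; split.
- by apply: cdiffM; exact: schwartz_cdiff.
- move=> i; rewrite partialM; [|exact: schwartz_cdiff|exact: schwartz_cdiff].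
  by apply: hull_add; apply: hull_gen; apply: GP => //; exact: schwartz_partial.
- move=> i; under eq_fun do rewrite mulrA.
  by apply: hull_gen; apply: GP => //; exact: schwartz_cx.
- have [M M0 HM] := schwartz_decay 0 su; have [N N0 HN] := schwartz_decay 0 sv.
  exists (M * N) => x; apply: le_trans (n1M _ _) _.
  apply: ler_pM; rewrite ?n1_ge0//.
    by have := HM x; rewrite /jbi expr0 invr1 mulr1.
  by have := HN x; rewrite /jbi expr0 invr1 mulr1.
Qed.

Lemma schwartz_integrable f : schwartz f -> cintegrable f.
Proof.
move=> sf; have [M M0 HM] := schwartz_decay d.*2 sf.
apply: (cintegrable_dom (schwartz_cmeasurable sf) _ HM).
exact/rintegrableZ/rintegrable_jbi.
Qed.

End schwartz_class.

(** * The Fourier transform *)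

Section real_trig.
Variable R : realType.
Implicit Types t : R.

Lemma abs_MVT0 (f df : R -> R) (M t : R) : (forall s : R, is_derive s 1 f (df s)) ->
  (forall s, `|s| <= `|t| -> `|df s| <= M) -> `|f t - f 0| <= M * `|t|.
Proof.
move=> fd H; have [t0|t0] := leP 0 t.
  have [c /andP[c0 ct] ->] := real_MVT t0 fd.
  rewrite normrM ler_wpM2r//; apply: H.
  by rewrite !ger0_norm.
have fd' (s : R) : is_derive s 1 (fun u => f (- u)) (- df (- s)).
  have := fd (- s) => h; have := @is_derive1_comp R f -%R s _ _ h (is_deriveNid s 1).
  by rewrite mulrN1.
have nt : 0 <= - t by rewrite oppr_ge0 ltW.
have [c /andP[c0 ct]] := real_MVT nt fd'.
rewrite opprK oppr0 => ->; rewrite normrM normrN (normrN t) ler_wpM2r//; apply: H.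
by rewrite normrN ger0_norm// (ltr0_norm t0).
Qed.

Lemma abs_sin_le t : `|sin t| <= `|t|.
Proof.
have := @abs_MVT0 sin cos 1 t (@is_derive_sin R) (fun s _ => cos_max s).
by rewrite sin0 subr0 mul1r.
Qed.

Lemma abs_cosB1_le2 t : `|cos t - 1| <= `|t| ^+ 2.
Proof.
have := @abs_MVT0 cos (fun s => - sin s) `|t| t (@is_derive_cos R).
rewrite cos0 expr2; apply=> s st; rewrite normrN.
exact: le_trans (abs_sin_le s) st.
Qed.

Lemma abs_cosB1_le t : `|cos t - 1| <= `|t|.
Proof.
have := @abs_MVT0 cos (fun s => - sin s) 1 t (@is_derive_cos R).
by rewrite cos0 mul1r; apply=> s _; rewrite normrN sin_max.
Qed.

Lemma abs_sinB_le t : `|sin t - t| <= `|t| ^+ 2.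
Proof.
have := @abs_MVT0 (fun s => sin s - s) (fun s => cos s - 1) `|t| t.
rewrite sin0 subr0 subr0 expr2; apply=> s st.
exact: le_trans (abs_cosB1_le s) st.
Qed.

(** Second-order expansion of e^(i t), the source of every differentiation under
the integral sign. *)
Lemma cis_taylor2 t : n1 (cis t - 1 - Complex 0 t) <= 2 * `|t| ^+ 2.
Proof.
rewrite /n1 !ReD !ImD !ReN !ImN /= !oppr0 !addr0.
by rewrite mulr_natl mulr2n lerD// ?abs_cosB1_le2// abs_sinB_le.
Qed.

Lemma real_taylor1 (f df ddf : R -> R) (M t : R) : 0 <= t ->
  (forall s : R, is_derive s 1 f (df s)) -> (forall s : R, is_derive s 1 df (ddf s)) ->
  (forall s, 0 <= s <= t -> `|ddf s| <= M) ->
  `|f t - f 0 - t * df 0| <= M * t ^+ 2.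
Proof.
move=> t0 d1 d2 H.
have [c /andP[c0 ct]] := real_MVT t0 d1 => ->.
have [b /andP[b0 bc] E] := real_MVT c0 d2.
rewrite (mulrC t) -mulrBl E !normrM (ger0_norm t0) (ger0_norm c0) expr2 mulrA ler_wpM2r//.
apply: ler_pM => //; apply: H.
by rewrite b0 (le_trans bc).
Qed.

End real_trig.

Section fourier_analysis.
Variables (R : realType) (d : nat).
Local Notation Rd := 'rV[R]_d.
Local Notation C := R[i].
Local Notation mu := (lebesgue_rV R d).
Local Notation e_ := (fun i : 'I_d => delta_mx ord0 i : Rd).
Local Notation cx := (@cx R d).
Local Notation Dw := (@Dw R d).
Implicit Types (f g : Rd -> C) (i j : 'I_d) (s : R) (x y xi : Rd).

Lemma dotpC x y : dotp x y = dotp y x.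
Proof. by apply: eq_bigr => i _; rewrite mulrC. Qed.

Lemma dotpDl x y z : dotp (x + y) z = dotp x z + dotp y z.
Proof. by rewrite /dotp -big_split /=; apply: eq_bigr => i _; rewrite mxE mulrDl. Qed.

Lemma dotpZl s x y : dotp (s *: x) y = s * dotp x y.
Proof. by rewrite /dotp mulr_sumr; apply: eq_bigr => i _; rewrite mxE mulrA. Qed.

Lemma dotpDr x y z : dotp x (y + z) = dotp x y + dotp x z.
Proof. by rewrite dotpC dotpDl !(dotpC x). Qed.

Lemma dotpZr s x y : dotp x (s *: y) = s * dotp x y.
Proof. by rewrite dotpC dotpZl dotpC. Qed.

Lemma dotp0 x : dotp x 0 = 0.
Proof. by rewrite /dotp big1// => i _; rewrite mxE mulr0. Qed.

Lemma dotp_e x i : dotp x (e_ i) = x ord0 i.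
Proof.
rewrite /dotp (bigD1 i)//= big1 ?addr0; first by rewrite mxE !eqxx mulr1.
by move=> j ji; rewrite mxE eqxx /= (negbTE ji) mulr0.
Qed.

Lemma dotp_le x y : `|dotp x y| <= d%:R * (`|x| * `|y|).
Proof.
rewrite (le_trans (ler_norm_sum _ _ _))//.
have -> : d%:R * (`|x| * `|y|) = \sum_(i < d) (`|x| * `|y|).
  by rewrite sumr_const card_ord mulr_natl.
by apply: ler_sum => i _; rewrite normrM ler_pM// coord_le_norm.
Qed.

Definition fker s xi x : C := cis (- (2 * pi * (s * dotp xi x))).

(** The dilation s unifies the Fourier transform (s = 1) and its inverse
(s = -1). *)
Definition ft s f xi : C := fourier f (s *: xi).

Lemma ftE s f xi : ft s f xi = cintegral (fun x => f x * fker s xi x).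
Proof. by apply: eq_cintegral => x; rewrite dotpZl. Qed.

Lemma ft1 f : ft 1 f = fourier f.
Proof. by apply/funext => x; rewrite /ft scale1r. Qed.

Lemma fkerC s x y : fker s x y = fker s y x.
Proof. by rewrite /fker dotpC. Qed.

Lemma fkerDl s x y t : fker s (x + y) t = fker s x t * cis (- (2 * pi * (s * dotp y t))).
Proof. by rewrite /fker -cisD; congr cis; rewrite dotpDl; ring. Qed.

Lemma n1_fker s xi x : n1 (fker s xi x) <= 2.
Proof. exact: n1_cis. Qed.

Lemma fker0 s x : fker s 0 x = 1.
Proof. by rewrite /fker dotpC dotp0 !mulr0 oppr0 cis0. Qed.

Lemma cmeasurable_fker s xi : cmeasurable (fker s xi).
Proof.
apply: cmeasurable_cis; apply: measurableT_comp => //.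
by apply: measurable_funM => //; apply: measurable_funM => //; exact: measurable_dotp.
Qed.

Lemma cintegrableMb f g (M : R) : cintegrable f -> cmeasurable g ->
  (forall x, n1 (g x) <= M) -> cintegrable (fun x => f x * g x).
Proof.
move=> cf mg gM; apply: (cintegrable_dom _ (rintegrableZ M (rintegrable_n1 cf))).
  by apply: cmeasurableM => //; exact: cintegrable_measurable.
by move=> x; rewrite (le_trans (n1M _ _))// mulrC ler_wpM2r ?n1_ge0.
Qed.

Lemma cintegrable_fker s f xi : cintegrable f -> cintegrable (fun x => f x * fker s xi x).
Proof.
by move=> cf; apply: cintegrableMb => //; [exact: cmeasurable_fker|move=> x; exact: n1_fker].
Qed.

Lemma n1_ft_le s f (h : Rd -> R) xi : cmeasurable f -> rintegrable h ->
  (forall x, n1 (f x) <= h x) -> n1 (ft s f xi) <= 2 * \int[mu]_x h x.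
Proof.
move=> mf ih fh; rewrite ftE -RintegralZl//.
apply: n1_cintegral_le; [|exact: rintegrableZ|].
  by apply: cmeasurableM => //; exact: cmeasurable_fker.
move=> x; rewrite (le_trans (n1M _ _))// mulrC ler_pM ?n1_ge0 ?n1_fker//.
Qed.

Lemma ftD s f g xi : cintegrable f -> cintegrable g ->
  ft s (fun x => f x + g x) xi = ft s f xi + ft s g xi.
Proof.
move=> cf cg; rewrite !ftE -cintegralD; [|exact: cintegrable_fker..].
by apply: eq_cintegral => x; rewrite mulrDl.
Qed.

Lemma ftZ s (c : C) f xi : cintegrable f ->
  ft s (fun x => c * f x) xi = c * ft s f xi.
Proof.
move=> cf; rewrite !ftE -cintegralZ; last exact: cintegrable_fker.
by apply: eq_cintegral => x; rewrite mulrA.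
Qed.

Lemma ft_translate s f y xi : cintegrable f ->
  ft s (fun x => f (x + y)) xi = fker (- s) xi y * ft s f xi.
Proof.
move=> cf; have cg := cintegrable_fker s xi cf.
have E x : f (x + y) * fker s xi x = fker (- s) xi y * (f (x + y) * fker s xi (x + y)).
  rewrite mulrCA; congr (_ * _); rewrite /fker -cisD dotpDr; congr cis.
  by rewrite mulNr mulrN opprK; ring.
rewrite !ftE; under eq_cintegral do rewrite E.
rewrite cintegralZ; last exact: (cintegrable_translate y cg).
by rewrite (cintegral_translate y (cintegrable_measurable cg)).
Qed.

(** A bound for the Fourier transform from functions of decay 2 d to bounded
functions. *)
Definition K0 : R := 2 * \int[mu]_x jbi d.*2 x.

Lemma K0_ge0 : 0 <= K0.
Proof. by rewrite mulr_ge0// rintegral_ge0. Qed.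

Definition decays f (M : R) (N : nat) := cmeasurable f /\ forall x, n1 (f x) <= M * jbi N x.

Lemma decays_M_ge0 f M N : decays f M N -> 0 <= M.
Proof.
by move=> [_ /(_ 0) h]; have := le_trans (n1_ge0 _) h; rewrite pmulr_lge0.
Qed.

Lemma decays_le f M N n : (n <= N)%N -> decays f M N -> decays f M n.
Proof.
move=> nN dM; have M0 := decays_M_ge0 dM; have [mf fM] := dM; split => // x.
by apply: le_trans (fM x) _; rewrite ler_wpM2l// jbi_mono.
Qed.

Lemma decays_integrable f M N : (d.*2 <= N)%N -> decays f M N -> cintegrable f.
Proof.
move=> dN [mf fM]; apply: (cintegrable_dom mf _ fM).
exact/rintegrableZ/rintegrable_jbi.
Qed.

Lemma decays_ft_le s f M xi : decays f M d.*2 -> n1 (ft s f xi) <= K0 * M.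
Proof.
move=> [mf fM].
have := n1_ft_le s xi mf (rintegrableZ M (@rintegrable_jbi R d _ (leqnn _))) fM.
by rewrite RintegralZl//; [rewrite mulrCA mulrC|exact: rintegrable_jbi].
Qed.

Lemma cmeasurable_cx i : cmeasurable (cx i).
Proof. by apply: cmeasurable_real; exact: measurable_coord. Qed.

Lemma decays_cx f M N i (c : C) : decays f M N.+1 ->
  decays (fun x => c * (cx i x * f x)) (n1 c * M) N.
Proof.
move=> dM; have M0 := decays_M_ge0 dM; have [mf fM] := dM; split.
  apply: cmeasurableM; first exact: cmeasurable_cst.
  by apply: cmeasurableM => //; exact: cmeasurable_cx.
move=> x; rewrite (le_trans (n1M _ _))// -mulrA ler_wpM2l ?n1_ge0//.
rewrite (le_trans (n1M _ _))// n1_cx.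
apply: (@le_trans _ _ (jb x * (M * jbi N.+1 x))).
  by rewrite ler_pM ?n1_ge0 ?coord_le_jb.
rewrite mulrCA ler_wpM2l// -[jb x]expr1 jbi_jb//= subn1 //.
Qed.

(** Derivation of ft s f is multiplication of f by dfac s times the coordinate. *)
Definition dfac s : C := Complex 0 (- (2 * pi * s)).

(** Two more powers of decay than integrability requires pay for the quadratic
remainder in the expansion of the kernel. *)
Lemma ft_diff s f M : decays f M (d.*2).+2 ->
  cdiff (ft s f) /\
  forall i, partial i (ft s f) = ft s (fun x => dfac s * (cx i x * f x)).
Proof.
move=> dM; have M0 := decays_M_ge0 dM; have [mf fM] := dM.
have cf : cintegrable f by apply: decays_integrable dM; rewrite leqW// leqW.
have dg i : decays (fun x => dfac s * (cx i x * f x)) (n1 (dfac s) * M) (d.*2).+1.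
  exact: decays_cx.
have cg i : cintegrable (fun x => dfac s * (cx i x * f x)).
  by apply: decays_integrable (dg i); rewrite leqW.
pose B := 2 * pi * s * d%:R.
pose K := 2 * (B ^+ 2 * M).
have main xi h : n1 (ft s f (xi + h) - ft s f xi -
    \sum_i ft s (fun x => dfac s * (cx i x * f x)) xi * Complex (h ord0 i) 0) <=
    (2 * K * \int[mu]_x jbi d.*2 x) * `|h| ^+ 2.
  pose D i x := fker s xi x * (f x * (dfac s * (cx i x * Complex (h ord0 i) 0))).
  have cD i : cintegrable (D i).
    have := cintegrableZ (Complex (h ord0 i) 0) (cintegrable_fker s xi (cg i)).
    by congr cintegrable; apply/funext => x; rewrite /D; ring.
  have [cS ES] := cintegral_sum (index_enum 'I_d) cD.
  have -> : \sum_i ft s (fun x => dfac s * (cx i x * f x)) xi * Complex (h ord0 i) 0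
      = cintegral (fun x => \sum_i D i x).
    rewrite ES; apply: eq_bigr => i _; rewrite ftE mulrC -cintegralZ; last exact: cintegrable_fker.
    by apply: eq_cintegral => x; rewrite /D; ring.
  rewrite !ftE -cintegralB; [|exact: cintegrable_fker..].
  rewrite -cintegralB//; last first.
    have := cintegrableD (cintegrable_fker s (xi + h) cf) (cintegrableN (cintegrable_fker s xi cf)).
    exact.
  rewrite mulrAC -RintegralZl//; last exact: rintegrable_jbi.
  have E x : f x * fker s (xi + h) x - f x * fker s xi x - \sum_i D i x =
     f x * fker s xi x * (cis (- (2 * pi * (s * dotp h x))) - 1 -
      Complex 0 (- (2 * pi * (s * dotp h x)))).
    rewrite fkerDl.
    have -> : \sum_i D i x = f x * fker s xi x * Complex 0 (- (2 * pi * (s * dotp h x))).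
      rewrite (_ : Complex 0 _ = \sum_i dfac s * (cx i x * Complex (h ord0 i) 0)).
        by rewrite mulr_sumr; apply: eq_bigr => i _; rewrite /D mulrA (mulrC (f x)).
      apply: complex_ext; rewrite ?Re_sum ?Im_sum /=.
        by rewrite big1// => i _; rewrite !(mul0r,mulr0,subr0,addr0).
      rewrite /dotp mulr_sumr mulr_sumr -sumrN; apply: eq_bigr => i _ /=.
      by rewrite !(mul0r,mulr0,subr0,addr0,add0r); ring.
    by ring.
  apply: n1_cintegral_le.
  - apply: cmeasurableD; last exact: cmeasurableN (cintegrable_measurable cS).
    apply: cmeasurableD; last apply: cmeasurableN; apply: cmeasurableM => //; exact: cmeasurable_fker.
  - exact/rintegrableZ/rintegrable_jbi.
  move=> x; rewrite E (le_trans (n1M _ _))//.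
  apply: (@le_trans _ _ ((M * jbi (d.*2).+2 x * 2) * (2 * `|- (2 * pi * (s * dotp h x))| ^+ 2))).
    rewrite ler_pM ?n1_ge0 ?cis_taylor2// (le_trans (n1M _ _))//.
    by rewrite ler_pM ?n1_ge0 ?n1_fker.
  have b1 : `|- (2 * pi * (s * dotp h x))| ^+ 2 <= B ^+ 2 * (`|h| ^+ 2 * jb x ^+ 2).
    rewrite -exprMn -exprMn -(real_normK (num_real (B * _))) lerXn2r ?nnegrE//.
    rewrite normrN /B mulrA -(mulrA _ d%:R) normrM [leRHS]normrM ler_wpM2l//.
    rewrite (le_trans (dotp_le _ _))// (le_trans _ (ler_norm _))//.
    by rewrite ler_wpM2l// ler_wpM2l// norm_le_jb.
  have b2 : jb x ^+ 2 * jbi (d.*2).+2 x = jbi d.*2 x by rewrite jbi_jb//= subn2.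
  rewrite -b2 /K.
  have J0 : 0 <= jbi (d.*2).+2 x by [].
  apply: (@le_trans _ _ (M * jbi (d.*2).+2 x * 2 * (2 * (B ^+ 2 * (`|h| ^+ 2 * jb x ^+ 2))))).
    by rewrite ler_wpM2l ?mulr_ge0// ler_wpM2l.
  by rewrite le_eqVlt; apply/orP; left; apply/eqP; ring.
have rmain xi h : `|Re (ft s f (xi + h)) - Re (ft s f xi) -
    \sum_i Re (ft s (fun x => dfac s * (cx i x * f x)) xi) * h ord0 i| <=
    (2 * K * \int[mu]_x jbi d.*2 x) * `|h| ^+ 2.
  apply: le_trans (main xi h); apply: le_trans (Re_le_n1 _).
  rewrite !ReD !ReN Re_sum le_eqVlt; apply/orP; left; apply/eqP.
  by congr `|_ - _|; apply: eq_bigr => i _; rewrite ReM /= mulr0 subr0.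
have imain xi h : `|Im (ft s f (xi + h)) - Im (ft s f xi) -
    \sum_i Im (ft s (fun x => dfac s * (cx i x * f x)) xi) * h ord0 i| <=
    (2 * K * \int[mu]_x jbi d.*2 x) * `|h| ^+ 2.
  apply: le_trans (main xi h); apply: le_trans (Im_le_n1 _).
  rewrite !ImD !ImN Im_sum le_eqVlt; apply/orP; left; apply/eqP.
  by congr `|_ - _|; apply: eq_bigr => i _; rewrite ImM /= mulr0 add0r.
have D1 xi := real_taylor2_diff (f := fun y => Re (ft s f y)) (rmain xi).
have D2 xi := real_taylor2_diff (f := fun y => Im (ft s f y)) (imain xi).
split=> [xi|i]; first by split; [exact: (D1 xi).1|exact: (D2 xi).1].
by apply/funext => xi; apply: complex_ext => /=; [rewrite (D1 xi).2|rewrite (D2 xi).2].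
Qed.

(** The bound is linear in the decay constant of f, with a factor depending only
on the order; this uniformity is what gives continuity of the inclusion between
the spaces of the theorem. *)
Lemma ft_words s k : exists2 A, 0 <= A & forall f M w, decays f M (d.*2 + k).+2 ->
  (size w <= k)%N -> cdiff (Dw w (ft s f)) /\ forall xi, n1 (Dw w (ft s f) xi) <= A * M.
Proof.
elim: k => [|k [A A0 IH]].
  exists K0 => [|f M w]; first exact: K0_ge0.
  rewrite addn0 leqn0 => dM /nilP ->; split; first exact: (ft_diff s dM).1.
  by move=> xi; apply: decays_ft_le; apply: decays_le dM; rewrite leqW// leqW.
exists (K0 + A * n1 (dfac s)).
  by rewrite addr_ge0 ?K0_ge0// mulr_ge0 ?n1_ge0.
move=> f M w dM; have M0 := decays_M_ge0 dM.
have dM2 : decays f M (d.*2).+2 by apply: decays_le dM; rewrite !ltnS leq_addr.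
have [cd E] := ft_diff s dM2.
case/lastP: w => [_|w i].
  split=> // xi; apply: le_trans (decays_ft_le s xi (decays_le _ dM2)) _ => //.
    by rewrite leqW// leqW.
  by rewrite ler_wpM2r// lerDl mulr_ge0 ?n1_ge0.
rewrite size_rcons ltnS => wk; rewrite -cats1 Dw_cat /= E.
have dg : decays (fun x => dfac s * (cx i x * f x)) (n1 (dfac s) * M) (d.*2 + k).+2.
  by apply: decays_cx; move: dM; rewrite addnS.
have [h1 h2] := IH _ _ _ dg wk; split => // xi; apply: le_trans (h2 xi) _.
by rewrite mulrA ler_wpM2r// lerDr K0_ge0.
Qed.

Lemma ft_smooth s f : (forall N, exists M, decays f M N) -> smooth (ft s f).
Proof.
move=> H w x; have [M dM] := H (d.*2 + size w).+2.
have [A _ HA] := ft_words s (size w).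
exact: (HA _ _ _ dM (leqnn _)).1.
Qed.

Lemma schwartz_decays f N : schwartz f -> exists M, decays f M N.
Proof.
move=> sf; have [M M0 HM] := schwartz_decay N sf.
by exists M; split => //; exact: schwartz_cmeasurable.
Qed.

(** One moment suffices here; this is the form in which integral conditions on f
give a continuous transform. *)
Lemma ft_lipschitz_int s f (k : Rd -> R) : cmeasurable f -> rintegrable k ->
  (forall x, jb x * n1 (f x) <= k x) ->
  exists2 A, 0 <= A & forall x y, n1 (ft s f x - ft s f y) <= A * `|x - y|.
Proof.
move=> mf ik fk.
have k0 x : 0 <= k x by apply: le_trans (fk x); rewrite mulr_ge0 ?n1_ge0.
have cf : cintegrable f.
  by apply: (cintegrable_dom mf ik) => x; apply: le_trans (fk x); rewrite ler_peMl ?n1_ge0.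
pose B := 2 * (2 * pi * `|s| * d%:R) : R.
have B0 : 0 <= B by rewrite !mulr_ge0// ?pi_ge0.
have I0 := rintegral_ge0 k0.
exists (2 * B * \int[mu]_x k x); first by apply: mulr_ge0 I0; rewrite mulr_ge0.
move=> x y.
have lip (t : R) : n1 (cis t - 1) <= 2 * `|t|.
  rewrite /n1 !ReD !ImD !ReN !ImN /= oppr0 addr0 mulr_natl mulr2n lerD// ?abs_cosB1_le//.
  exact: abs_sin_le.
rewrite !ftE -cintegralB; [|exact: cintegrable_fker..].
have E t : f t * fker s x t - f t * fker s y t =
    f t * fker s y t * (cis (- (2 * pi * (s * dotp (x - y) t))) - 1).
  by rewrite -{1}(subrK y x) [x - y + y]addrC fkerDl; ring.
rewrite mulrAC -(RintegralZl _ measurableT ik).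
apply: n1_cintegral_le; [|exact: rintegrableZ|].
  by apply: cmeasurableD; last apply: cmeasurableN; apply: cmeasurableM => //; exact: cmeasurable_fker.
move=> t; rewrite E (le_trans (n1M _ _))//.
apply: (@le_trans _ _ ((n1 (f t) * 2) * (B * (`|x - y| * jb t)))).
  rewrite ler_pM ?n1_ge0//.
    by rewrite (le_trans (n1M _ _))// ler_pM ?n1_ge0// n1_fker.
  rewrite (le_trans (lip _))// /B -(mulrA 2 (_ * _)) ler_wpM2l//.
  rewrite normrN !normrM (ger0_norm (pi_ge0 R)) ger0_norm// -!mulrA.
  rewrite ler_wpM2l// ler_wpM2l ?pi_ge0// ler_wpM2l// (le_trans (dotp_le _ _))//.
  by rewrite ler_wpM2l// ler_wpM2l// norm_le_jb.
rewrite (_ : _ * _ = 2 * B * `|x - y| * (jb t * n1 (f t))); last by ring.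
by rewrite ler_wpM2l// mulr_ge0// mulr_ge0.
Qed.

Lemma ft_lipschitz s f M : decays f M (d.*2).+1 ->
  exists2 A, 0 <= A & forall x y, n1 (ft s f x - ft s f y) <= A * `|x - y|.
Proof.
move=> dM; have M0 := decays_M_ge0 dM; have [mf fM] := dM.
apply: (@ft_lipschitz_int s f (fun x => M * jbi d.*2 x)) => //.
  exact/rintegrableZ/rintegrable_jbi.
move=> x.
apply: (@le_trans _ _ (jb x * (M * jbi (d.*2).+1 x))); first by rewrite ler_wpM2l.
by rewrite mulrCA ler_wpM2l// -[jb x]expr1 jbi_jb// subn1.
Qed.

Lemma schwartz_taylor i f : schwartz f -> exists2 M, 0 <= M & forall t x, 0 <= t <= 1 ->
  n1 (f (x + t *: e_ i) - f x - Complex t 0 * partial i f x) <= M * t ^+ 2 * jbi d.*2 x.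
Proof.
move=> sf; have [M M0 HM] := schwartz_decay d.*2 (schwartz_partial i (schwartz_partial i sf)).
exists (2 * (M * 2 ^+ d.*2)); first by rewrite !mulr_ge0// exprn_ge0.
move=> t x /andP[t0 t1].
have en : `|e_ i| <= 1.
  apply: norm_rV_le => // j; rewrite mxE eqxx /=.
  by case: eqP; rewrite ?normr1 ?normr0.
have H (u : R) : 0 <= u <= t -> M * jbi d.*2 (x + u *: e_ i) <= M * 2 ^+ d.*2 * jbi d.*2 x.
  move=> /andP[u0 ut]; rewrite -mulrA ler_wpM2l// /jbi ler_pdivlMr// ler_pdivrMl//.
  rewrite mulrC -exprMn lerXn2r ?nnegrE// ?mulr_ge0//.
  have -> : x = (x + u *: e_ i) + (- (u *: e_ i)) by rewrite addrK.
  rewrite addrNK; apply: le_trans (jbD _ _) _.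
  rewrite mulrC ler_wpM2r// jbN /jb normrZ ger0_norm//.
  have := ler_pM u0 (normr_ge0 _) (le_trans ut t1) en; lra.
have dff g : schwartz g -> forall y, differentiable (fun y => Re (g y) : R) y /\
   differentiable (fun y => Im (g y) : R) y by move=> /schwartz_cdiff.
have dx (g : Rd -> C) : schwartz g -> forall u : R,
    is_derive u 1 (fun u => Re (g (x + u *: e_ i))) (Re (partial i g (x + u *: e_ i))) /\
    is_derive u 1 (fun u => Im (g (x + u *: e_ i))) (Im (partial i g (x + u *: e_ i))).
  move=> sg u; have [d1 d2] := schwartz_cdiff sg (x + u *: e_ i).
  split; [exact: (is_derive_line d1)|exact: (is_derive_line d2)].
have s1 := schwartz_partial i sf.
have T1 := real_taylor1 t0 (fun u => (dx _ sf u).1) (fun u => (dx _ s1 u).1)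
  (fun u hu => le_trans (Re_le_n1 _) (le_trans (HM _) (H u hu))).
have T2 := real_taylor1 t0 (fun u => (dx _ sf u).2) (fun u => (dx _ s1 u).2)
  (fun u hu => le_trans (Im_le_n1 _) (le_trans (HM _) (H u hu))).
rewrite scale0r addr0 in T1; rewrite scale0r addr0 in T2.
rewrite {1}/n1 !ReD !ImD !ReN !ImN ReM ImM /=.
rewrite !mul0r subr0 addr0.
apply: le_trans (lerD T1 T2) _.
by rewrite le_eqVlt; apply/orP; left; apply/eqP; ring.
Qed.

(** For identities obtained as limits of difference quotients. *)
Lemma n1_small_eq0 (z : C) (K : R) : (forall t : R, 0 < t <= 1 -> n1 z <= K * t) -> z = 0.
Proof.
move=> H; apply: n1_eq0; apply/ler_addgt0Pr => e e0; rewrite add0r.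
pose t := Num.min 1 (e / (`|K| + 1)).
have K1 : 0 < `|K| + 1 by rewrite ltr_wpDl.
have t0 : 0 < t by rewrite lt_min ltr01 divr_gt0.
have t1 : t <= 1 by rewrite ge_min lexx.
have te : t <= e / (`|K| + 1) by rewrite ge_min lexx orbT.
apply: le_trans (H t _) _; first by rewrite t0.
apply: (@le_trans _ _ ((`|K| + 1) * t)).
  apply: ler_wpM2r; first exact: ltW.
  by rewrite (le_trans (ler_norm _))// lerDl.
by rewrite mulrC -ler_pdivlMr.
Qed.

Lemma fker_e s xi t i : fker (- s) xi (t *: e_ i) = cis (2 * pi * s * xi ord0 i * t).
Proof. by rewrite /fker dotpZr dotp_e; congr cis; ring. Qed.

(** Both sides are the limit as t -> 0 of ft s ((f(. + t e_i) - f) / t): on the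
left by schwartz_taylor, on the right because translation becomes
multiplication by a character. *)
Lemma ft_partial s f i xi : schwartz f ->
  ft s (partial i f) xi = Complex 0 (2 * pi * s * xi ord0 i) * ft s f xi.
Proof.
move=> sf; have [M M0 HM] := schwartz_taylor i sf.
have cf := schwartz_integrable sf.
have cp := schwartz_integrable (schwartz_partial i sf).
pose a := 2 * pi * s * xi ord0 i.
apply/esym/eqP; rewrite -subr_eq0; apply/eqP.
apply: (@n1_small_eq0 _ (2 * (M * \int[mu]_x jbi d.*2 x) + 2 * `|a| ^+ 2 * n1 (ft s f xi))).
move=> t /andP[t0 t1].
have ct := cintegrable_translate (t *: e_ i) cf.
pose g x := f (x + t *: e_ i) - f x - Complex t 0 * partial i f x.
have b1 : n1 (ft s g xi) <= 2 * (M * t ^+ 2 * \int[mu]_x jbi d.*2 x).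
  rewrite -RintegralZl//; last exact: rintegrable_jbi.
  apply: n1_ft_le.
  - apply: cmeasurableD; last first.
      by apply/cmeasurableN/cintegrable_measurable/cintegrableZ.
    by apply: cmeasurableD; [|apply: cmeasurableN]; exact: cintegrable_measurable.
  - exact/rintegrableZ/rintegrable_jbi.
  - by move=> x; apply: HM; rewrite ltW.
have E : ft s g xi = (cis (a * t) - 1) * ft s f xi - Complex t 0 * ft s (partial i f) xi.
  rewrite /g ftD; [|exact: cintegrableD ct (cintegrableN cf)|exact/cintegrableN/cintegrableZ].
  rewrite ftD//; last exact: cintegrableN.
  rewrite ft_translate// fker_e -/a.
  have -> : (fun x => - f x) = (fun x => (-1) * f x) by apply/funext => x; rewrite mulN1r.
  have -> : (fun x => - (Complex t 0 * partial i f x)) = (fun x => (- Complex t 0) * partial i f x).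
    by apply/funext => x; rewrite mulNr.
  by rewrite !ftZ//; ring.
have b2 : n1 ((cis (a * t) - 1 - Complex 0 (a * t)) * ft s f xi) <=
    2 * (`|a| * t) ^+ 2 * n1 (ft s f xi).
  rewrite (le_trans (n1M _ _))// ler_wpM2r ?n1_ge0//.
  by have := cis_taylor2 (a * t); rewrite normrM (ger0_norm (ltW t0)).
rewrite -(ler_pM2l t0) -(n1_sign 0 (_ - _)) expr0 mul1r.
rewrite -{1}(ger0_norm (ltW t0)) -n1_real.
have -> : Complex t 0 * (Complex 0 a * ft s f xi - ft s (partial i f) xi) =
    ft s g xi - (cis (a * t) - 1 - Complex 0 (a * t)) * ft s f xi.
  rewrite E; have -> : Complex 0 (a * t) = Complex t 0 * Complex 0 a.
    by apply: complex_ext => /=; rewrite !(mul0r, mulr0, subr0, addr0)// mulrC.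
  by ring.
apply: le_trans (n1B _ _) _; apply: le_trans (lerD b1 b2) _.
by rewrite le_eqVlt; apply/orP; left; apply/eqP; ring.
Qed.

(** The transforms of Schwartz functions form a class stable under derivation and
multiplication by coordinates, since ft exchanges the two operations. *)
Lemma schwartz_ft s f : s != 0 -> schwartz f -> schwartz (ft s f).
Proof.
move=> s0 sf.
pose P := [set h | exists2 g : Rd -> C, schwartz g & h = ft s g].
apply: (@op_class_schwartz _ _ P); last by exists f.
move=> _ [g sg ->].
have [M dM] := schwartz_decays (d.*2).+2 sg.
have [cd E] := ft_diff s dM; split => //.
- move=> i; rewrite E; exists (fun x => dfac s * (cx i x * g x)) => //.
  exact/schwartzZ/schwartz_cx.
- move=> i; pose c := Complex 0 (- (2 * pi * s)^-1) : C.
  exists (fun x => c * partial i g x); first exact/schwartzZ/schwartz_partial.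
  apply/funext => xi; rewrite ftZ; last exact/schwartz_integrable/schwartz_partial.
  rewrite ft_partial// mulrA; congr (_ * _).
  have ps : 2 * pi * s != 0 by rewrite !mulf_neq0// ?pnatr_eq0// lt0r_neq0// pi_gt0.
  apply: complex_ext => /=; rewrite !(mul0r, mulr0, subr0, addr0)//.
  by rewrite sub0r mulNr opprK mulrA mulVf// mul1r.
- exists (K0 * M) => xi; apply: decays_ft_le; apply: decays_le dM.
  by rewrite leqW// leqW.
Qed.

Lemma ft_fubini s f g : cintegrable f -> cintegrable g ->
  cintegrable (fun xi => f xi * ft s g xi) /\
  cintegral (fun xi => f xi * ft s g xi) = cintegral (fun x => ft s f x * g x).
Proof.
move=> cf cg.
have [f1 f2] := cintegrable_measurable cf; have [g1 g2] := cintegrable_measurable cg.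
pose K xi x := f xi * g x * fker s xi x.
have mth : measurable_fun setT (fun p : Rd * Rd => - (2 * pi * (s * dotp p.1 p.2))).
  apply: measurableT_comp => //; do 2 apply: measurable_funM => //.
  apply: measurable_sum => i; apply: measurable_funM.
    exact: (measurableT_comp (@measurable_coord R d i) measurable_fst).
  exact: (measurableT_comp (@measurable_coord R d i) measurable_snd).
have mc := measurableT_comp (continuous_measurable_fun (@continuous_cos R)) mth.
have ms := measurableT_comp (continuous_measurable_fun (@continuous_sin R)) mth.
have f1' := measurableT_comp f1 (@measurable_fst _ _ Rd Rd).
have f2' := measurableT_comp f2 (@measurable_fst _ _ Rd Rd).
have g1' := measurableT_comp g1 (@measurable_snd _ _ Rd Rd).
have g2' := measurableT_comp g2 (@measurable_snd _ _ Rd Rd).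
have m1 : measurable_fun setT (fun p : Rd * Rd => Re (K p.1 p.2)).
  under eq_fun do rewrite !ReM ImM.
  apply: measurable_funB; apply: measurable_funM => //.
    by apply: measurable_funB; apply: measurable_funM.
  by apply: measurable_funD; apply: measurable_funM.
have m2 : measurable_fun setT (fun p : Rd * Rd => Im (K p.1 p.2)).
  under eq_fun do rewrite ImM ReM ImM.
  apply: measurable_funD; apply: measurable_funM => //.
    by apply: measurable_funB; apply: measurable_funM.
  by apply: measurable_funD; apply: measurable_funM.
have Kb xi x : n1 (K xi x) <= 2 * n1 (f xi) * n1 (g x).
  rewrite (le_trans (n1M _ _))// mulrC -mulrA ler_pM ?n1_ge0 ?n1_fker//; exact: n1M.
have h0 xi : 0 <= 2 * n1 (f xi) by rewrite mulr_ge0 ?n1_ge0.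
have [I1 _ E] := complex_Fubini m1 m2 (rintegrableZ 2 (rintegrable_n1 cf))
  (rintegrable_n1 cg) h0 (fun x => n1_ge0 (g x)) Kb.
have E1 : (fun xi => f xi * ft s g xi) = fun xi => cintegral (K xi).
  apply/funext => xi; rewrite ftE -cintegralZ; last exact: cintegrable_fker.
  by apply: eq_cintegral => x; rewrite mulrA.
rewrite E1; split; first exact: I1.
rewrite E; apply: eq_cintegral => x; rewrite ftE mulrC -cintegralZ; last exact: cintegrable_fker.
by apply: eq_cintegral => xi; rewrite /K fkerC; ring.
Qed.

Lemma ft_exchange s f g : cintegrable f -> cintegrable g ->
  cintegral (fun xi => f xi * ft s g xi) = cintegral (fun x => ft s f x * g x).
Proof. by move=> cf cg; have [] := ft_fubini s cf cg. Qed.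

(** For f merely integrable the transform is continuous, but Fubini gives its
measurability directly. *)
Lemma ft_measurable s f : cintegrable f -> cmeasurable (ft s f).
Proof.
move=> cf; pose g x : C := Complex (jbi d.*2 x) 0.
have cg : cintegrable g.
  apply: (@cintegrable_dom _ _ _ (jbi d.*2)); [|exact: rintegrable_jbi|].
    by apply: cmeasurable_real; exact: measurable_jbi.
  by move=> x; rewrite /n1 /= normr0 addr0 ger0_norm.
have [/cintegrable_measurable m _] := ft_fubini s cg cf.
have mj : cmeasurable (fun x : Rd => Complex (jb x ^+ d.*2) 0 : C).
  by apply: cmeasurable_real; apply: measurable_funX; exact: measurable_jb.
have := cmeasurableM mj m; congr cmeasurable; apply/funext => x.
rewrite mulrA (_ : Complex _ _ * g x = 1) ?mul1r//.
by apply: complex_ext; rewrite ?ReM ?ImM /= !(mulr0, mul0r, subr0, addr0) /jbi ?mulfV ?lt0r_neq0.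
Qed.

End fourier_analysis.

(** * Gaussians *)

Section gaussian.
Variables (R : realType) (d : nat).
Local Notation Rd := 'rV[R]_d.
Local Notation C := R[i].
Local Notation mu := (lebesgue_rV R d).
Local Notation e_ := (fun i : 'I_d => delta_mx ord0 i : Rd).
Local Notation cx := (@cx R d).
Implicit Types (f g : Rd -> C) (i j : 'I_d) (s a t : R) (x y xi : Rd).

Lemma derive_coord (h : Rd -> R) x v : differentiable h x ->
  'D_v h x = \sum_i v ord0 i * 'D_(e_ i) h x.
Proof.
move=> dh; rewrite deriveE// {1}(row_sum_delta v) linear_sum; apply: eq_bigr => i _.
by rewrite linearZ /= deriveE.
Qed.

Lemma partial0_cst f : cdiff f -> (forall i x, partial i f x = 0) -> forall x, f x = f 0.
Proof.
move=> cf H x.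
have h (g : Rd -> R) : (forall x, differentiable g x) ->
    (forall i x, 'D_(e_ i) g x = 0) -> g x = g 0.
  move=> dg Dg.
  have [c _] := real_MVT ler01 (fun u => is_derive_line (dg (0 + u *: x))).
  rewrite derive_coord// big1 => [|i _]; last by rewrite Dg mulr0.
  by rewrite scale0r scale1r addr0 add0r mul0r => /eqP; rewrite subr_eq0 => /eqP.
apply: complex_ext.
  apply: (h (fun x => Re (f x))) => [y|i y]; first exact: (cf y).1.
  exact: (congr1 (@complex.Re R) (H i y)).
apply: (h (fun x => Im (f x))) => [y|i y]; first exact: (cf y).2.
exact: (congr1 (@complex.Im R) (H i y)).
Qed.

Lemma schwartz_lipschitz f : schwartz f ->
  exists2 M, 0 <= M & forall x y, n1 (f x - f y) <= M * `|x - y|.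
Proof.
move=> sf.
have H i : exists M, 0 <= M /\ forall x, n1 (partial i f x) <= M.
  have [M M0 HM] := schwartz_decay 0 (schwartz_partial i sf).
  by exists M; split => // x; have := HM x; rewrite /jbi expr0 invr1 mulr1.
have /choice[M HM] := H.
have SM : 0 <= \sum_i M i by rewrite sumr_ge0// => i _; case: (HM i).
exists (2 * \sum_i M i) => [|x y]; first by rewrite mulr_ge0.
have h (g : Rd -> R) : (forall x, differentiable g x) ->
    (forall i x, `|'D_(e_ i) g x| <= M i) -> `|g x - g y| <= (\sum_i M i) * `|x - y|.
  move=> dg Dg.
  have [c _] := real_MVT ler01 (fun u => is_derive_line (dg (y + u *: (x - y)))).
  rewrite scale0r scale1r addr0 subrKC mulr1 => ->.
  rewrite derive_coord// (le_trans (ler_norm_sum _ _ _))// mulr_suml.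
  apply: ler_sum => i _; rewrite normrM mulrC.
  by rewrite ler_pM ?coord_le_norm.
have cf := schwartz_cdiff sf.
rewrite /n1 ReD ImD ReN ImN -mulrA mulr_natl mulr2n lerD//.
  apply: (h (fun x => Re (f x))) => [z|i z]; first exact: (cf z).1.
  exact: le_trans (Re_le_n1 (partial i f z)) ((HM i).2 z).
apply: (h (fun x => Im (f x))) => [z|i z]; first exact: (cf z).2.
exact: le_trans (Im_le_n1 (partial i f z)) ((HM i).2 z).
Qed.

(** The translates of all Schwartz functions span a class stable under both
operations, because x_i = (x_i + y_i) - y_i. *)
Lemma schwartz_translate f y : schwartz f -> schwartz (fun x => f (x + y)).
Proof.
move=> sf.
pose G := [set h | exists2 g : Rd -> C, schwartz g & h = (fun x => g (x + y))].
have dt (h : Rd -> R) x i : differentiable h (x + y) ->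
   differentiable (fun x => h (x + y)) x /\
   'D_(e_ i) (fun x => h (x + y)) x = 'D_(e_ i) h (x + y).
  move=> dh; split.
    have ds : differentiable (fun x : Rd => x + y) x by apply: differentiableD => //; exact: differentiable_cst.
    exact: (differentiable_comp ds dh).
  have E : (fun u : R => u^-1 *: (((fun x => h (x + y)) \o shift x) (u *: e_ i) - h (x + y))) =
      (fun u : R => u^-1 *: ((h \o shift (x + y)) (u *: e_ i) - h (x + y))).
    by apply/funext => u /=; rewrite addrA.
  by rewrite /derive E.
have dtc g : schwartz g -> cdiff (fun x => g (x + y)).
  move=> /schwartz_cdiff cg z; have [c1 c2] := cg (z + y).
  have ds : differentiable (fun x : Rd => x + y) z.
    by apply: differentiableD => //; exact: differentiable_cst.
  by split; [exact: (differentiable_comp ds c1)|exact: (differentiable_comp ds c2)].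
have dtp g i : schwartz g -> partial i (fun x => g (x + y)) = fun x => partial i g (x + y).
  move=> /schwartz_cdiff cg; apply/funext => z; have [c1 c2] := cg (z + y).
  by apply: complex_ext; [exact: (dt (fun x => Re (g x)) z i c1).2|exact: (dt (fun x => Im (g x)) z i c2).2].
apply: (@hull_schwartz _ _ G); last by exists f.
move=> _ [g sg ->]; split.
- exact: dtc.
- move=> i; rewrite dtp//; apply: hull_gen.
  by exists (partial i g) => //; exact: schwartz_partial.
- move=> i.
  have -> : (fun x => cx i x * g (x + y)) =
      (fun x => (fun z => cx i z * g z) (x + y) + (- cx i y) * g (x + y)).
    apply/funext => x /=; rewrite -mulrDl; congr (_ * _).
    by apply: complex_ext; rewrite /= ?oppr0 ?addr0// mxE addrK.
  apply: hull_add; first by apply: hull_gen; exists (fun z => cx i z * g z) => //; exact: schwartz_cx.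
  by apply: hull_scale; apply: hull_gen; exists g.
- have [M M0 HM] := schwartz_decay 0 sg; exists M => x.
  by have := HM (x + y); rewrite /jbi expr0 invr1 mulr1.
Qed.

(** Polynomial functions, described by their closure properties: only these and
the growth bound are used. *)
Inductive cpoly : (Rd -> C) -> Prop :=
| cpoly_cst c : cpoly (fun=> c)
| cpoly_cx i : cpoly (cx i)
| cpoly_add f g of cpoly f & cpoly g : cpoly (fun x => f x + g x)
| cpoly_mul f g of cpoly f & cpoly g : cpoly (fun x => f x * g x).

Lemma cpoly_cdiff f : cpoly f -> cdiff f.
Proof.
elim=> [c|i|{}f g _ IH1 _ IH2|{}f g _ IH1 _ IH2].
- exact: (cdiff_cst c).
- exact: cdiff_cx.
- exact: cdiffD.
- exact: cdiffM.
Qed.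

Lemma cpoly_partial i f : cpoly f -> cpoly (partial i f).
Proof.
elim=> [c|j|{}f g pf IH1 pg IH2|{}f g pf IH1 pg IH2].
- by rewrite partial_cst; exact: cpoly_cst.
- by rewrite partial_cx; exact: cpoly_cst.
- by rewrite partialD; [exact: cpoly_add|exact: cpoly_cdiff..].
- rewrite partialM; [|exact: cpoly_cdiff..].
  by apply: cpoly_add; apply: cpoly_mul.
Qed.

Lemma cpoly_bound f : cpoly f -> exists A k, 0 <= A /\ forall x, n1 (f x) <= A * jb x ^+ k.
Proof.
elim=> [c|j|{}f g _ [A [k [A0 HA]]] _ [B [l [B0 HB]]]|{}f g _ [A [k [A0 HA]]] _ [B [l [B0 HB]]]].
- by exists (n1 c), 0%N; split=> [|x]; rewrite ?n1_ge0// expr0 mulr1.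
- by exists 1, 1%N; split=> // x; rewrite mul1r expr1 n1_cx coord_le_jb.
- exists (A + B), (k + l)%N; split=> [|x]; first exact: addr_ge0.
  rewrite (le_trans (n1D _ _))// mulrDl lerD//.
    by rewrite (le_trans (HA x))// ler_wpM2l// jbX_mono// leq_addr.
  by rewrite (le_trans (HB x))// ler_wpM2l// jbX_mono// leq_addl.
- exists (A * B), (k + l)%N; split=> [|x]; first exact: mulr_ge0.
  rewrite (le_trans (n1M _ _))// exprD mulrACA; apply: ler_pM; rewrite ?n1_ge0//.
Qed.

Definition sqd y x : R := \sum_i (x ord0 i - y ord0 i) ^+ 2.
Definition ga a y x : R := expR (- (a * sqd y x)).
Definition cga a y x : C := Complex (ga a y x) 0.

Lemma sqd_ge0 y x : 0 <= sqd y x.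
Proof. by apply: sumr_ge0 => i _; exact: sqr_ge0. Qed.

Lemma sqd_le y x : sqd y x <= d%:R * `|x - y| ^+ 2.
Proof.
have -> : d%:R * `|x - y| ^+ 2 = \sum_(i < d) `|x - y| ^+ 2.
  by rewrite sumr_const card_ord mulr_natl.
apply: ler_sum => i _; rewrite -real_normK ?num_real// lerXn2r ?nnegrE//.
by have := coord_le_norm (x - y) i; rewrite !mxE.
Qed.

Lemma norm_le_sqd y x : `|x - y| ^+ 2 <= sqd y x.
Proof.
have [E|E] := eqVneq (mx_norm (x - y)) 0.
  by rewrite [`|_|]E expr0n sqd_ge0.
have [[u i] /= Ei] := mx_norm_neq0 E.
rewrite [`|_|]Ei (ord1 u) !mxE real_normK ?num_real// /sqd (bigD1 i)//= lerDl.
by apply: sumr_ge0 => j _; exact: sqr_ge0.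
Qed.

Lemma sqd_diff y x : differentiable (sqd y) x /\
  forall i, 'D_(e_ i) (sqd y) x = 2 * (x ord0 i - y ord0 i).
Proof.
apply: (@real_taylor2_diff _ _ _ _ (fun i => 2 * (x ord0 i - y ord0 i)) d%:R) => h.
rewrite /sqd -!sumrB.
have -> : \sum_i (((x + h) ord0 i - y ord0 i) ^+ 2 - (x ord0 i - y ord0 i) ^+ 2
   - 2 * (x ord0 i - y ord0 i) * h ord0 i) = sqd 0 h.
  by apply: eq_bigr => i _; rewrite !mxE; ring.
by rewrite ger0_norm ?sqd_ge0//; have := sqd_le 0 h; rewrite subr0.
Qed.

Lemma ga_diff a y x : differentiable (ga a y) x /\
  forall i, 'D_(e_ i) (ga a y) x = - (2 * a * (x ord0 i - y ord0 i)) * ga a y x.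
Proof.
have [dq Dq] := sqd_diff y x.
have dq' : differentiable (fun x => - (a * sqd y x)) x.
  by apply: differentiableN; apply: differentiableM => //; exact: differentiable_cst.
have Dq' i : 'D_(e_ i) (fun x => - (a * sqd y x)) x = - (2 * a * (x ord0 i - y ord0 i)).
  have dd := @diff_derivable _ _ _ _ _ (e_ i) dq.
  rewrite (deriveN (f := fun x => a * sqd y x)); last exact: derivableZ.
  rewrite (deriveZ (f := sqd y))// Dq /GRing.scale/=; ring.
have de : differentiable (@expR R) (- (a * sqd y x)).
  by apply/derivable1_diffP; exact: derivable_expR.
split; first exact: (differentiable_comp dq' de).
move=> i; rewrite deriveE; last exact: (differentiable_comp dq' de).
rewrite (_ : ga a y = expR \o (fun x => - (a * sqd y x)))// diff_comp//=.
rewrite deriv1E; last exact: derivable_expR.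
by rewrite -deriveE// Dq' derive1E derive_val.
Qed.

Lemma cga_cdiff a y : cdiff (cga a y).
Proof. by apply: cdiff_real => x; exact: (ga_diff a y x).1. Qed.

Lemma partial_cga i a y :
  partial i (cga a y) = fun x => Complex (- (2 * a)) 0 * ((cx i x - cx i y) * cga a y x).
Proof.
rewrite partial_real; apply/funext => x; rewrite (ga_diff a y x).2.
apply: complex_ext; rewrite /= !(mul0r, mulr0, subr0, addr0, oppr0)//; ring.
Qed.

Lemma ga_le1 a y x : 0 <= a -> ga a y x <= 1.
Proof. by move=> a0; rewrite /ga -[leRHS]expR0 ler_expR oppr_le0 mulr_ge0// sqd_ge0. Qed.

Lemma expR_ge_pow (u : R) n : 0 <= u -> (0 < n)%N -> (1 + u / n%:R) ^+ n <= expR u.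
Proof.
move=> u0 n0; have -> : expR u = expR (u / n%:R) ^+ n.
  by rewrite -expRM_natl -mulrCA divff ?mulr1// pnatr_eq0 -lt0n.
rewrite lerXn2r ?nnegrE ?expR_ge0 ?expR_ge1Dx//.
by rewrite addr_ge0// divr_ge0.
Qed.

Lemma ga_decay a y k : 0 < a -> exists2 A, 0 <= A & forall x, ga a y x <= A * jbi k x.
Proof.
move=> a0; pose n := k.+1.
have n0 : 0 < n%:R :> R by rewrite ltr0n.
pose B := jb y ^+ 2 * (2 * (1 + n%:R / a)).
have B0 : 0 <= B by rewrite mulr_ge0 ?sqr_ge0// mulr_ge0// addr_ge0// divr_ge0// ltW.
exists (B ^+ n) => [|x]; first exact: exprn_ge0.
have u0 : 0 <= a * sqd y x by rewrite mulr_ge0 ?sqd_ge0// ltW.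
have b1 : jb x ^+ 2 <= B * (1 + a * sqd y x / n%:R).
  have h1 : jb x ^+ 2 <= jb y ^+ 2 * jb (x - y) ^+ 2.
    rewrite -exprMn lerXn2r ?nnegrE// ?mulr_ge0//.
    by rewrite -{1}(subrK y x) addrC jbD.
  apply: (le_trans h1); rewrite /B -mulrA ler_wpM2l ?sqr_ge0//.
  apply: (@le_trans _ _ (2 * (1 + `|x - y| ^+ 2))).
    by rewrite /jb; have := sqr_ge0 (1 - `|x - y|); nra.
  rewrite -[leRHS]mulrA ler_wpM2l//; apply: (@le_trans _ _ (1 + sqd y x)).
    by rewrite lerD2l norm_le_sqd.
  have E : n%:R / a * (a * sqd y x / n%:R) = sqd y x.
    by field; rewrite !lt0r_neq0.
  rewrite mulrDl !mulrDr !mul1r mulr1 E.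
  have p1 : 0 <= n%:R / a by rewrite divr_ge0// ltW.
  have p2 : 0 <= a * sqd y x / n%:R by rewrite divr_ge0// ltW.
  by lra.
rewrite /ga expRN /jbi.
rewrite ler_pdivlMr// ler_pdivrMl ?expR_gt0//.
apply: (@le_trans _ _ ((jb x ^+ 2) ^+ n)).
  by rewrite -exprM jbX_mono// mul2n -addnn (leq_trans (leqnSn k))// leq_addr.
apply: (@le_trans _ _ ((B * (1 + a * sqd y x / n%:R)) ^+ n)).
  by rewrite lerXn2r ?nnegrE ?sqr_ge0// mulr_ge0// addr_ge0// divr_ge0// ltW.
rewrite exprMn mulrC ler_wpM2r ?exprn_ge0//; exact: expR_ge_pow.
Qed.

(** Polynomials times a fixed Gaussian are stable under derivatives and
multiplication by coordinates. *)
Lemma schwartz_poly_cga f a y : 0 < a -> cpoly f -> schwartz (fun x => f x * cga a y x).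
Proof.
move=> a0 pf.
pose G := [set h | exists2 g : Rd -> C, cpoly g & h = (fun x => g x * cga a y x)].
apply: (@hull_schwartz _ _ G); last by exists f.
move=> _ [g pg ->]; split.
- by apply: cdiffM; [exact: cpoly_cdiff|exact: cga_cdiff].
- move=> i; rewrite partialM; [|exact: cpoly_cdiff|exact: cga_cdiff].
  apply: hull_add; first by apply: hull_gen; eexists; last reflexivity; exact: cpoly_partial.
  apply: hull_gen; rewrite partial_cga.
  exists (fun x => g x * (Complex (- (2 * a)) 0 * (cx i x + (- cx i y)))).
    apply: cpoly_mul => //; apply: cpoly_mul; first exact: cpoly_cst.
    by apply: cpoly_add; [exact: cpoly_cx|exact: cpoly_cst].
  by apply/funext => x; rewrite !mulrA.
- move=> i; apply: hull_gen; exists (fun x => cx i x * g x).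
    by apply: cpoly_mul => //; exact: cpoly_cx.
  by apply/funext => x; rewrite mulrA.
- have [A [k [A0 HA]]] := cpoly_bound pg; have [B B0 HB] := ga_decay y k a0.
  exists (A * B) => x; rewrite mulrC (le_trans (_ : _ <= ga a y x * n1 (g x)))//.
    by rewrite n1_real ger0_norm ?expR_ge0.
  apply: (@le_trans _ _ ((B * jbi k x) * (A * jb x ^+ k))).
    by apply: ler_pM; rewrite ?n1_ge0 ?expR_ge0.
  rewrite mulrACA (mulrC (jbi k x)) /jbi divff ?mulr1 1?mulrC// lt0r_neq0//.
Qed.

Lemma schwartz_cga a y : 0 < a -> schwartz (cga a y).
Proof.
move=> a0; have := schwartz_poly_cga y a0 (cpoly_cst 1).
by under eq_fun do rewrite mul1r.
Qed.

(** The transform of a Gaussian satisfies a first-order linear system whose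
solutions are the multiples of the dual Gaussian: their quotient has zero
gradient. *)
Lemma ft_cga a xi : 0 < a ->
  ft 1 (cga a 0) xi = ft 1 (cga a 0) 0 * cga (pi ^+ 2 / a) 0 xi.
Proof.
move=> a0; pose b := pi ^+ 2 / a.
have sG := schwartz_cga 0 a0.
have [M dM] := schwartz_decays (d.*2).+2 sG.
have [cE pE] := ft_diff 1 dM.
have pE' i x : partial i (ft 1 (cga a 0)) x = Complex (- (2 * b)) 0 * (cx i x * ft 1 (cga a 0) x).
  rewrite pE.
  have -> : (fun x => dfac 1 * (cx i x * cga a 0 x)) =
      (fun x => (dfac 1 * Complex (- (2 * a)^-1) 0) * partial i (cga a 0) x).
    apply/funext => z; rewrite partial_cga -mulrA; congr (_ * _).
    have cc : Complex (- (2 * a)^-1) 0 * Complex (- (2 * a)) 0 = 1 :> C.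
      apply: complex_ext => /=; rewrite !(mul0r, mulr0, subr0, addr0)//.
      by rewrite mulrNN mulVf// mulf_neq0// lt0r_neq0.
    rewrite [RHS]mulrA cc mul1r; congr (_ * _).
    by apply: complex_ext; rewrite /= ?mxE ?oppr0 ?addr0.
  rewrite ftZ; last exact/schwartz_integrable/schwartz_partial.
  rewrite ft_partial// mulrA (mulrA (Complex _ _)); congr (_ * _).
  apply: complex_ext => /=; rewrite !(oppr0, mul0r, mulr0, subr0, addr0, sub0r, add0r)//.
  by rewrite /b; field; rewrite lt0r_neq0.
have ch : cdiff (fun x => ft 1 (cga a 0) x * cga (- b) 0 x).
  by apply: cdiffM => //; exact: cga_cdiff.
have H := partial0_cst ch _ xi.
have {}H : ft 1 (cga a 0) xi * cga (- b) 0 xi = ft 1 (cga a 0) 0 * cga (- b) 0 0.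
  apply: H => i x; rewrite partialM//; last exact: cga_cdiff.
  rewrite pE' partial_cga.
  have -> : cx i (0 : Rd) = 0 by apply: complex_ext; rewrite /= ?mxE.
  have -> : Complex (- (2 * - b)) 0 = - Complex (- (2 * b)) 0 :> C.
    by apply: complex_ext; rewrite /= ?oppr0// mulrN.
  by ring.
have g0 : cga (- b) 0 0 = 1.
  apply: complex_ext => //=; rewrite /ga /sqd big1 ?mulr0 ?oppr0 ?expR0// => i _.
  by rewrite mxE subrr expr0n.
have gg : cga (- b) 0 xi * cga b 0 xi = 1.
  apply: complex_ext => /=; rewrite !(mul0r, mulr0, subr0, addr0)//.
  by rewrite /ga -expRD mulNr opprK subrr expR0.
by rewrite -[LHS]mulr1 -gg mulrA H g0 mulr1.
Qed.

(** The one-dimensional integral is the total mass of a normal density. *)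
Lemma integral_expR_sqr t : 0 < t ->
  (\int[@lebesgue_measure R]_u (expR (- (pi / t ^+ 2 * u ^+ 2)))%:E = t%:E)%E.
Proof.
move=> t0; pose sg := t / Num.sqrt (2 * pi).
have p0 : 0 < 2 * pi :> R by rewrite mulr_gt0// pi_gt0.
have sg0 : sg != 0 by rewrite lt0r_neq0// divr_gt0// sqrtr_gt0.
have sg2 : sg ^+ 2 = t ^+ 2 / (2 * pi).
  by rewrite /sg exprMn exprVn sqr_sqrtr// ltW.
have pk : normal_peak sg = t^-1.
  rewrite /normal_peak sg2 (_ : _ *+ 2 = t ^+ 2) ?sqrtr_sqr ?ger0_norm// ?ltW//.
  by rewrite -mulr_natr -mulrA (mulrC pi) divfK// lt0r_neq0.
have nf u : normal_fun 0 sg u = expR (- (pi / t ^+ 2 * u ^+ 2)).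
  rewrite /normal_fun subr0 sg2; congr expR; rewrite -mulr_natl.
  have aux (p : R) : p != 0 -> t != 0 ->
    - u ^+ 2 / (2 * (t ^+ 2 / (2 * p))) = - (p / t ^+ 2 * u ^+ 2) by move=> p1 t1; field; rewrite t1 p1.
  by apply: aux; rewrite lt0r_neq0// pi_gt0.
have := integral_normal_pdf 0 sg.
have i1 := integrable_normal_pdf 0 sg.
have E : (\int[@lebesgue_measure R]_u (expR (- (pi / t ^+ 2 * u ^+ 2)))%:E
   = \int[@lebesgue_measure R]_u (t%:E * (normal_pdf 0 sg u)%:E))%E.
  by apply: eq_integral => u _; rewrite normal_pdfE// pk nf -EFinM mulVKf// lt0r_neq0.
move=> N1; rewrite E integralZl//; first by rewrite N1 mule1.
Qed.

Lemma integral_ga t : 0 < t -> \int[mu]_x ga (pi / t ^+ 2) 0 x = t ^+ d.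
Proof.
move=> t0; rewrite /Rintegral.
have -> : (\int[mu]_x (ga (pi / t ^+ 2) 0 x)%:E =
    \int[mu]_x (\prod_i expR (- (pi / t ^+ 2 * x ord0 i ^+ 2)))%:E)%E.
  apply: eq_integral => x _; congr EFin; rewrite /ga /sqd mulr_sumr -sumrN.
  rewrite (big_morph _ (@expRD R) (@expR0 R)); apply: eq_bigr => i _.
  by rewrite mxE subr0.
rewrite (ge0_integral_rV_prod d (g := fun u => expR (- (pi / t ^+ 2 * u ^+ 2)))).
- by rewrite integral_expR_sqr// -EFin_expe.
- apply: continuous_measurable_fun => u.
  apply: continuous_comp; last exact: continuous_expR.
  apply: continuousN; apply: continuousM; first exact: cst_continuous.
  exact: exprn_continuous.
- by move=> u; exact: expR_ge0.
Qed.

End gaussian.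

(** * Mollification and Fourier inversion *)

Section inversion.
Variables (R : realType) (d : nat).
Local Notation Rd := 'rV[R]_d.
Local Notation C := R[i].
Local Notation mu := (lebesgue_rV R d).
Local Notation cx := (@cx R d).
Implicit Types (f g : Rd -> C) (i j : 'I_d) (s a t : R) (x y xi : Rd).

(** The Gaussian approximate identity at x, of mass one and width 1 / t. *)
Definition kap t x y : R := t ^+ d * ga (pi * t ^+ 2) x y.
Definition ckap t x y : C := Complex (kap t x y) 0.

Lemma kap_ge0 t x y : 0 < t -> 0 <= kap t x y.
Proof. by move=> t0; rewrite mulr_ge0 ?expR_ge0// exprn_ge0// ltW. Qed.

Lemma kap_shift t x y : kap t x y = kap t 0 (y - x).
Proof.
by congr (_ * expR (- (_ * _))); apply: eq_bigr => i _; rewrite !mxE subr0.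
Qed.

Let pit (t : R) : 0 < t -> 0 < pi * t ^+ 2.
Proof. by move=> t0; rewrite mulr_gt0 ?pi_gt0// exprn_gt0. Qed.

Lemma schwartz_ckap t x : 0 < t -> schwartz (ckap t x).
Proof.
move=> t0; have -> : ckap t x = fun y => Complex (t ^+ d) 0 * cga (pi * t ^+ 2) x y.
  by apply/funext => y; apply: complex_ext => /=; rewrite !(mul0r, mulr0, subr0, addr0).
exact/schwartzZ/schwartz_cga/pit.
Qed.

Lemma rintegrable_kap t x : 0 < t -> rintegrable (kap t x).
Proof. by move=> t0; have [] := schwartz_integrable (schwartz_ckap x t0). Qed.

Lemma rintegrable_norm_kap t x (h : Rd -> R) (A : R) (k : nat) : 0 < t -> measurable_fun setT h ->
  (forall y, `|h y| <= A * jb y ^+ k) -> rintegrable (fun y => h y * kap t x y).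
Proof.
move=> t0 mh hA; have [B B0 HB] := schwartz_decay (d.*2 + k) (schwartz_ckap x t0).
apply: (@rintegrable_dom _ _ _ (fun y => (`|A| * B) * jbi d.*2 y)).
- by apply: measurable_funM => //; exact: rintegrable_measurable (rintegrable_kap x t0).
- exact/rintegrableZ/rintegrable_jbi.
move=> y; rewrite normrM.
have E : jb y ^+ k * jbi (d.*2 + k) y = jbi d.*2 y by rewrite jbi_jb ?leq_addl// addnK.
rewrite -E mulrACA ler_pM//.
  by rewrite (le_trans (hA y))// ler_wpM2r// ler_norm.
by rewrite (le_trans (Re_le_n1 (ckap t x y)))// HB.
Qed.

Lemma integral_kap t x : 0 < t -> \int[mu]_y kap t x y = 1.
Proof.
move=> t0.
have -> : \int[mu]_y kap t x y = \int[mu]_y kap t 0 y.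
  under eq_Rintegral do rewrite kap_shift.
  apply: (@rintegral_translate _ _ (kap t 0) (- x)).
  exact: rintegrable_measurable (rintegrable_kap 0 t0).
have ti : 0 < t^-1 by rewrite invr_gt0.
have := integral_ga d ti; rewrite exprVn invrK => I.
have ig : rintegrable (ga (pi * t ^+ 2) (0 : Rd)).
  by have [] := schwartz_integrable (schwartz_cga (0 : Rd) (pit t0)).
rewrite RintegralZl// I exprVn divff// expf_neq0// lt0r_neq0//.
Qed.

(** Integration of d/dy_i (y_i kap) gives zero. *)
Lemma kap_moment2 t i : 0 < t ->
  \int[mu]_y (y ord0 i ^+ 2 * kap t 0 y) = (2 * pi * t ^+ 2)^-1.
Proof.
move=> t0; pose f y := cx i y * ckap t 0 y.
have sk := schwartz_ckap 0 t0; have sf : schwartz f by exact: schwartz_cx.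
have := ft_partial 1 i 0 sf.
have -> : Complex 0 (2 * pi * 1 * (0 : Rd) ord0 i) = 0 :> C.
  by apply: complex_ext => //=; rewrite mxE mulr0.
rewrite mul0r ftE.
have ik := rintegrable_kap 0 t0.
have ik2 : rintegrable (fun y => y ord0 i ^+ 2 * kap t 0 y).
  apply: (@rintegrable_norm_kap _ _ _ 1 2) => //.
    by apply: measurable_funX; exact: measurable_coord.
  by move=> y; rewrite mul1r normrX lerXn2r ?nnegrE// coord_le_jb.
have E y : partial i f y * fker 1 0 y =
    Complex (kap t 0 y - (2 * pi * t ^+ 2) * (y ord0 i ^+ 2 * kap t 0 y)) 0.
  rewrite fker0 mulr1 /f partialM; [|exact: cdiff_cx|exact: schwartz_cdiff].
  rewrite partial_cx eqxx.
  have -> : partial i (ckap t 0) y = Complex (- (2 * (pi * t ^+ 2))) 0 * ((cx i y - cx i 0) * ckap t 0 y).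
    have -> : ckap t 0 = fun y => Complex (t ^+ d) 0 * cga (pi * t ^+ 2) (0 : Rd) y.
      by apply/funext => z; apply: complex_ext => /=; rewrite !(mul0r, mulr0, subr0, addr0).
    rewrite partialZ; last exact: cga_cdiff.
    by rewrite partial_cga; ring.
  apply: complex_ext => /=; rewrite !(mul0r, mulr0, subr0, addr0, oppr0, mxE)//.
  by rewrite /ckap /=; ring.
rewrite (eq_cintegral E) => /(congr1 (@complex.Re R)) /=.
rewrite RintegralB//; last exact: rintegrableZ.
rewrite integral_kap// RintegralZl// => /eqP; rewrite subr_eq0 => /eqP H.
have p0 : 2 * pi * t ^+ 2 != 0.
  by rewrite lt0r_neq0// !mulr_gt0 ?pi_gt0// exprn_gt0.
by apply: (mulfI p0); rewrite -H divff.
Qed.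

(** From the second moments, through |u| <= 1 / t + t u^2 and
|y| <= sum of the |y_i|. *)
Lemma kap_moment1 t x : 0 < t ->
  rintegrable (fun y => `|y - x| * kap t x y) /\
  \int[mu]_y (`|y - x| * kap t x y) <= (2 * d%:R) / t.
Proof.
move=> t0; have ik := rintegrable_kap 0 t0.
have i1 : rintegrable (fun y => `|y| * kap t 0 y).
  apply: (@rintegrable_norm_kap _ _ _ 1 1) => //; first exact: measurable_norm_rV.
  by move=> y; rewrite normr_id mul1r expr1 norm_le_jb.
have i2 i : rintegrable (fun y => y ord0 i ^+ 2 * kap t 0 y).
  apply: (@rintegrable_norm_kap _ _ _ 1 2) => //.
    by apply: measurable_funX; exact: measurable_coord.
  by move=> y; rewrite mul1r normrX lerXn2r ?nnegrE// coord_le_jb.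
have E : (fun y => `|y - x| * kap t x y) = (fun y => (fun z => `|z| * kap t 0 z) (y + - x)).
  by apply/funext => y; rewrite kap_shift.
rewrite E; split; first exact: (rintegrable_translate (- x) i1).
have /= -> := rintegral_translate (- x) (rintegrable_measurable i1).
have pw y : `|y| * kap t 0 y <= \sum_(i < d) (t^-1 * kap t 0 y + t * (y ord0 i ^+ 2 * kap t 0 y)).
  have -> : \sum_(i < d) (t^-1 * kap t 0 y + t * (y ord0 i ^+ 2 * kap t 0 y)) =
      (\sum_(i < d) (t^-1 + t * y ord0 i ^+ 2)) * kap t 0 y.
    by rewrite mulr_suml; apply: eq_bigr => i _; ring.
  rewrite ler_wpM2r ?kap_ge0//.
  have ge0 (i : 'I_d) : 0 <= t^-1 + t * y ord0 i ^+ 2.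
    by apply: addr_ge0; [rewrite invr_ge0 ltW|rewrite mulr_ge0 ?sqr_ge0// ltW].
  apply: norm_rV_le => [|i]; first exact: sumr_ge0.
  rewrite (bigD1 i)//= ler_wpDr ?sumr_ge0//.
  rewrite -(real_normK (num_real (y ord0 i))).
  have tt : t * t^-1 = 1 by rewrite divff// lt0r_neq0.
  rewrite -(ler_pM2l t0) mulrDr tt mulrA -expr2 -exprMn.
  have := sqr_ge0 (t * `|y ord0 i| - 1); have := mulr_ge0 (ltW t0) (normr_ge0 (y ord0 i)).
  by nra.
have [iS ES] : rintegrable (fun y => \sum_(i < d) (t^-1 * kap t 0 y + t * (y ord0 i ^+ 2 * kap t 0 y))) /\
   \int[mu]_y (\sum_(i < d) (t^-1 * kap t 0 y + t * (y ord0 i ^+ 2 * kap t 0 y))) =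
   \sum_(i < d) (t^-1 + t * (2 * pi * t ^+ 2)^-1).
  elim: (index_enum 'I_d) => [|i r [IH1 IH2]].
    under eq_fun do rewrite big_nil; rewrite big_nil; split; first exact: integrable0.
    by rewrite Rintegral_cst// mul0r.
  have ii : rintegrable (fun y => t^-1 * kap t 0 y + t * (y ord0 i ^+ 2 * kap t 0 y)).
    by apply: rintegrableD; exact: rintegrableZ.
  under eq_fun do rewrite big_cons; rewrite big_cons; split; first exact: rintegrableD.
  rewrite RintegralD// IH2; congr (_ + _).
  rewrite RintegralD//; [|exact: rintegrableZ|exact: rintegrableZ].
  rewrite (RintegralZl _ measurableT ik) (RintegralZl _ measurableT (i2 i)).
  by rewrite integral_kap// kap_moment2// mulr1.
apply: (@le_trans _ _ (\sum_(i < d) (t^-1 + t * (2 * pi * t ^+ 2)^-1))).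
  by rewrite -ES; apply: le_Rintegral.
have H : t^-1 + t * (2 * pi * t ^+ 2)^-1 <= 2 / t.
  have -> : t * (2 * pi * t ^+ 2)^-1 = t^-1 * (2 * pi)^-1.
    have aux (p : R) : p != 0 -> t != 0 -> t * (2 * p * t ^+ 2)^-1 = t^-1 * (2 * p)^-1.
      by move=> p1 t1; field; rewrite t1 p1.
    by apply: aux; rewrite lt0r_neq0// pi_gt0.
  rewrite [leRHS]mulr_natl mulr2n lerD2l ler_piMr ?invr_ge0 ?(ltW t0)//.
  by rewrite invf_le1 ?mulr_gt0 ?pi_gt0//; have := pi_ge2 R; lra.
apply: le_trans (ler_sum _ (fun i _ => H)) _.
by rewrite sumr_const card_ord -[leLHS]mulr_natl mulrA (mulrC d%:R).
Qed.

(** A first moment of order 1 / t makes the mollified values of a Lipschitz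
function converge at that rate. *)
Lemma mollify_close f x (M t : R) : 0 < t -> 0 <= M -> cmeasurable f ->
  (forall y, n1 (f y - f x) <= M * `|y - x|) ->
  cintegrable (fun y => f y * ckap t x y) /\
  n1 (cintegral (fun y => f y * ckap t x y) - f x) <= M * ((2 * d%:R) / t).
Proof.
move=> t0 M0 mf HM; have [i1 H1] := kap_moment1 x t0.
have sk := schwartz_ckap x t0; have ck := schwartz_integrable sk.
have md : cmeasurable (fun y => (f y - f x) * ckap t x y).
  apply: cmeasurableM; last exact: cintegrable_measurable.
  by apply: cmeasurableD => //; exact: cmeasurable_cst.
have Hd y : n1 ((f y - f x) * ckap t x y) <= M * (`|y - x| * kap t x y).
  rewrite mulrC n1_real ger0_norm ?kap_ge0// mulrA (mulrC (kap _ _ _)).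
  by rewrite ler_wpM2r ?kap_ge0.
have cd := cintegrable_dom md (rintegrableZ M i1) Hd.
have cfx := cintegrableZ (f x) ck.
have E : (fun y => f y * ckap t x y) =
    (fun y => (f y - f x) * ckap t x y + f x * ckap t x y).
  by apply/funext => y; ring.
rewrite E; split; first exact: cintegrableD.
rewrite cintegralD// cintegralZ//.
have -> : cintegral (ckap t x) = 1.
  by apply: complex_ext => /=; [exact: integral_kap|rewrite Rintegral_cst// mul0r].
rewrite mulr1 addrK (le_trans (n1_cintegral_le md (rintegrableZ M i1) Hd))//.
by rewrite RintegralZl// ler_wpM2l.
Qed.

Lemma ft_cga_kap s t xi : s * s = 1 -> 0 < t -> ft s (cga (pi / t ^+ 2) 0) xi = ckap t 0 xi.
Proof.
move=> ss t0; have a0 : 0 < pi / t ^+ 2 by rewrite divr_gt0 ?pi_gt0// exprn_gt0.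
have -> : ft s (cga (pi / t ^+ 2) 0) xi = ft 1 (cga (pi / t ^+ 2) 0) (s *: xi).
  by rewrite /ft scale1r.
rewrite ft_cga//.
have -> : ft 1 (cga (pi / t ^+ 2) (0 : Rd)) 0 = Complex (t ^+ d) 0.
  rewrite ftE; under eq_cintegral do rewrite fker0 mulr1.
  by apply: complex_ext => /=; [rewrite integral_ga|rewrite Rintegral_cst// mul0r].
have -> : pi ^+ 2 / (pi / t ^+ 2) = pi * t ^+ 2.
  have aux (p : R) : p != 0 -> t != 0 -> p ^+ 2 / (p / t ^+ 2) = p * t ^+ 2.
    by move=> p1 t1; field; rewrite t1 p1.
  by apply: aux; rewrite lt0r_neq0// pi_gt0.
have -> : cga (pi * t ^+ 2) 0 (s *: xi) = cga (pi * t ^+ 2) 0 xi.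
  apply: complex_ext => //=; rewrite /ga /sqd; congr (expR (- (_ * _))).
  by apply: eq_bigr => i _; rewrite !mxE !subr0 exprMn expr2 ss mul1r.
by apply: complex_ext => /=; rewrite !(mul0r, mulr0, subr0, addr0).
Qed.

(** The transform is tested against wide Gaussians, whose own transforms are the
mollifiers kap: by ft_exchange the pairing tends to f 0 on one side and to the
integral of ft s f on the other. *)
Lemma ft_inversion0 s f : s * s = 1 -> schwartz f -> cintegral (ft s f) = f 0.
Proof.
move=> ss sf.
have s0 : s != 0 by apply/eqP => s0; move: ss; rewrite s0 mul0r => /eqP; rewrite eq_sym oner_eq0.
have sF := schwartz_ft s0 sf.
have [L L0 HL] := schwartz_lipschitz sf.
have [A A0 HA] := schwartz_decay (d.*2).+2 sF.
have cF := schwartz_integrable sF.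
apply/eqP; rewrite -subr_eq0; apply/eqP.
apply: (@n1_small_eq0 _ _ (L * (2 * d%:R) + (pi * d%:R * A) * \int[mu]_x jbi d.*2 x)).
move=> u /andP[u0 u1]; pose t := u^-1.
have t0 : 0 < t by rewrite invr_gt0.
have a0 : 0 < pi / t ^+ 2 by rewrite divr_gt0 ?pi_gt0// exprn_gt0.
have sG := schwartz_cga (0 : Rd) a0.
have [_ h1] := mollify_close t0 L0 (schwartz_cmeasurable sf) (fun y => HL y 0).
have E : cintegral (fun xi => cga (pi / t ^+ 2) 0 xi * ft s f xi) =
    cintegral (fun y => f y * ckap t 0 y).
  rewrite ft_exchange//; [|exact: schwartz_integrable..].
  by apply: eq_cintegral => x; rewrite ft_cga_kap// mulrC.
have cGF : cintegrable (fun xi => cga (pi / t ^+ 2) 0 xi * ft s f xi).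
  by apply: schwartz_integrable; exact: schwartzM.
have h2 : n1 (cintegral (ft s f) - cintegral (fun xi => cga (pi / t ^+ 2) 0 xi * ft s f xi)) <=
    (pi * d%:R * A * u) * \int[mu]_x jbi d.*2 x.
  rewrite -cintegralB// -RintegralZl//; last exact: rintegrable_jbi.
  apply: n1_cintegral_le.
  - by apply: cmeasurableD; [|apply: cmeasurableN]; exact: cintegrable_measurable.
  - exact/rintegrableZ/rintegrable_jbi.
  move=> x; rewrite -{1}(mul1r (ft s f x)) -mulrBl.
  have -> : 1 - cga (pi / t ^+ 2) 0 x = Complex (1 - ga (pi / t ^+ 2) 0 x) 0 :> C.
    by apply: complex_ext => /=; rewrite ?oppr0 ?addr0.
  rewrite n1_real.
  have g1 : 0 <= 1 - ga (pi / t ^+ 2) 0 x by rewrite subr_ge0 ga_le1// ltW.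
  rewrite ger0_norm//.
  have g2 : 1 - ga (pi / t ^+ 2) 0 x <= pi * d%:R * u * jb x ^+ 2.
    have := expR_ge1Dx (- (pi / t ^+ 2 * sqd 0 x)); rewrite -/(ga _ _ _) => h.
    apply: (@le_trans _ _ (pi / t ^+ 2 * sqd 0 x)); first by lra.
    rewrite /t exprVn invrK -!mulrA ler_wpM2l ?pi_ge0//.
    rewrite (mulrCA d%:R) ler_wpM2l ?(ltW u0)//.
    apply: (@le_trans _ _ (sqd 0 x)); first by rewrite ler_piMl ?sqd_ge0.
    rewrite (le_trans (sqd_le _ _))// subr0 ler_wpM2l//.
    by rewrite lerXn2r ?nnegrE// norm_le_jb.
  apply: (@le_trans _ _ ((pi * d%:R * u * jb x ^+ 2) * (A * jbi (d.*2).+2 x))).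
    by apply: ler_pM; rewrite ?n1_ge0.
  have E2 : jb x ^+ 2 * jbi (d.*2).+2 x = jbi d.*2 x by rewrite jbi_jb// subn2.
  by rewrite -E2 le_eqVlt; apply/orP; left; apply/eqP; ring.
have -> : cintegral (ft s f) - f 0 =
   (cintegral (ft s f) - cintegral (fun xi => cga (pi / t ^+ 2) 0 xi * ft s f xi)) +
   (cintegral (fun y => f y * ckap t 0 y) - f 0) by rewrite E addrA subrK.
rewrite (le_trans (n1D _ _))//; apply: le_trans (lerD h2 h1) _.
by rewrite /t invrK le_eqVlt; apply/orP; left; apply/eqP; ring.
Qed.

(** Inversion at x is inversion at 0 for the translate of f by x. *)
Lemma ft_inversion s f : s * s = 1 -> schwartz f -> ft (- s) (ft s f) = f.
Proof.
move=> ss sf; apply/funext => x.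
have := ft_inversion0 ss (schwartz_translate x sf); rewrite add0r => <-.
rewrite ftE; apply: eq_cintegral => xi.
by rewrite (ft_translate _ _ _ (schwartz_integrable sf)) [LHS]mulrC fkerC.
Qed.

Lemma ft_inversionN s f : s * s = 1 -> schwartz f -> ft s (ft (- s) f) = f.
Proof. by move=> ss sf; rewrite -{1}(opprK s) ft_inversion// mulrNN. Qed.

(** Equality as distributions; it is all that the definition of the spaces says
about two representatives of the same distribution. *)
Definition test_eq f g := forall h, schwartz h ->
  cintegral (fun x => f x * h x) = cintegral (fun x => g x * h x).

(** An essential bound for g near x is a pointwise bound for the Lipschitz
function f at x, since f x is the limit of the means of g against kap. *)
Lemma mollify_bound f g x (M B B' de : R) : 0 <= M -> cmeasurable f -> cmeasurable g ->
  (forall y, n1 (f y - f x) <= M * `|y - x|) -> test_eq f g ->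
  0 < de -> (forall y, `|y - x| < de -> n1 (g y) <= B) -> (forall y, n1 (g y) <= B') ->
  n1 (f x) <= B.
Proof.
move=> M0 mf mg HM fg de0 gB gB'.
have B0 : 0 <= B by apply: le_trans (n1_ge0 _) (gB x _); rewrite subrr normr0.
have B'0 : 0 <= B' by apply: le_trans (n1_ge0 _) (gB' x).
apply/ler_addgt0Pr => e e0.
(* far from x the bound B' is paid for by the first moment of the kernel *)
pose K := M * (2 * d%:R) + (B' / de) * (2 * d%:R).
have d2 : 0 <= 2 * d%:R :> R by rewrite mulr_ge0.
have K0 : 0 <= K by rewrite addr_ge0// mulr_ge0// divr_ge0// ltW.
pose t := (K + 1) / e.
have t0 : 0 < t by rewrite divr_gt0// ltr_wpDl.
have Kt : K / t <= e.
  rewrite ler_pdivrMr// /t mulrC divfK ?lt0r_neq0//; lra.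
have [cfk h1] := mollify_close t0 M0 mf HM.
have sk := schwartz_ckap x t0.
have [i1 m1] := kap_moment1 x t0.
have ik := rintegrable_kap x t0.
have h2 : n1 (cintegral (fun y => g y * ckap t x y)) <= B + (B' / de) * ((2 * d%:R) / t).
  apply: (@le_trans _ _ (\int[mu]_y (B * kap t x y + (B' / de) * (`|y - x| * kap t x y)))).
    apply: n1_cintegral_le.
    - by apply: cmeasurableM => //; exact: schwartz_cmeasurable.
    - by apply: rintegrableD; exact: rintegrableZ.
    move=> y; rewrite mulrC n1_real ger0_norm ?kap_ge0//.
    rewrite (_ : B * _ + _ = kap t x y * (B + B' / de * `|y - x|)); last by ring.
    rewrite ler_wpM2l ?kap_ge0//.
    have [yx|yx] := ltP `|y - x| de.
      by rewrite (le_trans (gB y yx))// lerDl mulr_ge0// divr_ge0// ltW.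
    rewrite (le_trans (gB' y))// ler_wpDl// mulrAC ler_pdivlMr//.
    by rewrite ler_wpM2l.
  rewrite RintegralD//; [|exact: rintegrableZ|exact: rintegrableZ].
  rewrite (RintegralZl B measurableT ik) (RintegralZl _ measurableT i1).
  by rewrite integral_kap// mulr1 lerD2l ler_wpM2l// divr_ge0// ltW.
rewrite -(fg _ sk) in h2.
move: h1 h2; set I := cintegral _ => h1 h2.
have -> : f x = I - (I - f x) by ring.
apply: le_trans (n1B _ _) _; apply: le_trans (lerD h2 h1) _.
rewrite -addrA lerD2l (le_trans _ Kt)// /K le_eqVlt; apply/orP; left; apply/eqP.
by field; rewrite !lt0r_neq0.
Qed.

Lemma test_eq_lipschitz f g (M B : R) : 0 <= M -> cmeasurable f -> cmeasurable g ->
  (forall x y, n1 (f x - f y) <= M * `|x - y|) ->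
  (forall x y, n1 (g x - g y) <= M * `|x - y|) ->
  (forall x, n1 (f x) <= B) -> (forall x, n1 (g x) <= B) ->
  test_eq f g -> f = g.
Proof.
move=> M0 mf mg fM gM fB gB fg; apply/funext => x; apply/eqP; rewrite -subr_eq0.
apply/eqP/n1_eq0.
have mfg : cmeasurable (fun x => f x - g x).
  by apply: cmeasurableD => //; exact: cmeasurableN.
apply: (@mollify_bound (fun x => f x - g x) (fun=> 0) x (M + M) 0 0 1) => //.
- exact: addr_ge0.
- move=> y; rewrite (_ : _ - _ = (f y - f x) - (g y - g x)); last by ring.
  by rewrite (le_trans (n1B _ _))// mulrDl lerD.
- move=> h sh; have ch := schwartz_integrable sh.
  have i1 : cintegrable (fun x => f x * h x).
    have := cintegrableMb ch mf fB; congr cintegrable.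
    by apply/funext => y; rewrite mulrC.
  have i2 : cintegrable (fun x => g x * h x).
    have := cintegrableMb ch mg gB; congr cintegrable.
    by apply/funext => y; rewrite mulrC.
  under eq_cintegral do rewrite mulrBl.
  rewrite cintegralB// (fg _ sh) subrr.
  by under eq_cintegral do rewrite mul0r; rewrite cintegral0.
- by move=> y _; rewrite n10.
- by move=> y; rewrite n10.
Qed.

End inversion.

(** * Interpolation of derivatives in weighted sup norms *)

Section finite_differences.
Variable R : realType.

(** A Vandermonde system yields weights extracting the k-th Taylor coefficient
from the values at 0, 1, .., N - 1. *)
Lemma derivative_stencil (N k : nat) : (k < N)%N ->
  exists c : 'I_N -> R, forall i, (i < N)%N ->
    \sum_j c j * (j%:R) ^+ i = (k`!)%:R *+ (i == k).
Proof.
move=> kN; pose V : 'M[R]_N := Vandermonde N (\row_(j < N) (j%:R)).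
have uV : V \in unitmx.
  rewrite unitmxE det_Vandermonde unitfE; apply/prodf_neq0 => i _.
  apply/prodf_neq0 => j ij; rewrite !mxE subr_eq0 eqr_nat.
  by apply: contraTneq ij => ->; rewrite ltnn.
pose e : 'cV[R]_N := \col_i ((k`!)%:R *+ (i == k :> nat)).
exists (fun j => (invmx V *m e) j ord0) => i iN.
have : (V *m (invmx V *m e)) (Ordinal iN) ord0 = e (Ordinal iN) ord0.
  by rewrite mulmxA mulmxV// mul1mx.
rewrite [LHS]mxE [RHS]mxE /= => <-; apply: eq_bigr => j _.
by rewrite [RHS]mulrC; congr (_ * _); rewrite !mxE.
Qed.

(** The functions g n stand for the successive derivatives of g 0. *)
Definition taylor_poly (N : nat) (g : nat -> R -> R) : {poly R} :=
  \poly_(i < N) (g i 0 / (i`!)%:R).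

Lemma deriv_taylor_poly N g :
  (taylor_poly N.+1 g)^`() = taylor_poly N (fun n => g n.+1).
Proof.
apply/polyP => i; rewrite coef_deriv !coef_poly ltnS; case: ifP => _; last by rewrite mul0rn.
have aux (u v w : R) : u != 0 -> w != 0 -> v / (u * w) * u = v / w by move=> ? ?; field; apply/andP.
by rewrite -[LHS]mulr_natr factS natrM aux// pnatr_eq0// -lt0n fact_gt0.
Qed.

Lemma taylor_bound N (g : nat -> R -> R) (M t : R) :
  (forall n (s : R), is_derive s 1 (g n) (g n.+1 s)) -> 0 <= t ->
  (forall s, 0 <= s <= t -> `|g N s| <= M) ->
  `|g 0%N t - (taylor_poly N g).[t]| <= M * t ^+ N.
Proof.
elim: N g t => [|N IH] g t dg t0 gM.
  rewrite /taylor_poly poly_def big_ord0 horner0 subr0 expr0 mulr1.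
  by apply: gM; rewrite t0 lexx.
pose p := taylor_poly N.+1 g.
have dp (s : R) : is_derive s 1 (fun u => g 0%N u - p.[u]) (g 1%N s - p^`().[s]).
  by apply: is_deriveB; exact: is_derive_horner.
have [c /andP[c0 ct]] := real_MVT t0 dp.
have -> : g 0%N 0 - p.[0] = 0.
  by rewrite horner_coef0 coef_poly /= fact0 divr1 subrr.
rewrite subr0 => ->; rewrite normrM (ger0_norm t0) exprSr mulrA ler_wpM2r//.
have M0 : 0 <= M by apply: le_trans (normr_ge0 _) (gM 0 _); rewrite lexx.
rewrite /p deriv_taylor_poly.
apply: le_trans (IH (fun n => g n.+1) c _ c0 _) _ => //.
  by move=> s /andP[s0 sc]; apply: gM; rewrite s0 (le_trans sc).
by rewrite ler_wpM2l// lerXn2r ?nnegrE.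
Qed.

(** The Landau-Kolmogorov inequality with an explicit step h: the k-th derivative
at 0 is read off the values at multiples of h, with the Taylor remainder of
order 2 k as error. *)
Lemma derivative_interpolation k : (0 < k)%N -> exists2 A : R, 0 <= A &
  forall (g : nat -> R -> R) (M ep h : R), 0 < h ->
  (forall n (s : R), is_derive s 1 (g n) (g n.+1 s)) ->
  (forall s, 0 <= s <= k.*2%:R * h -> `|g 0%N s| <= ep) ->
  (forall s, 0 <= s <= k.*2%:R * h -> `|g k.*2 s| <= M) ->
  `|g k 0| <= A * (ep / h ^+ k + M * h ^+ k).
Proof.
move=> k0; pose N := k.*2.
have kN : (k < N)%N by rewrite /N -addnn -[ltnLHS]addn0 ltn_add2l.
have [c Hc] := derivative_stencil kN.
pose S := \sum_(j < N) `|c j|.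
pose A := S * (1 + N%:R ^+ N).
have S0 : 0 <= S by apply: sumr_ge0.
have A0 : 0 <= A by rewrite mulr_ge0// addr_ge0// exprn_ge0.
exists A => // g M ep h h0 dg gep gM.
have hk0 : 0 < h ^+ k by rewrite exprn_gt0.
have jh (j : 'I_N) : 0 <= j%:R * h <= N%:R * h.
  by rewrite mulr_ge0 ?(ltW h0)//= ler_wpM2r ?(ltW h0)// ler_nat ltnW.
have M0 : 0 <= M by apply: le_trans (normr_ge0 _) (gM 0 _); rewrite lexx mulr_ge0// ltW.
have ep0 : 0 <= ep by apply: le_trans (normr_ge0 _) (gep 0 _); rewrite lexx mulr_ge0// ltW.
have E : \sum_j c j * (taylor_poly N g).[j%:R * h] = g k 0 * h ^+ k.
  under eq_bigr => j _ do rewrite horner_poly mulr_sumr.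
  rewrite exchange_big /=.
  have E1 (i : 'I_N) : \sum_(j < N) c j * (g i 0 / (i`!)%:R * (j%:R * h) ^+ i) =
      (g i 0 / (i`!)%:R * h ^+ i) * ((k`!)%:R *+ (i == k :> nat)).
    rewrite -Hc// mulr_sumr; apply: eq_bigr => j _; rewrite exprMn; ring.
  under eq_bigr do rewrite E1.
  rewrite (bigD1 (Ordinal kN))//= eqxx mulr1n big1 ?addr0.
    by rewrite mulrAC divfK// pnatr_eq0 -lt0n fact_gt0.
  move=> i ik; rewrite (_ : (i == k :> nat) = false) ?mulr0n ?mulr0//.
  by apply/negbTE; apply: contra ik => /eqP ik; apply/eqP/val_inj.
have B : `|g k 0 * h ^+ k| <= S * ep + S * (M * (N%:R * h) ^+ N).
  rewrite -E; have -> : \sum_j c j * (taylor_poly N g).[j%:R * h] =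
     \sum_j c j * g 0%N (j%:R * h) - \sum_j c j * (g 0%N (j%:R * h) - (taylor_poly N g).[j%:R * h]).
    by rewrite -sumrB; apply: eq_bigr => j _; ring.
  rewrite (le_trans (ler_normB _ _))// lerD//; rewrite (le_trans (ler_norm_sum _ _ _))// mulr_suml;
    apply: ler_sum => j _; rewrite normrM ler_wpM2l//.
    exact: gep.
  have /andP[j0 jN] := jh j.
  apply: le_trans (taylor_bound dg j0 _) _.
    by move=> s /andP[s0 sj]; apply: gM; rewrite s0 (le_trans sj).
  by rewrite ler_wpM2l// lerXn2r ?nnegrE// mulr_ge0// ltW.
rewrite -(ler_pM2r hk0) -{1}(ger0_norm (ltW hk0)) -normrM.
apply: (le_trans B).
have -> : A * (ep / h ^+ k + M * h ^+ k) * h ^+ k = A * (ep + M * h ^+ N).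
  by rewrite /N -addnn exprD; field; rewrite lt0r_neq0.
rewrite exprMn /A.
have n1' : 0 <= N%:R ^+ N :> R by rewrite exprn_ge0.
have hN : 0 <= h ^+ N by rewrite exprn_ge0// ltW.
have a1 : 0 <= S * (N%:R ^+ N * ep) by rewrite !mulr_ge0.
have a2 : 0 <= S * (M * h ^+ N) by rewrite !mulr_ge0.
have -> : S * (1 + N%:R ^+ N) * (ep + M * h ^+ N) =
  S * ep + S * (M * (N%:R ^+ N * h ^+ N)) + (S * (N%:R ^+ N * ep) + S * (M * h ^+ N)).
  by ring.
by rewrite lerDl addr_ge0.
Qed.

End finite_differences.

Section weighted_interpolation.
Variables (R : realType) (d : nat).
Local Notation Rd := 'rV[R]_d.
Local Notation C := R[i].
Local Notation e_ := (fun i : 'I_d => delta_mx ord0 i : Rd).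
Local Notation Dw := (@Dw R d).
Implicit Types (f g : Rd -> C) (w : Rd -> R).

(** What is used of a weight satisfying (alpha): its values at points closer than
de are comparable, up to the factor L and the constant E. *)
Record wloc w (L E de : R) : Prop := Wloc {
  wloc_L : 1 <= L ; wloc_E : 0 <= E ; wloc_de : 0 < de ;
  wloc_ge0 : forall x, 0 <= w x ;
  wloc_le : forall x y, `|x - y| < de -> w x <= L * w y + E }.

(** (alpha) bounds w x by L (w y + w (x - y)) and local boundedness at 0 bounds
w (x - y). *)
Lemma weight_wloc w : weight w -> cond_alpha w -> exists L E de, wloc w L E de.
Proof.
move=> [w0 _ wb] [L [K [L0 K0 H]]].
have [M /nbhs_ballP[de /= de0 Hb]] := wb 0.
pose L' := Num.max 1 L.
have LL' : L <= L' by rewrite le_max lexx orbT.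
have L'0 : 0 <= L' by rewrite le_max ler01.
exists L', (L' * `|M| + `|ln K|), de; split => //.
- by rewrite le_max lexx.
- by rewrite addr_ge0// mulr_ge0.
move=> x y xy.
have wM : w (x - y) <= `|M|.
  rewrite (le_trans _ (ler_norm _))//; apply: Hb.
  by rewrite -ball_normE /ball_ /= sub0r normrN.
have := H y (x - y); rewrite subrKC => /le_trans; apply.
have h1 : L * w y <= L' * w y by rewrite ler_wpM2r.
have h2 : L * w (x - y) <= L' * `|M| by rewrite ler_pM// ltW.
by have := ler_norm (ln K); rewrite mulrDr; lra.
Qed.

(** Interpolation along the direction i with a step proportional to
e^(- lam w x / (2 L k)): the decay of f over h^k and the bound on the derivative of
order 2 k times h^k are then both of order e^(- lam w x / (2 L)). *)
Lemma interp_step w L E de (lam : R) k : wloc w L E de -> 0 < lam ->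
  exists2 A : R, 1 <= A & forall f P i, smooth f ->
  (forall x, n1 (f x) <= P * expR (- (lam * w x))) ->
  (forall x, n1 (Dw (nseq k.*2 i) f x) <= P) ->
  forall x, n1 (Dw (nseq k i) f x) <= A * P * expR (- (lam / (2 * L) * w x)).
Proof.
move=> [L1 E0 de0 w0 wle] lam0.
have L0 : 0 < L by lra.
case: k => [|k'].
  exists 1 => // f P i sf fP _ x /=; rewrite mul1r.
  have P0 : 0 <= P by have := le_trans (n1_ge0 _) (fP x); rewrite pmulr_lge0// expR_gt0.
  apply: le_trans (fP x) _; rewrite ler_wpM2l// ler_expR lerN2 ler_wpM2r//.
  by rewrite ler_pdivrMr ?mulr_gt0//; nra.
set k := k'.+1.
have [A A0 HA] := @derivative_interpolation R k isT.
(* the 2 k steps of length at most q stay at distance less than de from x *)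
pose q := de / (2 * k.*2%:R).
have k20 : 0 < k.*2%:R :> R by rewrite ltr0n double_gt0.
have q0 : 0 < q by rewrite divr_gt0// mulr_gt0.
pose B := 2 * (A * (expR (lam * (E / L)) / q ^+ k + q ^+ k)) + 1.
have qk0 : 0 < q ^+ k by rewrite exprn_gt0.
have B0 : 0 <= expR (lam * (E / L)) / q ^+ k + q ^+ k.
  by rewrite addr_ge0 ?divr_ge0 ?expR_ge0// ltW.
exists B => [|f P i sf fP DP x].
  by rewrite lerDr !mulr_ge0.
have P0 : 0 <= P by have := le_trans (n1_ge0 _) (fP x); rewrite pmulr_lge0// expR_gt0.
pose th := lam / (2 * L) * w x.
have th0 : 0 <= th by rewrite mulr_ge0// divr_ge0 ?mulr_ge0// ltW.
pose h := q * expR (- (th / k%:R)).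
have h0 : 0 < h by rewrite mulr_gt0// expR_gt0.
have hk : h ^+ k = q ^+ k * expR (- th).
  rewrite exprMn -expRM_natl; congr (_ * expR _).
  by rewrite mulrN mulrCA divff ?mulr1// pnatr_eq0.
have hq : h <= q.
  rewrite /h ler_piMr ?(ltW q0)// -expR0 ler_expR oppr_le0 divr_ge0//.
have en : `|e_ i| <= 1.
  apply: norm_rV_le => // j; rewrite mxE eqxx /=.
  by case: eqP; rewrite ?normr1 ?normr0.
have near_x (s : R) : 0 <= s <= k.*2%:R * h -> n1 (f (x + s *: e_ i)) <=
    P * (expR (lam * (E / L)) * expR (- (2 * th))).
  move=> /andP[s0 sh]; apply: le_trans (fP _) _; rewrite ler_wpM2l// -expRD ler_expR.
  have /wle : `|x - (x + s *: e_ i)| < de.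
    rewrite opprD addrA subrr add0r normrN normrZ ger0_norm//.
    apply: (@le_lt_trans _ _ s); first by rewrite ler_piMr.
    apply: (le_lt_trans sh); apply: (@le_lt_trans _ _ (k.*2%:R * q)).
      by rewrite ler_wpM2l// ltW.
    have aux (n : R) : n != 0 -> n * (de / (2 * n)) = de / 2 by move=> ?; field.
    by rewrite /q aux ?lt0r_neq0//; lra.
  set v := w (x + _) => wv.
  have -> : lam * (E / L) - 2 * th = (lam / L) * (E - w x).
    by rewrite /th; field; rewrite lt0r_neq0.
  have -> : - (lam * v) = (lam / L) * (- (L * v)) by field; rewrite lt0r_neq0.
  by rewrite ler_wpM2l ?divr_ge0 ?(ltW lam0) ?(ltW L0)//; lra.
have line (n : nat) (s : R) :
   is_derive s 1 (fun s => Re (Dw (nseq n i) f (x + s *: e_ i)))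
     (Re (Dw (nseq n.+1 i) f (x + s *: e_ i))) /\
   is_derive s 1 (fun s => Im (Dw (nseq n i) f (x + s *: e_ i)))
     (Im (Dw (nseq n.+1 i) f (x + s *: e_ i))).
  have [d1 d2] := smooth_cdiff (nseq n i) sf (x + s *: e_ i).
  by split; [exact: (is_derive_line d1)|exact: (is_derive_line d2)].
have H1 := HA (fun n s => Re (Dw (nseq n i) f (x + s *: e_ i))) P _ h h0
  (fun n s => (line n s).1) (fun s hs => le_trans (Re_le_n1 _) (near_x s hs))
  (fun s hs => le_trans (Re_le_n1 _) (DP _)).
have H2 := HA (fun n s => Im (Dw (nseq n i) f (x + s *: e_ i))) P _ h h0
  (fun n s => (line n s).2) (fun s hs => le_trans (Im_le_n1 _) (near_x s hs))
  (fun s hs => le_trans (Im_le_n1 _) (DP _)).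
rewrite scale0r addr0 in H1; rewrite scale0r addr0 in H2.
apply: le_trans (lerD H1 H2) _.
have -> : P * (expR (lam * (E / L)) * expR (- (2 * th))) / h ^+ k + P * h ^+ k =
   P * expR (- th) * (expR (lam * (E / L)) / q ^+ k + q ^+ k).
  have -> : expR (- (2 * th)) = expR (- th) * expR (- th).
    by rewrite -expRD; congr expR; ring.
  rewrite hk; field.
  by rewrite !lt0r_neq0 ?expR_gt0.
rewrite -/th /B.
have e0 : 0 <= P * expR (- th) by rewrite mulr_ge0 ?expR_ge0.
rewrite [leRHS](_ : _ = (A * (P * expR (- th) * (expR (lam * (E / L)) / q ^+ k + q ^+ k)) +
  A * (P * expR (- th) * (expR (lam * (E / L)) / q ^+ k + q ^+ k))) + P * expR (- th)); last by ring.
by rewrite lerDl.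
Qed.

Lemma interp_step_le w L E de (lam : R) k : wloc w L E de -> 0 < lam ->
  exists2 A : R, 1 <= A & forall m f P i, (m <= k)%N -> smooth f ->
  (forall x, n1 (f x) <= P * expR (- (lam * w x))) ->
  (forall x, n1 (Dw (nseq m.*2 i) f x) <= P) ->
  forall x, n1 (Dw (nseq m i) f x) <= A * P * expR (- (lam / (2 * L) * w x)).
Proof.
move=> wl lam0.
have /choice[A HA] : forall m : 'I_k.+1, exists A : R, 1 <= A /\ forall f P i, smooth f ->
  (forall x, n1 (f x) <= P * expR (- (lam * w x))) ->
  (forall x, n1 (Dw (nseq m.*2 i) f x) <= P) ->
  forall x, n1 (Dw (nseq m i) f x) <= A * P * expR (- (lam / (2 * L) * w x)).
  by move=> m; have [A A1 HA] := interp_step m wl lam0; exists A.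
have A0 m : 0 <= A m by have [h _] := HA m; lra.
have AS m : A m <= \sum_m A m by rewrite (bigD1 m)//= lerDl sumr_ge0.
exists (\sum_m A m) => [|m f P i mk sf fP DP x].
  by apply: le_trans (AS ord0); case: (HA ord0).
have mk' : (m < k.+1)%N by rewrite ltnS.
have P0 : 0 <= P by have := le_trans (n1_ge0 _) (fP x); rewrite pmulr_lge0// expR_gt0.
apply: le_trans ((HA (Ordinal mk')).2 f P i sf fP DP x) _.
by rewrite -!mulrA ler_wpM2r ?mulr_ge0 ?expR_ge0.
Qed.

(** The word of the multi-index a restricted to the directions in l, so that
interpolation can proceed one direction at a time. *)
Definition lword (a : multiindex d) (l : seq 'I_d) := flatten [seq nseq (a i) i | i <- l].

Lemma size_lword a l k : (forall i, (a i <= k)%N) -> (size (lword a l) <= k * size l)%N.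
Proof.
move=> ak; elim: l => //= i l IH; rewrite size_cat size_nseq mulnS leq_add//.
Qed.

(** Each direction costs a factor 2 L in the rate of decay and doubles only the
order of derivation in that direction. *)
Lemma interp_words w L E de k (l : seq 'I_d) : wloc w L E de ->
  forall lam : R, 0 < lam ->
  exists2 A : R, 1 <= A & forall f P (a : multiindex d), (forall i, (a i <= k)%N) -> smooth f ->
  (forall x, n1 (f x) <= P * expR (- (lam * w x))) ->
  (forall s x, (size s <= k * (size l).+1)%N -> n1 (Dw s f x) <= P) ->
  forall x, n1 (Dw (lword a l) f x) <= A * P * expR (- (lam / (2 * L) ^+ size l * w x)).
Proof.
move=> wl lam lam0; have L1 := wloc_L wl; have L0 : 0 < 2 * L by lra.
elim: l => [|i l [A A1 IH]].
  by exists 1 => // f P a _ _ fP _ x; rewrite /= expr0 divr1 mul1r.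
have lam'0 : 0 < lam / (2 * L) ^+ size l by rewrite divr_gt0// exprn_gt0.
have [B B1 HB] := interp_step_le k wl lam'0.
exists (B * A) => [|f P a ak sf fP DP x]; first by rewrite -[1]mul1r ler_pM.
have P0 : 0 <= P by have := le_trans (n1_ge0 _) (fP x); rewrite pmulr_lge0// expR_gt0.
have H1 := IH f P a ak sf fP (fun s x sk => DP s x (leq_trans sk (leq_mul (leqnn k) (leqnSn _)))).
rewrite /= -/(lword a l) Dw_cat -(mulrA B).
have -> : lam / (2 * L) ^+ (size l).+1 = lam / (2 * L) ^+ size l / (2 * L).
  by rewrite exprSr invfM mulrA.
apply: HB => //; first exact: smooth_Dw.
move=> y; rewrite -Dw_cat; apply: le_trans (DP _ _ _) _; last first.
  by rewrite ler_peMl.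
rewrite size_cat size_nseq -addnn -addnA mulnS leq_add// mulnS leq_add//.
exact: size_lword.
Qed.

(** A decaying function whose derivatives are merely bounded has decaying
derivatives, at a rate smaller by a factor that does not depend on the order. *)
Lemma interp_mderiv w L E de k : wloc w L E de -> forall lam : R, 0 < lam ->
  exists2 A : R, 1 <= A & forall f P (a : multiindex d), (mlen a <= k)%N -> smooth f ->
  (forall x, n1 (f x) <= P * expR (- (lam * w x))) ->
  (forall s x, (size s <= k * d.+1)%N -> n1 (Dw s f x) <= P) ->
  forall x, n1 (mderiv a f x) <= A * P * expR (- (lam / (2 * L) ^+ d * w x)).
Proof.
move=> wl lam lam0; have [A A1 HA] := interp_words k (enum 'I_d) wl lam0.
exists A => // f P a ak sf fP DP x; rewrite mderiv_word.
have := HA f P a _ sf fP; rewrite size_enum_ord; apply => //.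
move=> i; apply: leq_trans ak; rewrite /mlen (bigD1 i)//= leq_addr//.
Qed.

End weighted_interpolation.

(** * Tempered distributions given by functions *)

Section distributions.
Variables (R : realType) (d : nat).
Local Notation Rd := 'rV[R]_d.
Local Notation C := R[i].
Local Notation mu := (lebesgue_rV R d).
Implicit Types (f g h : Rd -> C) (u : functional R d) (i j : 'I_d) (s : R) (x y xi : Rd).

Lemma on_schwartzE u g : schwartz g -> on_schwartz u g = u g.
Proof. by move=> sg; rewrite /on_schwartz; case: asboolP. Qed.

Lemma regularE f g : schwartz g -> regular f g = cintegral (fun x => f x * g x).
Proof. exact: on_schwartzE. Qed.

Lemma td_fourierE u g : schwartz g -> td_fourier u g = u (ft 1 g).
Proof.
move=> sg; rewrite /td_fourier on_schwartzE//; congr u.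
by apply/funext => x; rewrite ft1.
Qed.

Lemma td_derivE a u g : schwartz g -> td_deriv a u g = (-1) ^+ mlen a * u (mderiv a g).
Proof. exact: on_schwartzE. Qed.

Lemma given_by_regular u f : tempered u -> given_by u f -> u = regular f.
Proof.
move=> [_ uS] [_ uf]; apply/funext => g; rewrite uS /regular /on_schwartz.
by case: asboolP => // sg; have [_ ->] := uf g sg.
Qed.

Lemma schwartz_dom f g M : cmeasurable f -> (forall x, n1 (f x) <= M) ->
  schwartz g -> cintegrable (fun x => f x * g x).
Proof.
move=> mf fM sg.
rewrite (_ : (fun x => _) = (fun x => g x * f x)); last by apply/funext => x; rewrite mulrC.
exact: (cintegrableMb (schwartz_integrable sg) mf fM).
Qed.

Lemma mderiv0 f : mderiv (@mindex0 d) f = f.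
Proof.
rewrite mderiv_word; have /eqP := size_word (@mindex0 d).
by rewrite mlen0 => /nilP ->.
Qed.

Lemma norm_cmod (z : C) : `|z| = Complex (cmod z) 0.
Proof. by []. Qed.

Lemma given_by_integral u f : cmeasurable f ->
  (forall g, schwartz g -> cintegrable (fun x => f x * g x)) ->
  (forall g, schwartz g -> u g = cintegral (fun x => f x * g x)) -> given_by u f.
Proof. by move=> mf fi uf; split=> // g sg; split; [exact: fi|exact: uf]. Qed.

Lemma given_by_bounded u f M : cmeasurable f -> (forall x, n1 (f x) <= M) ->
  (forall g, schwartz g -> u g = cintegral (fun x => f x * g x)) -> given_by u f.
Proof.
by move=> mf fM; apply: given_by_integral => // g sg; exact: (schwartz_dom mf fM).
Qed.

(** Continuity of a linear functional from a single estimate by a seminorm. *)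
Lemma temperedP u (M : R) (k : nat) : 0 <= M ->
  (forall (a : C) f g, schwartz f -> schwartz g ->
    u (fun x => a * f x + g x) = a * u f + u g) ->
  (forall g (B : R), schwartz g -> 0 <= B -> (forall x, jb x ^+ k * n1 (g x) <= B) ->
    n1 (u g) <= M * B) ->
  (forall g, ~ schwartz g -> u g = 0) -> tempered u.
Proof.
move=> M0 ul ub u0; split; last first.
  by apply/funext => g; rewrite /on_schwartz; case: asboolP => // /u0.
split=> [a f g sf sg|e f e0 sf]; first exact: ul.
have Re0 : 0 < Re e by case: e e0 => a b; rewrite ltcE /= => /andP[].
pose c := 2 ^+ k.+2 * (M + 1).
have c0 : 0 < c by rewrite mulr_gt0 ?exprn_gt0// ltr_wpDl.
exists [set v | schwartz v /\ forall m : nat, m \in [:: k] -> (wnorm (fun _ : Rd => 0%R : R) m m 1 v < (Re e / 2 / c)%:E)%E].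
  by exists [:: k]; exists (Re e / 2 / c) => //; rewrite divr_gt0// divr_gt0.
move=> v [sv /(_ k (mem_head _ _)) vb].
have -> : u (f + v) - u f = u v.
  have := ul 1 f v sf sv; rewrite mul1r.
  have -> : (fun x => 1 * f x + v x) = (f + v : Rd -> C).
    by apply/funext => x; rewrite mul1r.
  by move=> ->; rewrite addrC addKr.
have B0 : 0 <= 2 ^+ k.+2 * (Re e / 2 / c).
  by rewrite mulr_ge0 ?exprn_ge0// !divr_ge0// ltW.
have : n1 (u v) <= M * (2 ^+ k.+2 * (Re e / 2 / c)).
  apply: (ub v _ sv B0) => x.
  have := wnorm_bound vb x (a := @mindex0 d); rewrite mlen0 mderiv0 mulr0 expR0 mulr1.
  exact.
have ie : Im e = 0 by case: e e0 {Re0 vb B0} => a b; rewrite ltcE /= => /andP[/eqP].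
rewrite norm_cmod => h; suff : cmod (u v) < Re e by rewrite ltcE /= ie eqxx.
apply: le_lt_trans (cmod_le_n1 _) _; apply: (le_lt_trans h).
set a := Re e in Re0 B0 *; rewrite /c.
have aux (p m : R) : 0 < p -> 0 <= m -> m * (p * (a / 2 / (p * (m + 1)))) = a / 2 * (m / (m + 1)).
  by move=> p0 m0; field; rewrite !lt0r_neq0//; lra.
rewrite aux ?exprn_gt0//.
have : M / (M + 1) <= 1 by rewrite ler_pdivrMr; lra.
nra.
Qed.

Lemma regular_tempered f M : cmeasurable f -> (forall x, n1 (f x) <= M) ->
  tempered (regular f).
Proof.
move=> mf fM.
have fi g : schwartz g -> cintegrable (fun x => f x * g x) by exact: schwartz_dom.
have M0 : 0 <= M by apply: le_trans (n1_ge0 (f 0)) _.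
pose I := \int[mu]_x jbi d.*2 x.
have I0 : 0 <= I by apply: rintegral_ge0 => x.
apply: (@temperedP _ (M * I) d.*2); first by rewrite mulr_ge0.
- move=> a g h sg sh.
  have sa : schwartz (fun x => a * g x) by exact: schwartzZ.
  rewrite !regularE//; last exact: schwartzD.
  rewrite -(cintegralZ a (fi _ sg)) -(cintegralD (cintegrableZ a (fi _ sg)) (fi _ sh)).
  by apply: eq_cintegral => x; rewrite mulrDr mulrCA.
- move=> g B sg B0 gB; rewrite regularE//.
  have -> : M * I * B = \int[mu]_x (M * B * jbi d.*2 x).
    by rewrite (RintegralZl _ measurableT (rintegrable_jbi _ (leqnn _)))// /I mulrAC.
  apply: n1_cintegral_le; [exact: cmeasurableM mf (schwartz_cmeasurable sg)|exact/rintegrableZ/rintegrable_jbi|].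
  move=> x; apply: le_trans (n1M _ _) _; rewrite -mulrA ler_pM ?n1_ge0//.
  by rewrite ler_pdivlMr// mulrC.
- by move=> g ng; rewrite /regular /on_schwartz; case: asboolP.
Qed.

Lemma given_by_regular_self f M : cmeasurable f -> (forall x, n1 (f x) <= M) ->
  given_by (regular f) f.
Proof. by move=> mf fM; apply: (given_by_bounded mf fM) => g; exact: regularE. Qed.

Lemma temperedD u f g : tempered u -> schwartz f -> schwartz g ->
  u (fun x => f x + g x) = u f + u g.
Proof.
move=> [[ul _] _] sf sg; have := ul 1 f g sf sg.
rewrite mul1r => <-; congr u; apply/funext => x.
by rewrite -[in LHS](scale1r (f x)).
Qed.

Lemma temperedZ u (a : C) f : tempered u -> schwartz f ->
  u (fun x => a * f x) = a * u f.
Proof.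
move=> ut sf; have := ut.1.1 a f (fun=> 0) sf (schwartz0 _ _).
have s0 := @schwartz0 R d.
have -> : u (fun=> 0) = 0.
  have := temperedD ut s0 s0; rewrite (_ : (fun x => 0 + 0) = fun=> 0); last by apply/funext => x; rewrite addr0.
  by move=> /eqP; rewrite -subr_eq0 opprD addNKr oppr_eq0 => /eqP.
move=> H; rewrite -[RHS]addr0; apply: etrans H.
by congr u; apply/funext => x; rewrite [RHS]addr0.
Qed.

End distributions.

(** * Continuous representatives *)

Section canonical_representatives.
Variables (R : realType) (d : nat).
Local Notation Rd := 'rV[R]_d.
Local Notation C := R[i].
Local Notation mu := (lebesgue_rV R d).
Implicit Types (f g h F G : Rd -> C) (u v : functional R d) (w : Rd -> R) (i j : 'I_d) (s : R).

Definition lipschitz F := exists2 A : R, 0 <= A & forall x y, n1 (F x - F y) <= A * `|x - y|.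

Lemma lipschitz_cmeasurable F : lipschitz F -> cmeasurable F.
Proof.
move=> [A A0 FA].
have lip (p : C -> R) : (forall z, `|p z| <= n1 z) -> (forall z z', p (z - z') = p z - p z') ->
    measurable_fun setT (fun x => p (F x)).
  move=> p1 pB; apply: continuous_measurable_rV => x.
  apply/(@cvgrPdist_lt _ R _ (nbhs (x : Rd)) (nbhs_filter (x : Rd))) => e e0; apply/nbhs_ballP; exists (e / (A + 1)) => /=.
    by rewrite divr_gt0// ltr_wpDl.
  move=> y; rewrite -ball_normE /= => xy; rewrite -pB.
  apply: le_lt_trans (le_trans (p1 _) (FA _ _)) _.
  apply: (@le_lt_trans _ _ ((A + 1) * `|x - y|)); first by rewrite ler_wpM2r// lerDl.
  by rewrite mulrC -ltr_pdivlMr// ltr_wpDl.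
split; apply: lip.
- by move=> z; exact: Re_le_n1.
- by move=> z z'; rewrite ReD ReN.
- by move=> z; exact: Im_le_n1.
- by move=> z z'; rewrite ImD ImN.
Qed.

Lemma given_by_test_eq u f g : given_by u f -> given_by u g -> test_eq f g.
Proof. by move=> [_ uf] [_ ug] h sh; rewrite -(uf h sh).2 -(ug h sh).2. Qed.

(** The weight with e^(n logw) = jb^n: through it polynomial decay is an instance
of the weighted estimates. *)
Definition logw (x : Rd) : R := ln (jb x).

Lemma expR_logw n x : expR (n%:R * logw x) = jb x ^+ n.
Proof. by rewrite expRM_natl lnK// posrE. Qed.

Lemma expRN_logw n x : expR (- (n%:R * logw x)) = jbi n x.
Proof. by rewrite expRN expR_logw. Qed.

Lemma wloc_logw : wloc logw 1 (ln 2) 1.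
Proof.
split=> // [|x|x y xy]; first by rewrite ln_ge0// ler1n.
  exact: ln_ge0.
rewrite mul1r -lnM ?posrE// ler_ln ?posrE ?mulr_gt0//.
rewrite -[x](subrK y); apply: le_trans (jbD _ _) _.
by rewrite mulrC ler_wpM2l// /jb; lra.
Qed.

(** A Lipschitz representative inherits the decay of any other representative, with
the rate divided by L, because w is comparable on the ball where the mean
values are taken. *)
Lemma given_by_lipschitz_bound w L E de u F f (P lam : R) : wloc w L E de -> 0 <= lam ->
  lipschitz F -> given_by u F -> given_by u f ->
  (forall x, n1 (f x) <= P * expR (- (lam * w x))) ->
  forall x, n1 (F x) <= P * expR (lam / L * E) * expR (- (lam / L * w x)).
Proof.
move=> [L1 E0 de0 w0 wle] lam0 lF uF uf fP x.
have L0 : 0 < L by lra.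
have mF := lipschitz_cmeasurable lF.
have [A A0 FA] := lF.
have P0 : 0 <= P by have := le_trans (n1_ge0 _) (fP x); rewrite pmulr_lge0// expR_gt0.
apply: (mollify_bound (de := de) (B' := P) A0 mF uf.1 _ (given_by_test_eq uF uf)) => // y.
  move=> yx; apply: le_trans (fP y) _; rewrite -mulrA ler_wpM2l// -expRD ler_expR.
  have := wle x y; rewrite distrC => /(_ yx) h.
  have -> : - (lam * w y) = lam / L * (- (L * w y)) by field; rewrite lt0r_neq0.
  rewrite -mulrBr; apply: ler_wpM2l; last lra.
  by rewrite divr_ge0// ltW.
apply: le_trans (fP y) _; rewrite ler_piMr// -expR0 ler_expR oppr_le0 mulr_ge0//.
Qed.

(** F represents u, ft 1 F represents the transform of u, and the two functions
are Lipschitz and Fourier inverse to each other: this is the representative on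
which all pointwise estimates are made. *)
Record canon u F : Prop := Canon {
  canon_rep : given_by u F ;
  canon_ft : given_by (td_fourier u) (ft 1 F) ;
  canon_inv : ft (- 1) (ft 1 F) = F ;
  canon_lip : lipschitz F ;
  canon_lip_ft : lipschitz (ft 1 F) ;
  canon_reg : u = regular F }.

Lemma decays_bound f M N : decays f M N -> forall x, n1 (f x) <= M.
Proof.
move=> dM x; apply: le_trans (dM.2 x) _; rewrite ler_piMr ?jbi_le1//.
exact: decays_M_ge0 dM.
Qed.

Lemma lipschitz_rep_unique u F G (M N : R) : lipschitz F -> lipschitz G ->
  (forall x, n1 (F x) <= M) -> (forall x, n1 (G x) <= N) ->
  given_by u F -> given_by u G -> F = G.
Proof.
move=> lF lG FM GN uF uG; have [A A0 HA] := lF; have [B B0 HB] := lG.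
have M0 : 0 <= M by apply: le_trans (FM 0); exact: n1_ge0.
have N0 : 0 <= N by apply: le_trans (GN 0); exact: n1_ge0.
have AB : 0 <= A + B by rewrite addr_ge0.
apply: (@test_eq_lipschitz _ _ _ _ (A + B) (M + N) AB).
- exact: lipschitz_cmeasurable.
- exact: lipschitz_cmeasurable.
- by move=> x y; apply: (le_trans (HA _ _)); apply: ler_wpM2r => //; rewrite lerDl.
- by move=> x y; apply: (le_trans (HB _ _)); apply: ler_wpM2r => //; rewrite lerDr.
- by move=> x; apply: (le_trans (FM x)); rewrite lerDl.
- by move=> x; apply: (le_trans (GN x)); rewrite lerDr.
- exact: given_by_test_eq uF uG.
Qed.

Lemma given_by_ft u f : cintegrable f -> given_by u f -> lipschitz (ft 1 f) ->
  given_by (td_fourier u) (ft 1 f).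
Proof.
move=> cf uf lf.
have [k ik fk] : exists2 k : Rd -> R, rintegrable k & forall x, n1 (f x) <= k x.
  by exists (fun x => n1 (f x)); [exact: rintegrable_n1|].
apply: (given_by_bounded (lipschitz_cmeasurable lf) (fun x => n1_ft_le 1 x (cintegrable_measurable cf) ik fk)) => g sg.
rewrite td_fourierE// (uf.2 _ (schwartz_ft (oner_neq0 _) sg)).2.
exact: ft_exchange (schwartz_integrable sg).
Qed.

Lemma given_by_ftN u f : cintegrable f -> given_by (td_fourier u) f -> lipschitz (ft (- 1) f) ->
  given_by u (ft (- 1) f).
Proof.
move=> cf uf lf.
have [k ik fk] : exists2 k : Rd -> R, rintegrable k & forall x, n1 (f x) <= k x.
  by exists (fun x => n1 (f x)); [exact: rintegrable_n1|].
apply: (given_by_bounded (lipschitz_cmeasurable lf) (fun x => n1_ft_le (-1) x (cintegrable_measurable cf) ik fk)) => g sg.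
have n10 : - 1 != 0 :> R by rewrite oppr_eq0 oner_eq0.
have sh := schwartz_ft n10 sg.
rewrite -(ft_exchange _ cf (schwartz_integrable sg)) -(uf.2 _ sh).2 td_fourierE//.
by rewrite ft_inversionN// mulr1.
Qed.

Lemma lipschitz_decays v F N : lipschitz F -> given_by v F ->
  (exists f M, given_by v f /\ decays f M N) -> exists M, decays F M N.
Proof.
move=> lF vF [f [M [vf [_ fM]]]]; exists (M * expR (N%:R / 1 * ln 2)).
split=> [|x]; first exact: lipschitz_cmeasurable.
rewrite -expRN_logw -[X in X * logw x]divr1.
apply: (given_by_lipschitz_bound wloc_logw (ler0n _ _) lF vF vf) => y.
by rewrite expRN_logw.
Qed.

(** The inverse transform F of f2 is Lipschitz and inherits the decay of f1, so
that its own transform is Lipschitz and inherits the decay of f2; then F and the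
inverse transform of ft 1 F are two Lipschitz representatives of u. *)
Lemma canon_exists u f1 f2 : tempered u -> given_by u f1 -> given_by (td_fourier u) f2 ->
  (exists M, decays f1 M (d.*2).+1) -> (exists M, decays f2 M (d.*2).+1) ->
  exists F, canon u F.
Proof.
move=> ut u1 u2 [M1 d1] [M2 d2].
have c1 : cintegrable f1 by apply: decays_integrable d1; rewrite leqW.
have c2 : cintegrable f2 by apply: decays_integrable d2; rewrite leqW.
pose F := ft (- 1) f2.
have lF : lipschitz F := ft_lipschitz _ d2.
have lG1 : lipschitz (ft 1 f1) := ft_lipschitz _ d1.
have uF : given_by u F := given_by_ftN c2 u2 lF.
have uG1 : given_by (td_fourier u) (ft 1 f1) := given_by_ft c1 u1 lG1.
have [N1 e1] := lipschitz_decays lF uF (ex_intro _ f1 (ex_intro _ M1 (conj u1 d1))).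
have cF : cintegrable F by apply: decays_integrable e1; rewrite leqW.
have lG : lipschitz (ft 1 F) := ft_lipschitz _ e1.
have uG : given_by (td_fourier u) (ft 1 F) := given_by_ft cF uF lG.
have [N3 e3] := lipschitz_decays lG uG (ex_intro _ f2 (ex_intro _ M2 (conj u2 d2))).
have cG : cintegrable (ft 1 F) by apply: decays_integrable e3; rewrite leqW.
have lF' : lipschitz (ft (- 1) (ft 1 F)) := ft_lipschitz _ e3.
have uF' := given_by_ftN cG uG lF'.
have [N4 e4] := lipschitz_decays lF' uF' (ex_intro _ f1 (ex_intro _ M1 (conj u1 d1))).
exists F; split => //; last exact: given_by_regular.
exact: lipschitz_rep_unique lF' lF (decays_bound e4) (decays_bound e1) uF' uF.
Qed.

End canonical_representatives.

(** * Weighted bounds for all derivatives *)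

Section quantitative_bounds.
Variables (R : realType) (d : nat).
Local Notation Rd := 'rV[R]_d.
Local Notation C := R[i].
Local Notation mu := (lebesgue_rV R d).
Implicit Types (f g h F G : Rd -> C) (u v : functional R d) (w eta omega : Rd -> R) (i j : 'I_d) (s : R).

(** The quantitative content of (gamma): polynomials of degree k are absorbed by
e^(m w). *)
Definition poly_dom w k (m : R) :=
  exists2 K : R, 0 <= K & forall x, jb x ^+ k <= K * expR (m * w x).

Lemma poly_dom_mono w k m k' m' : (forall x, 0 <= w x) -> (k' <= k)%N -> m <= m' ->
  poly_dom w k m -> poly_dom w k' m'.
Proof.
move=> w0 kk mm [K K0 HK]; exists K => // x; apply: le_trans (jbX_mono x kk) _.
by apply: le_trans (HK x) _; rewrite ler_wpM2l// ler_expR ler_wpM2r.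
Qed.

Lemma poly_dom_logw k : poly_dom (@logw R d) k k%:R.
Proof. by exists 1 => // x; rewrite mul1r expR_logw. Qed.

Lemma poly_dom_decays w k m : poly_dom w k m -> exists2 K : R, 0 <= K &
  forall f P, cmeasurable f -> 0 <= P -> (forall x, n1 (f x) <= P * expR (- (m * w x))) ->
  decays f (K * P) k.
Proof.
move=> [K K0 HK]; exists K => // f P mf P0 fP; split=> // x.
apply: le_trans (fP x) _; rewrite [K * P]mulrC -mulrA ler_wpM2l// /jbi.
by rewrite ler_pdivlMr// expRN mulrC ler_pdivrMr ?expR_gt0.
Qed.

(** The derivatives of ft s G are bounded by ft_words, hence decay by
interp_mderiv; half of the resulting rate absorbs the factor jb^k. The bound is
linear in the two constants B and P. *)
Lemma ft_wnorm_bound w L E de k (lam lam' s : R) : wloc w L E de -> 0 < lam ->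
  lam' <= lam / (2 * L) ^+ d / 2 -> poly_dom w k (lam / (2 * L) ^+ d / 2) ->
  exists2 A : R, 0 <= A & forall G B P, decays G B (d.*2 + k * d.+1).+2 ->
  smooth (ft s G) -> (forall x, n1 (ft s G x) <= P * expR (- (lam * w x))) ->
  (wnorm w k k lam' (ft s G) <= (A * (B + P))%:E)%E.
Proof.
move=> wl lam0; set m := lam / _ => ll [K K0 HK]; have w0 := wloc_ge0 wl.
have [A1 A10 H1] := @ft_words R d s (k * d.+1).
have [A2 A21 H2] := interp_mderiv k wl lam0.
have A20 : 0 <= A2 by rewrite (le_trans _ A21).
exists (A2 * (1 + A1) * K) => [|G B P dG sG GP].
  by rewrite !mulr_ge0// addr_ge0.
have B0 := decays_M_ge0 dG.
have P0 : 0 <= P by have := le_trans (n1_ge0 _) (GP 0); rewrite pmulr_lge0// expR_gt0.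
pose P' := P + A1 * B.
have P'0 : 0 <= P' by rewrite addr_ge0// mulr_ge0.
have PP' : P' <= (1 + A1) * (B + P).
  have : 0 <= A1 * P by rewrite mulr_ge0.
  by rewrite /P'; lra.
apply: wnorm_le => t x tk.
have [a at_ ->] := Dw_mderiv t sG.
have h := H2 (ft s G) P' a _ sG _ _ x.
have {h} h : n1 (mderiv a (ft s G) x) <= A2 * P' * expR (- (m * w x)).
  apply: h; first by rewrite at_.
    move=> y; apply: le_trans (GP y) _; rewrite ler_wpM2r ?expR_ge0//.
    by rewrite lerDl mulr_ge0.
  by move=> r y rk; apply: le_trans ((H1 _ _ _ dG rk).2 y) _; rewrite lerDr.
apply: (@le_trans _ _ (K * expR (m / 2 * w x) * (A2 * P' * expR (- (m * w x))) * expR (m / 2 * w x))).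
  apply: ler_pM; rewrite ?expR_ge0 ?mulr_ge0 ?n1_ge0//; last by rewrite ler_expR ler_wpM2r.
  by apply: ler_pM; rewrite ?n1_ge0.
have -> : K * expR (m / 2 * w x) * (A2 * P' * expR (- (m * w x))) * expR (m / 2 * w x) =
   A2 * P' * K * (expR (m / 2 * w x) * expR (- (m * w x)) * expR (m / 2 * w x)) by ring.
rewrite -!expRD (_ : m / 2 * w x - m * w x + m / 2 * w x = 0); last by field.
rewrite expR0 mulr1 [leRHS](_ : _ = A2 * ((1 + A1) * (B + P)) * K); last by ring.
by apply: ler_wpM2r => //; apply: ler_wpM2l.
Qed.

Lemma wnorm0 w k l f : wnorm w k l 0 f = wnorm (fun _ : Rd => 0 : R) k l 1 f.
Proof.
rewrite /wnorm; congr ereal_sup; apply/seteqP; split=> r [a [b [x [h1 h2 ->]]]];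
  by exists a, b, x; split => //; rewrite mul0r mulr0.
Qed.

(** The bounds of order N may come from different representatives: the canonical
one inherits all of them. Its derivatives decay by the previous lemma for the
weight logw. *)
Lemma rapid_schwartz u : tempered u ->
  (forall N, exists f M, given_by u f /\ decays f M N) ->
  (forall N, exists f M, given_by (td_fourier u) f /\ decays f M N) ->
  exists2 F, canon u F & schwartz F.
Proof.
move=> ut H1 H2; have [f1 [M1 [u1 d1]]] := H1 (d.*2).+1; have [f2 [M2 [u2 d2]]] := H2 (d.*2).+1.
have [F cF] := canon_exists ut u1 u2 (ex_intro _ M1 d1) (ex_intro _ M2 d2).
have dF N := lipschitz_decays (canon_lip cF) (canon_rep cF) (H1 N).
have dG N := lipschitz_decays (canon_lip_ft cF) (canon_ft cF) (H2 N).
have sF : smooth F by rewrite -(canon_inv cF); exact: ft_smooth.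
exists F => //; split => // k.
(* L = 1 for logw; the rate left after interpolation and halving is k + 1 *)
pose lam : R := k.+1%:R * (2 * 1) ^+ d * 2.
have lam0 : 0 < lam by rewrite !mulr_gt0// ?exprn_gt0// mulr1.
have lamE : lam / (2 * 1) ^+ d / 2 = k.+1%:R.
  by rewrite /lam; field; rewrite mulr1 expf_neq0.
have pd : poly_dom (@logw R d) k (lam / (2 * 1) ^+ d / 2).
  apply: poly_dom_mono (poly_dom_logw k) => //; first exact: wloc_ge0 (@wloc_logw R d).
  by rewrite lamE ler_nat.
have lam'0 : 0 <= lam / (2 * 1) ^+ d / 2 by rewrite lamE.
have [A A0 HA] := ft_wnorm_bound (- 1) (@wloc_logw R d) lam0 lam'0 pd.
have [B dB] := dG (d.*2 + k * d.+1).+2.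
pose n := (2 * k.+1 * 2 ^ d)%N.
have [P dP] := dF n.
have := HA _ _ P dB; rewrite (canon_inv cF) wnorm0 => /(_ sF) h.
apply: le_lt_trans (h _) (ltry _) => x.
have -> : lam = n%:R by rewrite /lam /n !natrM natrX mulr1; ring.
by rewrite expRN_logw; exact: dP.2.
Qed.

End quantitative_bounds.

(** * The norms of the two scales of spaces *)

Section seminorms.
Variables (R : realType) (d : nat).
Local Notation Rd := 'rV[R]_d.
Local Notation C := R[i].
Local Notation mu := (lebesgue_rV R d).
Local Notation mi0 := (@mindex0 d).
Implicit Types (f g h F G : Rd -> C) (u v : functional R d) (w eta omega : Rd -> R) (i j : 'I_d) (s lam : R) (a : multiindex d).

Lemma dsup_ge0 a w lam u : (0 <= dsup a w lam u)%E.
Proof.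
apply: le_ereal_inf_tmp => _ [f uf ->].
apply: le_trans (_ : _ <= (`|monomial a (0 : Rd)| * cmod (f 0) * expR (lam * w 0))%:E)%E _.
  by rewrite lee_fin !mulr_ge0 ?cmod_ge0 ?expR_ge0.
by apply: ereal_sup_ubound; exists 0.
Qed.

Lemma wnorm_ge0 w k l lam f : (0 <= wnorm w k l lam f)%E.
Proof.
apply: le_trans (_ : _ <= (`|monomial mi0 (0 : Rd)| * cmod (mderiv mi0 f 0) * expR (lam * w 0))%:E)%E _.
  by rewrite lee_fin !mulr_ge0 ?cmod_ge0 ?expR_ge0.
by apply: ereal_sup_ubound; exists mi0, mi0, 0; rewrite mlen0.
Qed.

(** Passing from the modulus to n1 costs a factor 2. *)
Lemma dsup_lt a w lam u P : (dsup a w lam u < P%:E)%E ->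
  exists2 f, given_by u f &
    forall x, `|monomial a x| * n1 (f x) <= 2 * P * expR (- (lam * w x)).
Proof.
move=> /ereal_inf_lt[_ [f uf ->]] fP; exists f => // x.
rewrite expRN ler_pdivlMr ?expR_gt0//.
apply: (@le_trans _ _ (2 * (`|monomial a x| * cmod (f x) * expR (lam * w x)))).
  rewrite !mulrA ler_wpM2r ?expR_ge0// [2 * _]mulrC -mulrA ler_wpM2l//.
  exact: n1_le_cmod.
rewrite ler_wpM2l// -lee_fin; apply: le_trans (ltW fP).
by apply: ereal_sup_ubound; exists x.
Qed.

Lemma dsup_le a w lam u f (P : \bar R) : given_by u f ->
  (forall x, (`|monomial a x| * cmod (f x) * expR (lam * w x))%:E <= P)%E ->
  (dsup a w lam u <= P)%E.
Proof.
move=> uf fP; apply: le_trans (_ : _ <= ereal_sup [set (`|monomial a x| * cmod (f x) *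
                        expR (lam * w x))%:E | x in setT])%E _.
  by apply: ereal_inf_lbound; exists f.
by apply: ge_ereal_sup => _ [x _ <-].
Qed.

Lemma dsup_fin w lam u f P : given_by u f ->
  (forall x, n1 (f x) <= P * expR (- (lam * w x))) -> (dsup mi0 w lam u < +oo)%E.
Proof.
move=> uf fP; apply: le_lt_trans (ltry P); apply: (dsup_le uf) => x.
rewrite lee_fin monomial0 normr1 mul1r -ler_pdivlMr ?expR_gt0// -expRN.
by apply: le_trans (cmod_le_n1 _) _.
Qed.

Lemma dsup_le_wnorm a k l w lam u f : (mlen a <= l)%N -> given_by u f ->
  (dsup a w lam u <= wnorm w k l lam f)%E.
Proof.
move=> al uf; apply: (dsup_le uf) => x.
by apply: ereal_sup_ubound; exists mi0, a, x; rewrite mderiv0 mlen0.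
Qed.

Lemma dsup_mono a w lam lam' u : (forall x, 0 <= w x) -> lam <= lam' ->
  (dsup a w lam u <= dsup a w lam' u)%E.
Proof.
move=> w0 ll; apply: le_ereal_inf_tmp => _ [f uf ->]; apply: (dsup_le uf) => x.
apply: le_trans (_ : _ <= (`|monomial a x| * cmod (f x) * expR (lam' * w x))%:E)%E _.
  by rewrite lee_fin ler_wpM2l ?mulr_ge0 ?cmod_ge0// ler_expR ler_wpM2r.
by apply: ereal_sup_ubound; exists x.
Qed.

(** The norm defining GS_step. *)
Definition gs_norm eta omega lam u : \bar R :=
  (dsup mi0 eta lam u + dsup mi0 omega lam (td_fourier u))%E.

Lemma gs_norm_mono eta omega lam lam' u : (forall x, 0 <= eta x) -> (forall x, 0 <= omega x) ->
  lam <= lam' -> (gs_norm eta omega lam u <= gs_norm eta omega lam' u)%E.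
Proof. by move=> ? ? ?; apply: leeD; exact: dsup_mono. Qed.

Lemma gs_norm_lt eta omega lam u P : (gs_norm eta omega lam u < P%:E)%E ->
  (exists2 f, given_by u f & forall x, n1 (f x) <= 2 * P * expR (- (lam * eta x))) /\
  (exists2 f, given_by (td_fourier u) f &
     forall x, n1 (f x) <= 2 * P * expR (- (lam * omega x))).
Proof.
move=> uP.
have [/dsup_lt[f uf fP] /dsup_lt[g ug gP]] :
   (dsup mi0 eta lam u < P%:E)%E /\ (dsup mi0 omega lam (td_fourier u) < P%:E)%E.
  split; apply: le_lt_trans uP; first by rewrite leeDl// dsup_ge0.
  by rewrite leeDr// dsup_ge0.
by split; [exists f|exists g] => // x; [have := fP x|have := gP x];
  rewrite monomial0 normr1 mul1r.
Qed.

Lemma ereal_fin_bound (a : \bar R) : (0 <= a)%E -> (a < +oo)%E ->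
  exists2 P : R, 0 < P & (a < P%:E)%E.
Proof.
case: a => // r r0 _; exists (r + 1); last by rewrite lte_fin ltrDl.
by rewrite ltr_wpDl// -lee_fin.
Qed.

Lemma gs_norm_ge0 eta omega lam u : (0 <= gs_norm eta omega lam u)%E.
Proof. by rewrite adde_ge0// dsup_ge0. Qed.

Lemma gs_norm_gt0 eta omega lam u P : (gs_norm eta omega lam u < P%:E)%E -> 0 < P.
Proof. by move=> h; rewrite -lte_fin (le_lt_trans _ h)// gs_norm_ge0. Qed.

Lemma gs_schwartz eta omega u : tempered u ->
  (forall N, exists lam, [/\ poly_dom eta N lam, poly_dom omega N lam &
     (gs_norm eta omega lam u < +oo)%E]) ->
  exists2 F, canon u F & schwartz F.
Proof.
move=> ut H; apply: rapid_schwartz => // N; have [lam [p1 p2 /ereal_fin_bound]] := H N.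
  move=> /(_ (gs_norm_ge0 _ _ _ _))[P P0 /gs_norm_lt[[f uf fP] _]].
  have [K K0 HK] := poly_dom_decays p1; exists f, (K * (2 * P)); split=> //.
  by apply: HK fP; [exact: uf.1|rewrite mulr_ge0// ltW].
move=> /(_ (gs_norm_ge0 _ _ _ _))[P P0 /gs_norm_lt[_ [f uf fP]]].
have [K K0 HK] := poly_dom_decays p2; exists f, (K * (2 * P)); split=> //.
by apply: HK fP; [exact: uf.1|rewrite mulr_ge0// ltW].
Qed.

(** Passage from the norm of GS_step to the seminorms of order k of GSt_step: the
rate lam is divided once by L (pointwise bound on F) and then by
2 (2 L)^d (derivatives and polynomial factor), a loss that does not depend
on k. *)
Lemma gs_norm_wnorm eta omega L E de k lam lam' :
  wloc eta L E de -> wloc omega L E de -> 0 < lam ->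
  lam' <= lam / L / (2 * L) ^+ d / 2 ->
  poly_dom eta k (lam / L / (2 * L) ^+ d / 2) ->
  poly_dom omega k (lam / L / (2 * L) ^+ d / 2) ->
  poly_dom eta (d.*2 + k * d.+1).+2 (lam / L) ->
  poly_dom omega (d.*2 + k * d.+1).+2 (lam / L) ->
  exists2 A : R, 0 <= A & forall u F P, canon u F -> smooth F -> smooth (ft 1 F) ->
    (gs_norm eta omega lam u < P%:E)%E ->
    (wnorm eta k k lam' F + wnorm omega k k lam' (fourier F) <= (A * P)%:E)%E.
Proof.
move=> we wo lam0 ll pe po pe' po'.
have L1 := wloc_L we; have L0 : 0 < L by lra.
have lamL : 0 < lam / L by rewrite divr_gt0.
have [A1 A10 H1] := ft_wnorm_bound (- 1) we lamL ll pe.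
have [A2 A20 H2] := ft_wnorm_bound 1 wo lamL ll po.
have [K1 K10 HK1] := poly_dom_decays pe'.
have [K2 K20 HK2] := poly_dom_decays po'.
pose c := expR (lam / L * E).
have c0 : 0 <= c by exact: expR_ge0.
exists (A1 * (K2 * (2 * c) + 2 * c) + A2 * (K1 * (2 * c) + 2 * c)).
  by rewrite addr_ge0// mulr_ge0// addr_ge0 ?mulr_ge0.
move=> u F P cF sF sG uP; have P0 := gs_norm_gt0 uP.
have [[f1 u1 f1P] [f2 u2 f2P]] := gs_norm_lt uP.
have bF := given_by_lipschitz_bound we (ltW lam0) (canon_lip cF) (canon_rep cF) u1 f1P.
have bG := given_by_lipschitz_bound wo (ltW lam0) (canon_lip_ft cF) (canon_ft cF) u2 f2P.
have Pc0 : 0 <= 2 * P * c by rewrite !mulr_ge0// ltW.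
have dF := HK1 F _ (lipschitz_cmeasurable (canon_lip cF)) Pc0 bF.
have dG := HK2 _ _ (lipschitz_cmeasurable (canon_lip_ft cF)) Pc0 bG.
rewrite mulrDl EFinD; apply: leeD.
  have := H1 _ _ (2 * P * c) dG; rewrite (canon_inv cF) => /(_ sF bF).
  by rewrite [X in (_ <= X%:E)%E -> _](_ : _ = A1 * (K2 * (2 * c) + 2 * c) * P)//; ring.
have := H2 _ _ (2 * P * c) dF sG bG; rewrite (_ : ft 1 F = fourier F).
  by rewrite [X in (_ <= X%:E)%E -> _](_ : _ = A2 * (K1 * (2 * c) + 2 * c) * P)//; ring.
by apply/funext => x; rewrite ft1.
Qed.

Lemma ft1_fourier f : fourier f = ft 1 f.
Proof. by apply/funext => x; rewrite ft1. Qed.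

Lemma schwartz_fourier f : schwartz f -> schwartz (fourier f).
Proof. by move=> sf; rewrite ft1_fourier; exact: schwartz_ft (oner_neq0 _) sf. Qed.

Lemma given_by_schwartz f : schwartz f -> given_by (regular f) f.
Proof.
move=> sf; have [M M0 fM] := schwartz_decay 0 sf.
apply: (@given_by_regular_self _ _ _ M) => [|x]; first exact: schwartz_cmeasurable.
by apply: le_trans (fM x) _; rewrite ler_piMr ?jbi_le1.
Qed.

Lemma given_by_schwartz_fourier f : schwartz f ->
  given_by (td_fourier (regular f)) (fourier f).
Proof.
move=> sf; rewrite ft1_fourier; apply: given_by_ft (schwartz_integrable sf) (given_by_schwartz sf) _.
have [M fM] := schwartz_decays (d.*2).+1 sf; exact: ft_lipschitz fM.
Qed.

Lemma gst_seminorm_le eta omega lam k f : schwartz f ->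
  (GSt_seminorm eta omega lam k (regular f) <=
   wnorm eta k k lam f + wnorm omega k k lam (fourier f))%E.
Proof. by move=> sf; apply: ereal_inf_lbound; exists f. Qed.

Lemma gs_norm_le_gst eta omega lam k u :
  (gs_norm eta omega lam u <= GSt_seminorm eta omega lam k u)%E.
Proof.
apply: le_ereal_inf_tmp => _ [f [sf -> ->]]; apply: leeD; apply: dsup_le_wnorm; rewrite ?mlen0//.
  exact: given_by_schwartz.
exact: given_by_schwartz_fourier.
Qed.

Lemma gst_seminorm_lt eta omega lam k u P :
  (GSt_seminorm eta omega lam k u < P)%E ->
  exists f, [/\ schwartz f, u = regular f &
    (wnorm eta k k lam f + wnorm omega k k lam (fourier f) < P)%E].
Proof. by move=> /ereal_inf_lt[_ [f [sf -> ->]] h]; exists f. Qed.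

Lemma schwartz_distr_tempered u : schwartz_distr u -> tempered u.
Proof.
move=> [f sf <-]; have [M M0 fM] := schwartz_decay 0 sf.
apply: (@regular_tempered _ _ _ M) => [|x]; first exact: schwartz_cmeasurable.
by apply: le_trans (fM x) _; rewrite ler_piMr ?jbi_le1.
Qed.

End seminorms.

(** * Equality of the two locally convex spaces *)

Section topologies.
Variables (R : realType) (d : nat).
Local Notation Rd := 'rV[R]_d.
Local Notation C := R[i].
Implicit Types (f g h F G : Rd -> C) (u v : functional R d) (w eta omega : Rd -> R) (i j : 'I_d) (s lam : R) (a : multiindex d).

(** (gamma) as absorption of polynomials: at some rate in the Beurling case, at
every rate in the Roumieu case. *)
Definition admissible (c : regime) w : Prop :=
  match c with
  | Beurling => forall k, exists2 m : R, 0 < m & poly_dom w k m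
  | Roumieu => forall k (m : R), 0 < m -> poly_dom w k m
  end.

Lemma norm_le_enorm (x : Rd) : `|x| <= enorm x.
Proof.
apply: norm_rV_le => [|i]; first exact: sqrtr_ge0.
rewrite -sqrtr_sqr; apply: ler_wsqrtr; rewrite (bigD1 i)//= lerDl sumr_ge0// => j _.
exact: sqr_ge0.
Qed.

(** In the Roumieu case (gamma) dominates polynomials outside a ball, and the
constant of poly_dom takes care of the ball; ln (1 + t) <= 2 ln t for t >= 2
bridges the two logarithms. *)
Lemma cond_gamma_admissible c w : (forall x, 0 <= w x) -> cond_gamma c w -> admissible c w.
Proof.
move=> w0; have e0 (x : Rd) : 0 <= enorm x by exact: sqrtr_ge0.
case: c => /= [[A [B [A0 B0 H]]] k|H k m m0].
  exists (k.+1%:R / A); first by rewrite divr_gt0.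
  exists (expR (k%:R / A * ln B)); first exact: expR_ge0.
  move=> x; rewrite -expRD.
  apply: (@le_trans _ _ ((1 + enorm x) ^+ k)).
    by rewrite lerXn2r ?nnegrE ?addr_ge0// lerD2l norm_le_enorm.
  have p0 : 0 < 1 + enorm x by rewrite ltr_wpDr.
  rewrite -[1 + enorm x]lnK ?posrE// -expRM_natl ler_expR.
  apply: (@le_trans _ _ (k%:R / A * (A * ln (1 + enorm x)))).
    by rewrite mulrA divfK ?lt0r_neq0.
  apply: (@le_trans _ _ (k%:R / A * (w x + ln B))).
    by rewrite ler_wpM2l// divr_ge0// ltW.
  rewrite mulrDr addrC lerD2l ler_wpM2r// ler_wpM2r ?invr_ge0 ?(ltW A0)//.
  by rewrite ler_nat.
have [r Hr] := H (2 * k%:R / m).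
pose r' := Num.max r 2.
have r'2 : 2 <= r' by rewrite le_max lexx orbT.
exists ((1 + r') ^+ k); first by rewrite exprn_ge0//; lra.
move=> x; have [xr|xr] := leP (enorm x) r'.
  apply: (@le_trans _ _ ((1 + r') ^+ k)).
    rewrite lerXn2r ?nnegrE//; [by rewrite addr_ge0//; lra|].
    by rewrite lerD2l (le_trans (norm_le_enorm x)).
  rewrite ler_peMr ?exprn_ge0 ?addr_ge0//; first lra.
  by rewrite -expR0 ler_expR mulr_ge0// ltW.
have x2 : 2 < enorm x := le_lt_trans r'2 xr.
have rx : r < enorm x by apply: le_lt_trans xr; rewrite le_max lexx.
have ln0 : 0 < ln (enorm x) by rewrite ln_gt0//; lra.
have := Hr x rx; rewrite ler_pdivlMr// => h.
rewrite -[leLHS]mul1r; apply: ler_pM => //.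
  by rewrite exprn_ege1//; lra.
apply: (@le_trans _ _ (expR (2 * k%:R * ln (enorm x)))).
  rewrite -mulrA mulrCA mulrC expRM_natr; rewrite lerXn2r ?nnegrE ?expR_ge0//.
  rewrite mulr2n mulrDl mul1r expRD lnK ?posrE; last lra.
  apply: (@le_trans _ _ (1 + enorm x)); first by rewrite lerD2l norm_le_enorm.
  nra.
rewrite ler_expR; have -> : 2 * k%:R * ln (enorm x) = m * (2 * k%:R / m * ln (enorm x)).
  by field; rewrite lt0r_neq0.
by rewrite ler_wpM2l// ltW.
Qed.

Lemma wloc_common w1 w2 : weight w1 -> cond_alpha w1 -> weight w2 -> cond_alpha w2 ->
  exists L E de, wloc w1 L E de /\ wloc w2 L E de.
Proof.
move=> W1 a1 W2 a2; have [L1 [E1 [de1 [h11 h12 h13 h14 h15]]]] := weight_wloc W1 a1.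
have [L2 [E2 [de2 [h21 h22 h23 h24 h25]]]] := weight_wloc W2 a2.
exists (L1 + L2), (E1 + E2), (Num.min de1 de2).
split; split; rewrite ?addr_ge0 ?lt_min ?h13 ?h23//; try lra.
- move=> x y; rewrite lt_min => /andP[/h15 h _]; have := h14 y => wy.
  have : 0 <= L2 * w1 y by rewrite mulr_ge0//; lra.
  lra.
- move=> x y; rewrite lt_min => /andP[_ /h25 h]; have := h24 y => wy.
  have : 0 <= L1 * w2 y by rewrite mulr_ge0//; lra.
  lra.
Qed.

(** Bases of neighbourhoods refining each other define the same open sets. *)
Lemma lcs_eq_refine (K : numFieldType) (V : lmodType K) (E F : lcs V) :
  lcs_carrier E = lcs_carrier F ->
  (forall N, lcs_base0 E N -> exists2 N', lcs_base0 F N' & N' `<=` N) ->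
  (forall N, lcs_base0 F N -> exists2 N', lcs_base0 E N' & N' `<=` N) ->
  lcs_eq E F.
Proof.
move=> cEF HE HF; split=> //; apply/seteqP; split=> U [Uc Un]; split.
- by rewrite -cEF.
- by move=> x /Un[N /HE[N' N'F N'N] NU]; exists N' => // v /N'N/NU.
- by rewrite cEF.
- by move=> x /Un[N /HF[N' N'F N'N] NU]; exists N' => // v /N'N/NU.
Qed.

Section fixed_weights.
Variables (eta omega : Rd -> R) (L E de : R).
Hypotheses (we : wloc eta L E de) (wo : wloc omega L E de).
Local Notation gsn := (gs_norm eta omega).
Local Notation gstn := (GSt_seminorm eta omega).

Lemma GS_carrierP c u : lcs_carrier (GS c eta omega) u <->
  quant c (fun lam => tempered u /\ (gsn lam u < +oo)%E).
Proof.
case: c => /=; split.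
- by move=> H lam lam0; have [ut /(_ tt) uf] := H lam lam0.
- by move=> H lam lam0; have [ut uf] := H lam lam0; split.
- by move=> [lam lam0 [ut /(_ tt) uf]]; exists lam.
- by move=> [lam lam0 [ut uf]]; exists lam => //; split.
Qed.

Lemma GSt_carrierP c u : lcs_carrier (GSt c eta omega) u <->
  quant c (fun lam => schwartz_distr u /\ forall k, (gstn lam k u < +oo)%E).
Proof. by case: c. Qed.

Lemma GS_tempered c u : lcs_carrier (GS c eta omega) u -> tempered u.
Proof.
by move=> /GS_carrierP; case: c => [/(_ 1 ltr01)[]|[lam _ []]].
Qed.

Lemma GSt_sub_GS c u : lcs_carrier (GSt c eta omega) u -> lcs_carrier (GS c eta omega) u.
Proof.
move=> /GSt_carrierP H; apply/GS_carrierP; case: c H => /= [H lam lam0|[lam lam0 H]].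
  have [us uk] := H lam lam0; split; first exact: schwartz_distr_tempered.
  exact: le_lt_trans (gs_norm_le_gst _ _ _ _ _) (uk 0%N).
have [us uk] := H; exists lam => //; split; first exact: schwartz_distr_tempered.
exact: le_lt_trans (gs_norm_le_gst _ _ _ _ _) (uk 0%N).
Qed.

Lemma GS_canon c u : admissible c eta -> admissible c omega ->
  lcs_carrier (GS c eta omega) u -> exists2 F, canon u F & schwartz F.
Proof.
move=> ae ao uG; apply: (gs_schwartz (eta := eta) (omega := omega) (GS_tempered uG)) => N.
move/GS_carrierP : uG; case: c ae ao => /= ae ao H.
  have [m m0 p1] := ae N; have [m' m'0 p2] := ao N; exists (m + m'); split.
  - by apply: poly_dom_mono p1 => //; [exact: wloc_ge0 we|rewrite lerDl ltW].
  - by apply: poly_dom_mono p2 => //; [exact: wloc_ge0 wo|rewrite lerDr ltW].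
  - by have [] := H (m + m') (addr_gt0 m0 m'0).
by have [lam lam0 [_ uf]] := H; exists lam; split => //; [exact: ae|exact: ao].
Qed.

(** The estimate making the inclusion of GS_step at lam into GSt_step at lam'
continuous; it is stated on F because the seminorms of GSt_step are infinite on
distributions that are not Schwartz functions. *)
Definition dominates lam lam' k := exists2 A : R, 0 <= A & forall u F P, canon u F -> schwartz F ->
    (gsn lam u < P%:E)%E -> (gstn lam' k u <= (A * P)%:E)%E.

Lemma dominates_wnorm lam lam' k : 0 < lam ->
  lam' <= lam / L / (2 * L) ^+ d / 2 ->
  poly_dom eta k (lam / L / (2 * L) ^+ d / 2) ->
  poly_dom omega k (lam / L / (2 * L) ^+ d / 2) ->
  poly_dom eta (d.*2 + k * d.+1).+2 (lam / L) ->
  poly_dom omega (d.*2 + k * d.+1).+2 (lam / L) -> dominates lam lam' k.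
Proof.
move=> lam0 ll p1 p2 p3 p4; have [A A0 HA] := gs_norm_wnorm we wo lam0 ll p1 p2 p3 p4.
exists A => // u F P cF sF uP; rewrite (canon_reg cF).
apply: le_trans (gst_seminorm_le _ _ _ _ sF) _.
by apply: HA cF _ _ uP; [exact: sF.1|rewrite -ft1_fourier; exact: (schwartz_fourier sF).1].
Qed.

Lemma dominates_fin lam lam' k u F : dominates lam lam' k -> canon u F -> schwartz F ->
  (gsn lam u < +oo)%E -> (gstn lam' k u < +oo)%E.
Proof.
move=> [A A0 HA] cF sF /(ereal_fin_bound (gs_norm_ge0 _ _ _ _))[P P0 uP].
by apply: le_lt_trans (HA u F P cF sF uP) (ltry _).
Qed.

(** The rate lam is chosen large after k, so that (gamma) absorbs polynomials
even at the rates remaining after all losses. *)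
Lemma dominates_beurling : admissible Beurling eta -> admissible Beurling omega ->
  forall lam' k, 0 < lam' -> exists2 lam, 0 < lam & dominates lam lam' k.
Proof.
move=> ae ao lam' k lam'0; have L1 := wloc_L we; have L0 : 0 < L by lra.
pose N := (d.*2 + k * d.+1).+2.
have [m1 m10 p1] := ae k; have [m2 m20 p2] := ao k.
have [m3 m30 p3] := ae N; have [m4 m40 p4] := ao N.
pose m := lam' + (m1 + m2 + (m3 + m4)).
have m0 : 0 < m by rewrite /m; lra.
have p0 : 0 < (2 * L) ^+ d by rewrite exprn_gt0//; lra.
(* the rate m is what remains of lam after all losses *)
pose lam := m * 2 * (2 * L) ^+ d * L.
have lam0 : 0 < lam by rewrite !mulr_gt0.
have e1 : lam / L / (2 * L) ^+ d / 2 = m.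
  by rewrite /lam; field; rewrite !lt0r_neq0//; lra.
have e2 : lam / L = m * 2 * (2 * L) ^+ d by rewrite /lam; field; rewrite lt0r_neq0.
have e3 : m <= m * 2 * (2 * L) ^+ d.
  rewrite -mulrA ler_pMr//; have : 1 <= (2 * L) ^+ d by rewrite exprn_ege1//; lra.
  lra.
exists lam => //; apply: dominates_wnorm => //; rewrite ?e1 ?e2.
- by rewrite /m; lra.
- by apply: poly_dom_mono p1 => //; [exact: wloc_ge0 we|rewrite /m; lra].
- by apply: poly_dom_mono p2 => //; [exact: wloc_ge0 wo|rewrite /m; lra].
- by apply: poly_dom_mono p3 => //; [exact: wloc_ge0 we|apply: le_trans e3; rewrite /m; lra].
- by apply: poly_dom_mono p4 => //; [exact: wloc_ge0 wo|apply: le_trans e3; rewrite /m; lra].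
Qed.

(** Since the loss of rate is the same for all k and (gamma) absorbs polynomials
at every rate, one lam' serves all seminorms. *)
Lemma dominates_roumieu : admissible Roumieu eta -> admissible Roumieu omega ->
  forall lam, 0 < lam -> exists2 lam', 0 < lam' & forall k, dominates lam lam' k.
Proof.
move=> ae ao lam lam0; have L1 := wloc_L we; have L0 : 0 < L by lra.
have p0 : 0 < (2 * L) ^+ d by rewrite exprn_gt0//; lra.
have l1 : 0 < lam / L by exact: divr_gt0.
have l2 : 0 < lam / L / (2 * L) ^+ d / 2 by rewrite !divr_gt0.
exists (lam / L / (2 * L) ^+ d / 2) => // k.
exact: (dominates_wnorm lam0 (lexx _) (ae _ _ l2) (ao _ _ l2) (ae _ _ l1) (ao _ _ l1)).
Qed.

Lemma GS_sub_GSt c u : admissible c eta -> admissible c omega ->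
  lcs_carrier (GS c eta omega) u -> lcs_carrier (GSt c eta omega) u.
Proof.
move=> ae ao uG; have [F cF sF] := GS_canon ae ao uG.
have us : schwartz_distr u by exists F => //; rewrite (canon_reg cF).
move/GS_carrierP : uG => uG; apply/GSt_carrierP; case: c ae ao uG => /= ae ao uG.
  move=> lam' lam'0; split=> // k; have [lam lam0 D] := dominates_beurling ae ao k lam'0.
  exact: dominates_fin D cF sF (uG lam lam0).2.
have [lam lam0 [_ uf]] := uG; have [lam' lam'0 D] := dominates_roumieu ae ao lam0.
by exists lam' => //; split=> // k; exact: dominates_fin (D k) cF sF uf.
Qed.

Lemma GS_eq_GSt_carrier c : admissible c eta -> admissible c omega ->
  lcs_carrier (GS c eta omega) = lcs_carrier (GSt c eta omega).
Proof.
by move=> ae ao; apply/seteqP; split=> u; [exact: GS_sub_GSt|exact: GSt_sub_GS].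
Qed.

(** Neighbourhoods of 0 in the Beurling space GS: the norms increase with lam, so
that a finite intersection of balls contains a ball of a single norm. *)
Let nbhd (P : set (functional R d)) := exists lam (e : R), [/\ 0 < lam, 0 < e &
  forall v, lcs_carrier (GS Beurling eta omega) v -> (gsn lam v < e%:E)%E -> P v].

Let nbhd_seq (T : eqType) (r : seq T) (Q : T -> set (functional R d)) :
  (forall t, t \in r -> nbhd (Q t)) -> nbhd [set v | forall t, t \in r -> Q t v].
Proof.
elim: r => [|t r IH] H; first by exists 1, 1.
have [l1 [e1 [l10 e10 H1]]] := H t (mem_head _ _).
have [l2 [e2 [l20 e20 H2]]] : nbhd [set v | forall t, t \in r -> Q t v].
  by apply: IH => t' t'r; apply: H; rewrite inE t'r orbT.
exists (Num.max l1 l2), (Num.min e1 e2); split; rewrite ?lt_min ?e10 ?e20 ?lt_max ?l10//.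
move=> v vC vN t'; rewrite inE => /orP[/eqP->|t'r].
  apply: H1 => //; apply: (@lt_le_trans _ _ (Num.min e1 e2)%:E).
    apply: le_lt_trans vN; apply: gs_norm_mono; [exact: wloc_ge0 we|exact: wloc_ge0 wo|].
    by rewrite le_max lexx.
  by rewrite lee_fin ge_min lexx.
apply: H2 t'r => //; apply: (@lt_le_trans _ _ (Num.min e1 e2)%:E).
  apply: le_lt_trans vN; apply: gs_norm_mono; [exact: wloc_ge0 we|exact: wloc_ge0 wo|].
  by rewrite le_max lexx orbT.
by rewrite lee_fin ge_min lexx orbT.
Qed.

Lemma GS_eq_GSt_beurling : admissible Beurling eta -> admissible Beurling omega ->
  lcs_eq (GS Beurling eta omega) (GSt Beurling eta omega).
Proof.
move=> ae ao; have cE := GS_eq_GSt_carrier ae ao; apply: lcs_eq_refine => //.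
  move=> N [r [M [HM ->]]].
  have /choice[e He] : forall l : R, exists e : R, l \in r ->
      [/\ 0 < l, 0 < e & forall v, (gsn l v < e%:E)%E -> (tempered v) -> M l v].
    move=> l; case: (boolP (l \in r)) => lr; last by exists 0.
    have [l0 [s' [e e0 ME]]] := HM l lr; exists e => _; split=> // v vl vt.
    rewrite ME; split=> [|i _]; last exact: vl.
    by split=> // _; exact: lt_trans vl (ltry _).
  exists [set v | lcs_carrier (GSt Beurling eta omega) v /\ forall l, l \in r ->
     [set v | lcs_carrier (GSt_step eta omega l) v /\
        forall k, k \in [:: 0%N] -> (gstn l k v < (e l)%:E)%E] v].
    exists r, (fun l => [set v | lcs_carrier (GSt_step eta omega l) v /\
        forall k, k \in [:: 0%N] -> (gstn l k v < (e l)%:E)%E]); split=> // l lr.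
    by have [l0 e0 _] := He l lr; split=> //; exists [:: 0%N], (e l).
  move=> v [vC vM]; split; first by rewrite [X in X v]cE.
  move=> l lr; have [l0 e0] := He l lr; have [[vs _] /(_ 0%N (mem_head _ _)) vl] := vM l lr.
  by apply; [exact: le_lt_trans (gs_norm_le_gst _ _ _ _ _) vl|exact: schwartz_distr_tempered].
move=> N [r [M [HM ->]]].
have [lam [e [lam0 e0 He]]] : nbhd [set v | forall l, l \in r -> M l v].
  apply: nbhd_seq => l lr; have [l0 [s' [e e0 ->]]] := HM l lr.
  have [lam [e' [lam0 e'0 He']]] : nbhd [set v | forall k, k \in s' -> (gstn l k v < e%:E)%E].
    apply: nbhd_seq => k _; have [lam lam0 [A A0 HA]] := dominates_beurling ae ao k l0.
    exists lam, (e / (A + 1)); split=> //; first by rewrite divr_gt0// ltr_wpDl.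
    move=> v vC vl; have [F cF sF] := GS_canon ae ao vC.
    apply: le_lt_trans (HA v F _ cF sF vl) _; rewrite lte_fin mulrCA gtr_pMr//.
    by rewrite ltr_pdivrMr ?ltr_wpDl//; lra.
  exists lam, e'; split=> // v vC vl; split; last exact: He'.
  by have := vC; rewrite cE => /(_ l l0).
exists [set v | lcs_carrier (GS Beurling eta omega) v /\ forall l, l \in [:: lam] ->
   [set v | lcs_carrier (GS_step eta omega l) v /\
      forall k : unit, k \in [:: tt] -> (gsn l v < e%:E)%E] v].
  exists [:: lam], (fun l => [set v | lcs_carrier (GS_step eta omega l) v /\
      forall k : unit, k \in [:: tt] -> (gsn l v < e%:E)%E]); split=> // l.
  by rewrite inE => /eqP->; split=> //; exists [:: tt], e.
move=> v [vC /(_ lam (mem_head _ _))[_ /(_ tt (mem_head _ _)) vl]]; split.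
  by rewrite -[X in X v]cE.
exact: He.
Qed.

(** An absolutely convex set is a neighbourhood of 0 for both inductive limits at
once: only the traces on the steps have to be compared. *)
Lemma GS_eq_GSt_roumieu : admissible Roumieu eta -> admissible Roumieu omega ->
  lcs_eq (GS Roumieu eta omega) (GSt Roumieu eta omega).
Proof.
move=> ae ao; have cE := GS_eq_GSt_carrier ae ao; apply: lcs_eq_refine => // W [WC Wc WN].
  exists W => //; split=> //; first by move=> v /WC vC; rewrite -[X in X v]cE.
  move=> l l0; have [N [s' [e e0 NE]] NW] := WN l l0.
  exists [set v | lcs_carrier (GSt_step eta omega l) v /\
     forall k, k \in [:: 0%N] -> (gstn l k v < e%:E)%E]; first by exists [:: 0%N], e.
  move=> v [[vs _] /(_ 0%N (mem_head _ _)) vl]; apply: NW; rewrite NE.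
  have vl' : (gsn l v < e%:E)%E by exact: le_lt_trans (gs_norm_le_gst _ _ _ _ _) vl.
  split=> [|k _]; last exact: vl'.
  by split=> [|_]; [exact: schwartz_distr_tempered|exact: lt_trans vl' (ltry _)].
exists W => //; split=> //; first by move=> v /WC vC; rewrite [X in X v]cE.
move=> lam lam0; have [lam' lam'0 D] := dominates_roumieu ae ao lam0.
have [N [s' [e e0 NE]] NW] := WN lam' lam'0.
have [e' e'0 He'] : exists2 e' : R, 0 < e' & forall v F k, k \in s' -> canon v F -> schwartz F ->
    (gsn lam v < e'%:E)%E -> (gstn lam' k v < e%:E)%E.
  elim: s' {NE} => [|k r [e1 e10 H1]]; first by exists 1.
  have [A A0 HA] := D k; have eA : 0 < e / (A + 1) by rewrite divr_gt0// ltr_wpDl.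
  exists (Num.min e1 (e / (A + 1))); first by rewrite lt_min e10.
  move=> v F k'; rewrite inE => /orP[/eqP->|k'r] cF sF vl.
    apply: le_lt_trans (HA v F (e / (A + 1)) cF sF _) _.
      by apply: (lt_le_trans vl); rewrite lee_fin ge_min lexx orbT.
    by rewrite lte_fin mulrCA gtr_pMr// ltr_pdivrMr ?ltr_wpDl//; lra.
  apply: H1 k'r cF sF _; apply: (lt_le_trans vl); by rewrite lee_fin ge_min lexx.
exists [set v | lcs_carrier (GS_step eta omega lam) v /\
   forall k : unit, k \in [:: tt] -> (gsn lam v < e'%:E)%E]; first by exists [:: tt], e'.
move=> v [[vt vf] /(_ tt (mem_head _ _)) vl]; apply: NW; rewrite NE.
have vC : lcs_carrier (GS Roumieu eta omega) v by exists lam => //; split.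
have [F cF sF] := GS_canon ae ao vC.
split; last by move=> k ks; exact: He' ks cF sF vl.
split; first by exists F => //; rewrite (canon_reg cF).
by move=> k; exact: dominates_fin (D k) cF sF (vf tt).
Qed.

Lemma GS_eq_GSt c : admissible c eta -> admissible c omega ->
  lcs_eq (GS c eta omega) (GSt c eta omega).
Proof. case: c; [exact: GS_eq_GSt_beurling|exact: GS_eq_GSt_roumieu]. Qed.

End fixed_weights.

End topologies.

(** * Rapid decay from separate weak bounds *)

Section weak_characterisations.
Variables (R : realType) (d : nat).
Local Notation Rd := 'rV[R]_d.
Local Notation C := R[i].
Local Notation mu := (lebesgue_rV R d).
Local Notation cx := (@cx R d).
Local Notation mi0 := (@mindex0 d).
Implicit Types (f g h F G : Rd -> C) (u v : functional R d) (w eta omega : Rd -> R) (i j : 'I_d) (s lam : R) (a : multiindex d).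

(** No measurability is assumed, weights being only Lebesgue measurable. *)
Lemma ge0_integral_le (f g : Rd -> \bar R) : (forall x, 0 <= f x)%E ->
  (forall x, f x <= g x)%E -> (\int[mu]_x f x <= \int[mu]_x g x)%E.
Proof.
move=> f0 fg; rewrite !ge0_integralTE//; last by move=> x; exact: le_trans (fg x).
by apply: ereal_sup_le => _ [h hf <-]; exists h => // x; exact: le_trans (fg x).
Qed.

Lemma dint_ge0 w lam u : (0 <= dint w lam u)%E.
Proof.
apply: le_ereal_inf_tmp => _ [f uf ->]; apply: integral_ge0 => x _.
by rewrite lee_fin mulr_ge0 ?cmod_ge0 ?expR_ge0.
Qed.

(** The integral of f against e^(lam w), tested on the Borel functions below the
integrand. *)
Definition wint_le w lam f (P : R) := forall k : Rd -> R, measurable_fun setT k ->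
  (forall x, 0 <= k x <= cmod (f x) * expR (lam * w x)) ->
  rintegrable k /\ \int[mu]_x k x <= P.

Lemma dint_lt w lam u : (dint w lam u < +oo)%E ->
  exists f P, given_by u f /\ wint_le w lam f P.
Proof.
move=> /(ereal_fin_bound (dint_ge0 _ _ _))[P P0 /ereal_inf_lt[_ [f uf ->] fP]].
exists f, P; split => // k mk kf.
have k0 x : 0 <= k x by case/andP: (kf x).
have le : (\int[mu]_x (k x)%:E <= P%:E)%E.
  apply: le_trans (ltW fP); apply: ge0_integral_le => x; rewrite lee_fin//.
  by case/andP: (kf x).
split; first by apply: rintegrable_ge0P => //; exact: le_lt_trans le (ltry _).
rewrite /Rintegral -lee_fin fineK// ge0_fin_numE ?(le_lt_trans le) ?ltry//.
by apply: integral_ge0 => x _; rewrite lee_fin.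
Qed.

Lemma wint_le_integrable w lam f P : 0 <= lam -> (forall x, 0 <= w x) -> cmeasurable f ->
  wint_le w lam f P -> cintegrable f.
Proof.
move=> lam0 w0 mf H.
have [] := H (fun x => 2^-1 * n1 (f x)).
- by apply: measurable_funM => //; exact: measurable_n1.
- move=> x; rewrite mulr_ge0 ?n1_ge0//= mulrC ler_pdivrMr// mulrAC.
  apply: le_trans (n1_le_cmod _) _; rewrite [2 * _]mulrC ler_peMr ?mulr_ge0 ?cmod_ge0//.
  by rewrite -expR0 ler_expR mulr_ge0.
move=> ik _; apply: (cintegrable_dom mf (rintegrableZ 2 ik)) => x.
by rewrite mulrA divff ?mul1r.
Qed.

Lemma schwartz_cpoly g f : cpoly g -> schwartz f -> schwartz (fun x => g x * f x).
Proof.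
move=> pg; elim: pg f => {g} [c|i|g h _ IHg _ IHh|g h _ IHg _ IHh] f sf.
- exact: schwartzZ.
- exact: schwartz_cx.
- rewrite (_ : (fun x => _) = (fun x => g x * f x + h x * f x)).
    by apply: schwartzD; [exact: IHg|exact: IHh].
  by apply/funext => x; rewrite mulrDl.
- rewrite (_ : (fun x => _) = (fun x => g x * (h x * f x))); first exact/IHg/IHh.
  by apply/funext => x; rewrite mulrA.
Qed.

Lemma cxX i n (x : Rd) : cx i x ^+ n = Complex (x ord0 i ^+ n) 0.
Proof.
elim: n => [|n IH]; first by rewrite !expr0.
by rewrite !exprS IH; apply: complex_ext; rewrite ?ReM ?ImM /=; ring.
Qed.

Lemma cpoly_cxX i n : cpoly (fun x => cx i x ^+ n).
Proof.
elim: n => [|n IH]; first by rewrite (_ : (fun x => _) = fun=> 1)//; exact: cpoly_cst.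
rewrite (_ : (fun x => _) = fun x => cx i x * cx i x ^+ n).
  by apply: cpoly_mul => //; exact: cpoly_cx.
by apply/funext => x; rewrite exprS.
Qed.

Lemma cpoly_1Dsum (r : seq 'I_d) n : cpoly (fun x => 1 + \sum_(j <- r) cx j x ^+ n).
Proof.
apply: cpoly_add; first exact: cpoly_cst.
elim: r => [|i r IH].
  by rewrite (_ : (fun x => _) = fun=> 0); [exact: cpoly_cst|apply/funext => x; rewrite big_nil].
rewrite (_ : (fun x => _) = fun x => cx i x ^+ n + \sum_(j <- r) cx j x ^+ n).
  by apply: cpoly_add => //; exact: cpoly_cxX.
by apply/funext => x; rewrite big_cons.
Qed.

Section inverse_polynomial.
Variable N : nat.

(** A polynomial, bounded below by 1, comparable to jb^(2 N). *)
Definition evp (x : Rd) : R := 1 + \sum_i x ord0 i ^+ N.*2.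
Definition cevp (x : Rd) : C := Complex (evp x) 0.
Definition cevpi (x : Rd) : C := Complex (evp x)^-1 0.

Let pow_ge0 (t : R) : 0 <= t ^+ N.*2.
Proof. by rewrite -mul2n exprM exprn_ge0// sqr_ge0. Qed.

Lemma evp_ge1 x : 1 <= evp x.
Proof. by rewrite lerDl sumr_ge0. Qed.

Let evp_gt0 x : 0 < evp x. Proof. exact: lt_le_trans (evp_ge1 x). Qed.
Let evp_neq0 x : evp x != 0. Proof. exact: lt0r_neq0. Qed.

Lemma cevpE : cevp = fun x => 1 + \sum_i cx i x ^+ N.*2.
Proof.
apply/funext => x; apply: complex_ext; rewrite ?ReD ?ImD ?Re_sum ?Im_sum /=.
  by congr (_ + _); apply: eq_bigr => i _; rewrite cxX.
by rewrite add0r big1// => i _; rewrite cxX.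
Qed.

Lemma cpoly_cevp : cpoly cevp.
Proof.
by rewrite cevpE; exact: cpoly_1Dsum.
Qed.

Lemma cevpK x : cevp x * cevpi x = 1.
Proof.
by apply: complex_ext; rewrite ?ReM ?ImM /= !(mulr0, mul0r, subr0, addr0) ?mulfV.
Qed.

Lemma cdiff_cevpi : cdiff cevpi.
Proof.
apply: cdiff_real => x; apply: differentiableV => //.
by have [] := cpoly_cdiff cpoly_cevp x.
Qed.

Lemma partial_cevpi i : partial i cevpi = fun x => - partial i cevp x * cevpi x ^+ 2.
Proof.
have := partialM i (cpoly_cdiff cpoly_cevp) cdiff_cevpi.
rewrite (_ : (fun x => cevp x * cevpi x) = fun _ => 1); last by apply/funext => x; rewrite cevpK.
rewrite partial_cst => /funeqP E; apply/funext => x; have := E x; move=> Ex.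
have -> : - partial i cevp x * cevpi x ^+ 2 = cevpi x * (- (partial i cevp x * cevpi x)).
  by ring.
have -> : - (partial i cevp x * cevpi x) = cevp x * partial i cevpi x.
  have aux (a b : C) : 0 = a + b -> - a = b by move=> ab; rewrite -[b](addKr a) -ab addr0.
  exact: aux Ex.
by rewrite mulrA [cevpi x * _]mulrC cevpK mul1r.
Qed.

Lemma n1_cevpiX_le k x : n1 (cevpi x ^+ k) <= 1.
Proof.
elim: k => [|k IH]; first by rewrite expr0 /n1 /= normr1 normr0 addr0.
rewrite exprS n1_real ger0_norm ?invr_ge0 ?(ltW (evp_gt0 x))//.
by rewrite mulr_ile1 ?n1_ge0 ?invr_ge0 ?(ltW (evp_gt0 x))// invf_le1// evp_ge1.
Qed.

Lemma cdiff_cevpiX k : cdiff (fun x => cevpi x ^+ k).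
Proof.
elim: k => [|k IH]; first exact: cdiff_cst.
rewrite (_ : (fun x => _) = fun x => cevpi x * cevpi x ^+ k).
  exact: cdiffM cdiff_cevpi IH.
by apply/funext => x; rewrite exprS.
Qed.

Lemma partial_cevpiX i k :
  partial i (fun x => cevpi x ^+ k) = fun x => - k%:R * partial i cevp x * cevpi x ^+ k.+1.
Proof.
elim: k => [|k IH].
  rewrite (_ : (fun x => cevpi x ^+ 0) = fun=> 1)// partial_cst.
  by apply/funext => x; rewrite oppr0 !mul0r.
rewrite (_ : (fun x => cevpi x ^+ k.+1) = fun x => cevpi x * cevpi x ^+ k); last first.
  by apply/funext => x; rewrite exprS.
rewrite (partialM _ cdiff_cevpi (cdiff_cevpiX k)) IH partial_cevpi.
by apply/funext => x; rewrite -(natr1 k) !exprS expr0; ring.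
Qed.

(** The functions g / evp^k, with g Schwartz and k arbitrary, are stable under
derivation: the derivative of g / evp^k has denominator evp^(k+1). *)
Lemma schwartz_div_evp f : schwartz f -> schwartz (fun x => f x * cevpi x).
Proof.
move=> sf; pose P := [set h | exists k g, schwartz g /\ h = fun x => g x * cevpi x ^+ k].
apply: (@op_class_schwartz _ _ P); last first.
  by exists 1%N, f; split=> //; apply/funext => x; rewrite expr1.
move=> h [k [g [sg ->]]]; have cg := schwartz_cdiff sg; split.
- exact: cdiffM cg (cdiff_cevpiX k).
- move=> i; exists k.+1, (fun x => cevp x * partial i g x + (- k%:R) * (partial i cevp x * g x)).
  split.
    apply: schwartzD; first exact: schwartz_cpoly cpoly_cevp (schwartz_partial i sg).
    by apply: schwartzZ; apply: schwartz_cpoly sg; exact: cpoly_partial cpoly_cevp.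
  rewrite (partialM _ cg (cdiff_cevpiX k)) partial_cevpiX; apply/funext => x.
  have -> : partial i g x * cevpi x ^+ k = cevp x * cevpi x * (partial i g x * cevpi x ^+ k).
    by rewrite cevpK mul1r.
  by rewrite exprS; ring.
- move=> i; exists k, (fun x => cx i x * g x); split; first exact: schwartz_cx.
  by apply/funext => x; rewrite mulrA.
have [M M0 gM] := schwartz_decay 0 sg; exists M => x; rewrite -[M]mulr1.
apply: le_trans (n1M _ _) _; apply: ler_pM; rewrite ?n1_ge0 ?n1_cevpiX_le//.
by apply: le_trans (gM x) _; rewrite ler_piMr ?jbi_le1.
Qed.

Lemma evpi_le_jbi x : (evp x)^-1 <= 2 ^+ N.+1 * jbi N x.
Proof.
rewrite /jbi ler_pdivlMr// mulrC -[leRHS]mulr1; apply: jb_exp_le.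
- by rewrite invr_ge0 ltW.
- by rewrite invf_le1// evp_ge1.
move=> i; rewrite ler_pdivrMr// mul1r.
have E : x ord0 i ^+ N.*2 = (`|x ord0 i| ^+ N) ^+ 2.
  by rewrite -exprM muln2 -normrX ger0_norm.
apply: (@le_trans _ _ (1 + x ord0 i ^+ N.*2)).
  by rewrite E; set t := _ ^+ N; nra.
by rewrite lerD2l (bigD1 i)//= lerDl sumr_ge0.
Qed.

End inverse_polynomial.

(** Representation by a bounded function, as a property of any map on test
functions: it is applied to g |-> u (x^a g). *)
Definition bounded_rep (v : (Rd -> C) -> C) := exists b M, [/\ cmeasurable b,
  (forall x, n1 (b x) <= M) & forall g, schwartz g -> v g = cintegral (fun x => b x * g x)].

Lemma bounded_rep_sum (I : Type) (r : seq I) (v : I -> (Rd -> C) -> C) :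
  (forall k, bounded_rep (v k)) -> bounded_rep (fun g => \sum_(k <- r) v k g).
Proof.
move=> H; elim: r => [|k r [b [M [mb bM vb]]]].
  exists (fun=> 0), 0; split=> [|x|g sg]; first exact: cmeasurable_cst.
    by rewrite n10.
  rewrite big_nil -[LHS](@cintegral0 R d); apply: eq_cintegral => x; by rewrite mul0r.
have [b' [M' [mb' bM' vb']]] := H k; exists (fun x => b' x + b x), (M' + M); split.
- exact: cmeasurableD.
- by move=> x; apply: le_trans (n1D _ _) (lerD _ _).
move=> g sg; rewrite big_cons vb// vb'// -cintegralD; [|exact: schwartz_dom bM' sg|exact: schwartz_dom bM sg].
by apply: eq_cintegral => x; rewrite mulrDl.
Qed.

Lemma bounded_rep_ext (v v' : (Rd -> C) -> C) : (forall g, schwartz g -> v' g = v g) ->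
  bounded_rep v -> bounded_rep v'.
Proof.
by move=> E [b [M [mb bM vb]]]; exists b, M; split=> // g sg; rewrite E// vb.
Qed.

(** Nothing relates the functions representing the various x^a u. But
u (evp g) = int b g with b bounded, and g / evp is again a test function:
hence u is represented by b / evp, which decays as fast as wanted. *)
Lemma given_by_decays u :
  (forall g h, schwartz g -> schwartz h -> u (fun x => g x + h x) = u g + u h) ->
  bounded_rep u -> (forall i n, bounded_rep (fun g => u (fun x => cx i x ^+ n * g x))) ->
  forall N, exists f M, given_by u f /\ decays f M N.
Proof.
move=> uD u0 un N.
have sn i g : schwartz g -> schwartz (fun x => cx i x ^+ N.*2 * g x).
  by apply: schwartz_cpoly; exact: cpoly_cxX.
have usum (r : seq 'I_d) g : schwartz g -> u (fun x => (1 + \sum_(i <- r) cx i x ^+ N.*2) * g x) =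
    u g + \sum_(i <- r) u (fun x => cx i x ^+ N.*2 * g x).
  move=> sg; elim: r => [|i r IH].
    by rewrite big_nil addr0; congr u; apply/funext => x; rewrite big_nil addr0 mul1r.
  rewrite big_cons addrCA -IH -(uD _ _ (sn _ _ sg) (schwartz_cpoly (cpoly_1Dsum _ _) sg)).
  by congr u; apply/funext => x; rewrite big_cons; ring.
have [b [M [mb bM ub]]] : bounded_rep (fun g => u (fun x => cevp N x * g x)).
  (* None stands for the constant term of evp *)
  apply: (@bounded_rep_ext (fun g => \sum_(o <- None :: map Some (index_enum 'I_d))
     (if o is Some i then u (fun x => cx i x ^+ N.*2 * g x) else u g))); last first.
    by apply: bounded_rep_sum => -[i|].
  by move=> g sg; rewrite cevpE big_cons big_map usum.
have M0 : 0 <= M by apply: le_trans (bM 0); exact: n1_ge0.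
have mi : cmeasurable (cevpi N) by apply: cdiff_measurable; exact: cdiff_cevpi.
have fM x : n1 (b x * cevpi N x) <= M * 2 ^+ N.+1 * jbi N x.
  rewrite mulrC n1_real mulrC -mulrA; apply: ler_pM; rewrite ?n1_ge0//.
  rewrite ger0_norm ?evpi_le_jbi// invr_ge0.
  exact: le_trans ler01 (evp_ge1 _ _).
exists (fun x => b x * cevpi N x), (M * 2 ^+ N.+1); split; last by split=> //; exact: cmeasurableM.
apply: (@given_by_bounded _ _ _ _ (M * 2 ^+ N.+1)).
- exact: cmeasurableM.
- move=> x; apply: le_trans (fM x) _; rewrite ler_piMr ?jbi_le1// mulr_ge0// exprn_ge0//.
move=> g sg; have := ub _ (schwartz_div_evp N sg).
have -> : (fun x => cevp N x * (g x * cevpi N x)) = g.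
  by apply/funext => x; rewrite mulrCA cevpK mulr1.
by move=> ->; apply: eq_cintegral => x; ring.
Qed.

Lemma bounded_rep_dsup w lam v i n : 0 <= lam -> (forall x, 0 <= w x) ->
  (dsup (mono_pow i n) w lam v < +oo)%E ->
  bounded_rep (fun g => v (fun x => cx i x ^+ n * g x)).
Proof.
move=> lam0 w0 /(ereal_fin_bound (dsup_ge0 _ _ _ _))[P P0 /dsup_lt[f vf fP]].
exists (fun x => cx i x ^+ n * f x), (2 * P); split.
- by apply: cmeasurableM vf.1; exact/cdiff_measurable/cpoly_cdiff/cpoly_cxX.
- move=> x; rewrite cxX n1_real; have := fP x; rewrite monomial_mono_pow => /le_trans; apply.
  by rewrite ler_piMr ?mulr_ge0 ?(ltW P0)// -expR0 ler_expR oppr_le0 mulr_ge0.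
move=> g sg; rewrite (vf.2 _ (schwartz_cpoly (cpoly_cxX i n) sg)).2.
by apply: eq_cintegral => x; ring.
Qed.

Lemma bounded_rep_dsup0 w lam v : 0 <= lam -> (forall x, 0 <= w x) ->
  (dsup mi0 w lam v < +oo)%E -> bounded_rep v.
Proof.
move=> lam0 w0 /(ereal_fin_bound (dsup_ge0 _ _ _ _))[P P0 /dsup_lt[f vf fP]].
exists f, (2 * P); split; first exact: vf.1.
  move=> x; have := fP x; rewrite monomial0 normr1 mul1r => /le_trans; apply.
  by rewrite ler_piMr ?mulr_ge0 ?(ltW P0)// -expR0 ler_expR oppr_le0 mulr_ge0.
by move=> g sg; exact: (vf.2 _ sg).2.
Qed.

Lemma td_fourierD u g h : tempered u -> schwartz g -> schwartz h ->
  td_fourier u (fun x => g x + h x) = td_fourier u g + td_fourier u h.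
Proof.
move=> ut sg sh; have s1 := schwartz_ft (oner_neq0 R) sg; have s2 := schwartz_ft (oner_neq0 R) sh.
rewrite !td_fourierE//; last exact: schwartzD.
rewrite -(temperedD ut s1 s2); congr u; apply/funext => x.
by rewrite ftD//; exact: schwartz_integrable.
Qed.

Lemma td_fourierZ u (c : C) g : tempered u -> schwartz g ->
  td_fourier u (fun x => c * g x) = c * td_fourier u g.
Proof.
move=> ut sg; have s1 := schwartz_ft (oner_neq0 R) sg.
rewrite !td_fourierE//; last exact: schwartzZ.
rewrite -temperedZ//; congr u; apply/funext => x.
by rewrite ftZ//; exact: schwartz_integrable.
Qed.

Lemma rapid_distr u : tempered u ->
  (forall N, exists f M, given_by u f /\ decays f M N) ->
  (forall N, exists f M, given_by (td_fourier u) f /\ decays f M N) ->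
  schwartz_distr u.
Proof.
move=> ut H1 H2; have [F cF sF] := rapid_schwartz ut H1 H2.
by exists F => //; rewrite (canon_reg cF).
Qed.

Lemma dsup_schwartz eta omega lam u : (forall x, 0 <= eta x) -> (forall x, 0 <= omega x) ->
  0 <= lam -> tempered u ->
  (forall a, (dsup a eta lam u < +oo)%E /\ (dsup a omega lam (td_fourier u) < +oo)%E) ->
  schwartz_distr u.
Proof.
move=> e0 o0 lam0 ut H; apply: rapid_distr => //; apply: given_by_decays.
- by move=> g h; exact: temperedD.
- exact: bounded_rep_dsup0 lam0 e0 (H mi0).1.
- by move=> i n; exact: bounded_rep_dsup lam0 e0 (H (mono_pow i n)).1.
- by move=> g h; exact: td_fourierD.
- exact: bounded_rep_dsup0 lam0 o0 (H mi0).2.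
- by move=> i n; exact: bounded_rep_dsup lam0 o0 (H (mono_pow i n)).2.
Qed.

Lemma n1_ft_bound s f : cintegrable f -> exists M, forall x, n1 (ft s f x) <= M.
Proof.
move=> cf; exists (2 * \int[mu]_x n1 (f x)) => x.
exact: n1_ft_le (cintegrable_measurable cf) (rintegrable_n1 cf) _.
Qed.

Lemma mderiv_mono_pow i n f : mderiv (mono_pow i n) f = iter n (partial i) f.
Proof.
rewrite /mderiv.
have H (r : seq 'I_d) : uniq r -> foldr (fun j g => iter (mono_pow i n j) (partial j) g) f r =
    if i \in r then iter n (partial i) f else f.
  elim: r => //= j r IH /andP[jr /IH ->]; rewrite inE /mono_pow eq_sym.
  have [->|ij] /= := eqVneq i j; first by rewrite (negbTE jr).
  by [].
by rewrite H ?enum_uniq// mem_enum.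
Qed.

Lemma iter_partial_ft s i n f : schwartz f ->
  iter n (partial i) (ft s f) = fun xi => dfac s ^+ n * ft s (fun x => cx i x ^+ n * f x) xi.
Proof.
move=> sf; elim: n => [|n IH].
  apply/funext => xi /=; rewrite expr0 mul1r; congr ft; apply/funext => x.
  by rewrite expr0 mul1r.
have sn := schwartz_cxX i n sf; rewrite iterS IH.
have [M dM] := schwartz_decays (d.*2).+2 sn; have [cd pd] := ft_diff s dM.
rewrite (partialZ i _ cd) pd; apply/funext => xi.
have cn : cintegrable (fun x => cx i x ^+ n.+1 * f x).
  exact/schwartz_integrable/schwartz_cxX.
have -> : (fun x => dfac s * (cx i x * (cx i x ^+ n * f x))) =
    fun x => dfac s * (cx i x ^+ n.+1 * f x).
  by apply/funext => x; rewrite exprS !mulrA.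
by rewrite ftZ// exprSr mulrA.
Qed.

Lemma dfac_neq0 s : s != 0 -> dfac s != 0.
Proof.
move=> s0; rewrite eq_complex /= negb_and eqxx /= oppr_eq0 !mulf_neq0//.
exact: lt0r_neq0 (pi_gt0 _).
Qed.

(** A derivative of v with an integrable representative makes x^a times the
transform of v bounded. *)
Lemma bounded_rep_td_deriv s v h i n : s != 0 ->
  (forall (c : C) g, schwartz g -> v (fun x => c * g x) = c * v g) ->
  cintegrable h -> given_by (td_deriv (mono_pow i n) v) h ->
  bounded_rep (fun g => v (ft s (fun x => cx i x ^+ n * g x))).
Proof.
move=> s0 vZ ch vh; pose c : C := (dfac s ^+ n)^-1 * (-1) ^+ n.
have [M hM] := n1_ft_bound s ch.
exists (fun x => c * ft s h x), (n1 c * M); split.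
- by apply: cmeasurableM; [exact: cmeasurable_cst|exact: ft_measurable].
- by move=> x; apply: le_trans (n1M _ _) _; rewrite ler_wpM2l ?n1_ge0.
move=> g sg; have sn := schwartz_cxX i n sg; have sh := schwartz_ft s0 sg.
have E : v (mderiv (mono_pow i n) (ft s g)) = (-1) ^+ n * cintegral (fun x => h x * ft s g x).
  by rewrite -(vh.2 _ sh).2 td_derivE// mlen_mono_pow mulrA -expr2 sqrr_sign mul1r.
have dn : dfac s ^+ n != 0 by rewrite expf_neq0// dfac_neq0.
have -> : ft s (fun x => cx i x ^+ n * g x) =
    fun xi => (dfac s ^+ n)^-1 * mderiv (mono_pow i n) (ft s g) xi.
  by apply/funext => xi; rewrite mderiv_mono_pow iter_partial_ft// mulKf.
rewrite vZ; last first.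
  by rewrite mderiv_mono_pow iter_partial_ft//; apply: schwartzZ; exact: schwartz_ft.
rewrite E mulrA (ft_exchange _ ch (schwartz_integrable sg)) -/c -cintegralZ.
  by apply: eq_cintegral => x; rewrite mulrA.
exact: schwartz_dom (ft_measurable s ch) hM sg.
Qed.

Lemma given_by_td_deriv0 v h : given_by (td_deriv mi0 v) h -> given_by v h.
Proof.
move=> [mh vh]; split=> // g sg; have [h1 h2] := vh g sg; split=> //.
by rewrite -h2 td_derivE// mlen0 mul1r mderiv0.
Qed.

Lemma dint_rep w lam v : 0 <= lam -> (forall x, 0 <= w x) -> (dint w lam v < +oo)%E ->
  exists2 h, cintegrable h & given_by v h.
Proof.
move=> lam0 w0 /dint_lt[h [P [vh hP]]]; exists h => //.
exact: wint_le_integrable lam0 w0 vh.1 hP.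
Qed.

(** Integrability of all derivatives of u bounds all x^a times its transform, and
conversely; given_by_decays applies to both. *)
Lemma dint_schwartz eta omega lam u : (forall x, 0 <= eta x) -> (forall x, 0 <= omega x) ->
  0 <= lam -> tempered u ->
  (forall a, (dint eta lam (td_deriv a u) < +oo)%E /\
             (dint omega lam (td_deriv a (td_fourier u)) < +oo)%E) ->
  schwartz_distr u.
Proof.
move=> e0 o0 lam0 ut H.
have n10 : - 1 != 0 :> R by rewrite oppr_eq0 oner_eq0.
have n11 := oner_neq0 R.
have Ha a := dint_rep lam0 e0 (H a).1; have Hb a := dint_rep lam0 o0 (H a).2.
have uE g : schwartz g -> u g = td_fourier u (ft (- 1) g).
  by move=> sg; rewrite td_fourierE ?ft_inversionN ?mulr1//; exact: schwartz_ft.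
have b0 v s h : s != 0 -> cintegrable h -> given_by v h -> bounded_rep (fun g => v (ft s g)).
  move=> s0 ch vh; have [M hM] := n1_ft_bound s ch; exists (ft s h), M; split=> //.
    exact: ft_measurable.
  move=> g sg; rewrite (vh.2 _ (schwartz_ft s0 sg)).2.
  exact: ft_exchange (schwartz_integrable sg).
apply: rapid_distr => //; apply: given_by_decays.
- by move=> g h; exact: temperedD.
- have [h ch /given_by_td_deriv0 vh] := Hb mi0.
  by apply: bounded_rep_ext (b0 _ _ _ n10 ch vh) => g sg; exact: uE.
- move=> i n; have [h ch vh] := Hb (mono_pow i n).
  apply: bounded_rep_ext (bounded_rep_td_deriv n10 (fun c g => @td_fourierZ u c g ut) ch vh) => g sg.
  exact/uE/schwartz_cxX.
- by move=> g h; exact: td_fourierD.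
- have [h ch /given_by_td_deriv0 vh] := Ha mi0.
  by apply: bounded_rep_ext (b0 _ _ _ n11 ch vh) => g sg; exact: td_fourierE.
- move=> i n; have [h ch vh] := Ha (mono_pow i n).
  apply: bounded_rep_ext (bounded_rep_td_deriv n11 (fun c g => @temperedZ _ _ u c g ut) ch vh) => g sg.
  exact/td_fourierE/schwartz_cxX.
Qed.

End weak_characterisations.

(** * Weighted suprema and integrals under (gamma) *)

Section strong_characterisations.
Variables (R : realType) (d : nat).
Local Notation Rd := 'rV[R]_d.
Local Notation C := R[i].
Local Notation mu := (lebesgue_rV R d).
Local Notation Dw := (@Dw R d).
Local Notation mi0 := (@mindex0 d).
Implicit Types (f g h F G : Rd -> C) (u v : functional R d) (w eta omega : Rd -> R) (i j : 'I_d) (s lam : R) (a : multiindex d).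

(** The integral of a derivative is the value at 0 of its transform. *)
Lemma integration_by_parts i f g : schwartz f -> schwartz g ->
  cintegral (fun x => f x * partial i g x) = - cintegral (fun x => partial i f x * g x).
Proof.
move=> sf sg; have sfg := schwartzM sf sg.
have c1 := schwartz_integrable (schwartzM sf (schwartz_partial i sg)).
have c2 := schwartz_integrable (schwartzM (schwartz_partial i sf) sg).
have := ft_partial 1 i 0 sfg; rewrite !mxE mulr0 (_ : Complex 0 0 = 0)// mul0r ftE.
have -> : (fun x => partial i (fun x => f x * g x) x * fker 1 0 x) =
    (fun x => f x * partial i g x + partial i f x * g x).
  apply/funext => x; rewrite fker0 mulr1 (partialM i (schwartz_cdiff sf) (schwartz_cdiff sg)).
  by rewrite addrC.
by rewrite cintegralD// => /eqP; rewrite addr_eq0 => /eqP.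
Qed.

Lemma integration_by_parts_Dw (r : seq 'I_d) f g : schwartz f -> schwartz g ->
  cintegral (fun x => f x * Dw r g x) = (-1) ^+ size r * cintegral (fun x => Dw (rev r) f x * g x).
Proof.
elim: r f => [|i r IH] f sf sg; first by rewrite mul1r.
rewrite /= (integration_by_parts i sf (schwartz_Dw r sg)) IH//; last exact: schwartz_partial.
by rewrite rev_cons -cats1 Dw_cat exprS mulN1r mulNr.
Qed.

Lemma given_by_mderiv a f : schwartz f ->
  given_by (td_deriv a (regular f)) (mderiv a f).
Proof.
move=> sf; rewrite mderiv_word; have sD := schwartz_Dw (word a) sf.
have [M M0 DM] := schwartz_decay 0 sD.
apply: (@given_by_bounded _ _ _ _ M); first exact: schwartz_cmeasurable.
  by move=> x; apply: le_trans (DM x) _; rewrite ler_piMr ?jbi_le1.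
move=> g sg; rewrite td_derivE// mderiv_word regularE; last exact: schwartz_Dw.
rewrite integration_by_parts_Dw// size_word mulrA -expr2 sqrr_sign mul1r.
by rewrite (Dw_perm sf.1 (_ : perm_eq (rev (word a)) (word a)))// perm_rev.
Qed.

Lemma td_fourier_regular f : schwartz f -> td_fourier (regular f) = regular (fourier f).
Proof.
move=> sf; have := given_by_schwartz_fourier sf => -[_ H].
apply/funext => g; have [sg|ng] := pselect (schwartz g).
  by rewrite (H g sg).2 regularE.
by rewrite /td_fourier /regular /on_schwartz; case: asboolP.
Qed.

Lemma dint_wnorm w lam a k u f : (mlen a <= k)%N -> (d.*2 <= k)%N ->
  given_by u (mderiv a f) -> (wnorm w k k lam f < +oo)%E -> (dint w lam u < +oo)%E.
Proof.
move=> ak dk uf /(ereal_fin_bound (wnorm_ge0 _ _ _ _ _))[P P0 fP].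
pose B := 2 ^+ k.+2 * P.
have iB : rintegrable (fun x : Rd => B * jbi k x) by exact/rintegrableZ/rintegrable_jbi.
apply: (@le_lt_trans _ _ (\int[mu]_x (B * jbi k x)%:E)%E); last first.
  have /integrableP[_] := iB; apply: le_lt_trans.
  by apply: ge0_integral_le => x; rewrite /= ?lee_fin ?ler_norm// mulr_ge0// /B mulr_ge0 ?exprn_ge0// ltW.
apply: (@le_trans _ _ (\int[mu]_(x in setT) (cmod (mderiv a f x) * expR (lam * w x))%:E)%E).
  by apply: ereal_inf_lbound; exists (mderiv a f).
apply: ge0_integral_le => x; rewrite lee_fin.
  by rewrite mulr_ge0 ?cmod_ge0 ?expR_ge0.
rewrite /jbi ler_pdivlMr// mulrC; apply: le_trans (wnorm_bound fP x ak).
by rewrite ler_wpM2l// ler_wpM2r ?expR_ge0 ?cmod_le_n1.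
Qed.

Lemma gst_wnorm eta omega lam k u : (GSt_seminorm eta omega lam k u < +oo)%E ->
  exists f, [/\ schwartz f, u = regular f, (wnorm eta k k lam f < +oo)%E &
     (wnorm omega k k lam (fourier f) < +oo)%E].
Proof.
move=> /gst_seminorm_lt[f [sf uf fP]]; exists f; split=> //; apply: le_lt_trans fP.
  by rewrite leeDl// wnorm_ge0.
by rewrite leeDr// wnorm_ge0.
Qed.

Lemma quant_impl c (P Q : R -> Prop) : (forall lam, 0 < lam -> P lam -> Q lam) ->
  quant c P -> quant c Q.
Proof.
case: c => PQ /=; first by move=> H lam lam0; exact: PQ (H lam lam0).
by move=> [lam lam0 Pl]; exists lam => //; exact: PQ.
Qed.

Lemma GSt_dsup c eta omega u : lcs_carrier (GSt c eta omega) u ->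
  quant c (fun lam => forall a, (dsup a eta lam u < +oo)%E /\
    (dsup a omega lam (td_fourier u) < +oo)%E).
Proof.
move=> /GSt_carrierP; apply: quant_impl => lam lam0 [_ H] a.
have [f [sf -> h1 h2]] := gst_wnorm (H (mlen a)).
split; [apply: le_lt_trans h1|apply: le_lt_trans h2]; apply: dsup_le_wnorm => //.
  exact: given_by_schwartz.
exact: given_by_schwartz_fourier.
Qed.

Lemma GSt_dint c eta omega u : lcs_carrier (GSt c eta omega) u ->
  quant c (fun lam => forall a, (dint eta lam (td_deriv a u) < +oo)%E /\
    (dint omega lam (td_deriv a (td_fourier u)) < +oo)%E).
Proof.
move=> /GSt_carrierP; apply: quant_impl => lam lam0 [_ H] a.
pose k := maxn (mlen a) d.*2; have [f [sf -> h1 h2]] := gst_wnorm (H k).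
have ak : (mlen a <= k)%N by rewrite leq_maxl.
have dk : (d.*2 <= k)%N by rewrite leq_maxr.
split; first exact: dint_wnorm ak dk (given_by_mderiv a sf) h1.
rewrite td_fourier_regular//.
exact: dint_wnorm ak dk (given_by_mderiv a (schwartz_fourier sf)) h2.
Qed.

Lemma dsup_GS c eta omega u : tempered u ->
  quant c (fun lam => forall a, (dsup a eta lam u < +oo)%E /\
    (dsup a omega lam (td_fourier u) < +oo)%E) -> lcs_carrier (GS c eta omega) u.
Proof.
move=> ut H; apply/GS_carrierP; apply: quant_impl H => lam lam0 H; split=> //.
by have [h1 h2] := H mi0; rewrite /gs_norm lte_add_pinfty.
Qed.

(** With t^(d+1) = e^(lam w x / L) the kernel of width 1 / t at x is at most
t^(-1) e^(lam w): near x the weight compensates the height t^d of the kernel, and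
away from x the kernel is O(t^(-1)). *)
Lemma kap_weight w L E de lam : wloc w L E de -> 0 < lam -> exists2 K : R, 0 <= K &
  forall x y t, t = expR (lam / (L * d.+1%:R) * w x) ->
  kap t x y <= K / t * expR (lam * w y).
Proof.
move=> [L1 E0 de0 w0 wle] lam0; have L0 : 0 < L by lra.
have d0 : 0 < d.+1%:R :> R by [].
pose c : R := d.+1%:R / (pi * de ^+ 2).
have pd : 0 < pi * de ^+ 2 by rewrite mulr_gt0 ?pi_gt0 ?exprn_gt0.
have c0 : 0 <= c by rewrite divr_ge0 ?(ltW pd).
exists (expR (lam / L * E) + c ^+ d.+1); first by rewrite addr_ge0 ?expR_ge0 ?exprn_ge0.
move=> x y t tE.
have t1 : 1 <= t.
  by rewrite tE -expR0 ler_expR mulr_ge0// divr_ge0 ?mulr_ge0 ?(ltW lam0) ?(ltW L0).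
have t0 : 0 < t by exact: lt_le_trans t1.
have tw : t ^+ d.+1 = expR (lam / L * w x).
  by rewrite tE -expRM_natl; congr expR; field; rewrite !lt0r_neq0.
have ey : 1 <= expR (lam * w y) by rewrite -expR0 ler_expR mulr_ge0// ltW.
have td0 : 0 < t ^+ d by rewrite exprn_gt0.
have [yx|yx] := ltP `|x - y| de.
  have h1 : kap t x y <= t ^+ d.
    by rewrite /kap ler_piMr ?(ltW td0)// ga_le1// mulr_ge0 ?pi_ge0// exprn_ge0// ltW.
  apply: (le_trans h1); apply: (@le_trans _ _ (expR (lam / L * E) / t * expR (lam * w y))); last first.
    rewrite ler_wpM2r ?expR_ge0// ler_wpM2r ?invr_ge0 ?(ltW t0)// lerDl exprn_ge0//.
  rewrite mulrAC ler_pdivlMr// -exprSr tw -expRD ler_expR.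
  have := wle x y yx => h.
  have -> : lam / L * E + lam * w y = lam / L * (L * w y + E) by field; rewrite lt0r_neq0.
  by rewrite ler_wpM2l// divr_ge0// ltW.
apply: (@le_trans _ _ (c ^+ d.+1 / t)); last first.
  rewrite -[leLHS]mulr1; apply: ler_pM => //; first by rewrite divr_ge0 ?exprn_ge0 ?(ltW t0).
  by rewrite ler_wpM2r ?invr_ge0 ?(ltW t0)// lerDr expR_ge0.
rewrite /kap /ga; pose u := pi * t ^+ 2 * de ^+ 2.
have u0 : 0 < u by rewrite /u mulrAC mulr_gt0// exprn_gt0.
have hs : expR (- (pi * t ^+ 2 * sqd x y)) <= (d.+1%:R / u) ^+ d.+1.
  apply: (@le_trans _ _ (expR (- u))).
    rewrite ler_expR lerN2 ler_wpM2l ?mulr_ge0 ?pi_ge0 ?exprn_ge0 ?(ltW t0)//.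
    apply: le_trans (norm_le_sqd x y); rewrite lerXn2r ?nnegrE ?(ltW de0)//.
    by rewrite distrC.
  rewrite expRN -[d.+1%:R / u]invf_div exprVn lef_pV2 ?posrE ?expR_gt0 ?exprn_gt0 ?divr_gt0//.
  apply: le_trans (expR_ge_pow (ltW u0) (ltn0Sn d)).
  have ud : 0 <= u / d.+1%:R by rewrite divr_ge0// ltW.
  by rewrite lerXn2r ?nnegrE ?addr_ge0// lerDr.
apply: (le_trans (ler_wpM2l (ltW td0) hs)).
have -> : d.+1%:R / u = c / t ^+ 2.
  by rewrite /c /u [pi * _ * _]mulrAC invfM mulrA.
rewrite exprMn mulrCA ler_wpM2l ?exprn_ge0// exprVn -exprM ler_pdivrMr ?exprn_gt0//.
rewrite mulrC ler_pdivlMr// -exprSr.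
by rewrite ler_weXn2l// mul2n -addnn addnS leqW// leq_addr.
Qed.

(** The value of F at x differs by O(1 / t) from its mean against kap t x, and
kap_weight turns the weighted integral of f into a bound O(1 / t) for this
mean. *)
Lemma integral_to_sup w L E de lam v f F P : wloc w L E de -> 0 < lam ->
  given_by v f -> wint_le w lam f P -> lipschitz F -> given_by v F ->
  exists B : R, forall x, n1 (F x) <= B * expR (- (lam / (L * d.+1%:R) * w x)).
Proof.
move=> wl lam0 vf fP lF vF; have [K K0 HK] := kap_weight wl lam0.
have [M M0 FM] := lF.
exists ((K + 1) * 2 * P + M * (2 * d%:R)) => x; pose t := expR (lam / (L * d.+1%:R) * w x).
have t0 : 0 < t by exact: expR_gt0.
have sk := schwartz_ckap x t0.
have [ci hc] := mollify_close t0 M0 (lipschitz_cmeasurable lF) (fun y => FM y x).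
have E1 : cintegral (fun y => F y * ckap t x y) = cintegral (fun y => f y * ckap t x y).
  by rewrite -(vF.2 _ sk).2 (vf.2 _ sk).2.
have mk : measurable_fun setT (kap t x) by exact: rintegrable_measurable (rintegrable_kap x t0).
(* the factor q brings n1 (f y) kap t x y below the weighted integrand of fP *)
pose q := t / ((K + 1) * 2).
have K1 : 0 < (K + 1) * 2 by rewrite mulr_gt0// ltr_wpDl.
have q0 : 0 < q by rewrite divr_gt0.
pose phi y := q * (n1 (f y) * kap t x y).
have [ip lp] : rintegrable phi /\ \int[mu]_y phi y <= P.
  apply: fP.
    apply: measurable_funM => //; apply: measurable_funM => //; exact: measurable_n1 vf.1.
  move=> y; rewrite (mulr_ge0 (ltW q0) (mulr_ge0 (n1_ge0 _) (kap_ge0 _ _ t0))) /=.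
  apply: (@le_trans _ _ (q * ((2 * cmod (f y)) * ((K + 1) / t * expR (lam * w y))))).
    apply: ler_wpM2l; first exact: ltW.
    apply: ler_pM; rewrite ?n1_ge0 ?kap_ge0 ?n1_le_cmod//.
    apply: le_trans (HK x y t erefl) _; rewrite ler_wpM2r ?expR_ge0// ler_wpM2r ?invr_ge0 ?(ltW t0)//.
    by rewrite lerDl.
  rewrite le_eqVlt; apply/orP; left; apply/eqP; rewrite /q.
  by field; rewrite !lt0r_neq0// ltr_wpDl.
have b1 : n1 (cintegral (fun y => f y * ckap t x y)) <= q^-1 * P.
  apply: (@le_trans _ _ (\int[mu]_y (q^-1 * phi y))); last first.
    by rewrite (RintegralZl _ measurableT ip) ler_wpM2l// invr_ge0 ltW.
  apply: n1_cintegral_le; [|exact: rintegrableZ|].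
    by apply: cmeasurableM vf.1 _; exact: cmeasurable_real.
  by move=> y; rewrite mulrC n1_real ger0_norm ?kap_ge0// /phi (mulKf (lt0r_neq0 q0)) [leRHS]mulrC.
have -> : F x = cintegral (fun y => F y * ckap t x y) - (cintegral (fun y => F y * ckap t x y) - F x).
  by rewrite opprB addrC subrK.
apply: le_trans (n1B _ _) _; rewrite expRN -/t mulrDl; apply: lerD.
  by rewrite E1; apply: le_trans b1 _; rewrite /q invf_div mulrAC.
by apply: le_trans hc _; rewrite le_eqVlt; apply/orP; left; apply/eqP; ring.
Qed.

Lemma dint_lipschitz w lam v f P s : poly_dom w 1 lam -> cmeasurable f -> wint_le w lam f P ->
  lipschitz (ft s f).
Proof.
move=> [K K0 HK] mf fP; have K1 : 0 < 2 * (K + 1) by rewrite mulr_gt0// ltr_wpDl.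
have [ik _] : rintegrable (fun x => (2 * (K + 1))^-1 * (jb x * n1 (f x))) /\
    \int[mu]_x ((2 * (K + 1))^-1 * (jb x * n1 (f x))) <= P.
  apply: fP.
    apply: measurable_funM => //; apply: measurable_funM; last exact: measurable_n1.
    exact: measurable_jb.
  move=> x; rewrite !mulr_ge0 ?n1_ge0 ?invr_ge0 ?(ltW K1)//= mulrC ler_pdivrMr//.
  have h := HK x; rewrite expr1 in h.
  apply: (@le_trans _ _ ((K + 1) * expR (lam * w x) * (2 * cmod (f x)))).
    apply: ler_pM; rewrite ?n1_ge0 ?n1_le_cmod//; apply: (le_trans h).
    by rewrite ler_wpM2r ?expR_ge0// lerDl.
  by rewrite le_eqVlt; apply/orP; left; apply/eqP; ring.
apply: (@ft_lipschitz_int _ _ s f (fun x => (2 * (K + 1)) * ((2 * (K + 1))^-1 * (jb x * n1 (f x))))) => //.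
  exact: rintegrableZ.
by move=> x; rewrite mulVKf// lt0r_neq0.
Qed.

Lemma dint_gs_norm eta omega L E de lam u : wloc eta L E de -> wloc omega L E de -> 0 < lam ->
  poly_dom eta 1 lam -> poly_dom omega 1 lam -> 
  (dint eta lam (td_deriv mi0 u) < +oo)%E ->
  (dint omega lam (td_deriv mi0 (td_fourier u)) < +oo)%E ->
  (gs_norm eta omega (lam / (L * d.+1%:R)) u < +oo)%E.
Proof.
move=> we wo lam0 pe po /dint_lt[f [P [/given_by_td_deriv0 uf fP]]].
move=> /dint_lt[h [Q [/given_by_td_deriv0 uh hQ]]].
have cf := wint_le_integrable (ltW lam0) (wloc_ge0 we) uf.1 fP.
have ch := wint_le_integrable (ltW lam0) (wloc_ge0 wo) uh.1 hQ.
have lF : lipschitz (ft (- 1) h) := dint_lipschitz u (- 1) po uh.1 hQ.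
have lG : lipschitz (ft 1 f) := dint_lipschitz u 1 pe uf.1 fP.
have uF := given_by_ftN ch uh lF; have uG := given_by_ft cf uf lG.
have [B1 hB1] := integral_to_sup we lam0 uf fP lF uF.
have [B2 hB2] := integral_to_sup wo lam0 uh hQ lG uG.
by rewrite /gs_norm lte_add_pinfty//; [exact: dsup_fin uF hB1|exact: dsup_fin uG hB2].
Qed.

(** The rate is divided by L (d + 1), which is harmless in both cases. *)
Lemma dint_GS c eta omega L E de u : wloc eta L E de -> wloc omega L E de ->
  admissible c eta -> admissible c omega -> tempered u ->
  quant c (fun lam => forall a, (dint eta lam (td_deriv a u) < +oo)%E /\
    (dint omega lam (td_deriv a (td_fourier u)) < +oo)%E) ->
  lcs_carrier (GS c eta omega) u.
Proof.
move=> we wo ae ao ut H; apply/GS_carrierP.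
have L1 := wloc_L we; have L0 : 0 < L by lra.
have Ld1 : 1 <= L * d.+1%:R by rewrite -[leLHS]mulr1; apply: ler_pM => //; rewrite ler1n.
have Ld : 0 < L * d.+1%:R by lra.
have e0 := wloc_ge0 we; have o0 := wloc_ge0 wo.
case: c ae ao H => /= ae ao H.
  move=> lam lam0; split=> //; have [m1 m10 p1] := ae 1%N; have [m2 m20 p2] := ao 1%N.
  pose m := (lam + (m1 + m2)) * (L * d.+1%:R).
  have s0 : 0 < lam + (m1 + m2) by lra.
  have m0 : 0 < m by rewrite mulr_gt0.
  have ml : lam + (m1 + m2) <= m by rewrite /m ler_peMr// ltW.
  have [h1 h2] := H m m0 mi0.
  have q1 : poly_dom eta 1 m by apply: poly_dom_mono p1 => //; lra.
  have q2 : poly_dom omega 1 m by apply: poly_dom_mono p2 => //; lra.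
  apply: le_lt_trans (dint_gs_norm we wo m0 q1 q2 h1 h2).
  by apply: gs_norm_mono => //; rewrite /m mulfK ?lt0r_neq0//; lra.
have [lam lam0 Hl] := H; have [h1 h2] := Hl mi0.
exists (lam / (L * d.+1%:R)); first by rewrite divr_gt0.
split; first exact: ut.
exact: (dint_gs_norm we wo lam0 (ae _ _ lam0) (ao _ _ lam0) h1 h2).
Qed.

End strong_characterisations.

(** * Lacunary sums of translates *)

Section lacunary_series.
Variables (R : realType) (d : nat).
Local Notation Rd := 'rV[R]_d.
Local Notation C := R[i].
Local Notation mu := (lebesgue_rV R d).
Implicit Types (f g h : Rd -> C) (w : Rd -> R) (s lam K : R) (z : nat -> C).

Lemma le_addr_pow2 (x S c : R) : (forall N, x <= S + c / 2 ^+ N) -> x <= S.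
Proof.
move=> H; rewrite leNgt; apply/negP => Sx.
have xS : 0 < x - S by rewrite subr_gt0.
pose N := Num.bound (`|c| / (x - S)).
have h1 : `|c| / (x - S) < 2 ^+ N.
  apply: (@lt_le_trans _ _ N%:R); first by apply: archi_boundP; rewrite divr_ge0// ltW.
  by rewrite -natrX ler_nat ltnW// ltn_expl.
have p0 : 0 < 2 ^+ N :> R by rewrite exprn_gt0.
have := H N; rewrite leNgt => /negP; apply.
rewrite -ltrBrDl ltr_pdivrMr// mulrC -ltr_pdivrMr//; apply: le_lt_trans h1.
by rewrite ler_wpM2r ?invr_ge0 ?(ltW xS)// ler_norm.
Qed.

Lemma sum_pow2_le K N M : 0 <= K -> \sum_(N <= k < M) K / 2 ^+ k <= 2 * K / 2 ^+ N.
Proof.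
move=> K0; have [MN|/ltnW NM] := leqP M N.
  by rewrite big_geq// divr_ge0 ?mulr_ge0// exprn_ge0.
rewrite (eq_bigr (fun k => - (2 * K / 2 ^+ k.+1) - - (2 * K / 2 ^+ k))); last first.
  by move=> k _; rewrite exprS; field; rewrite expf_neq0.
by rewrite telescope_sumr// opprK addrC gerBl divr_ge0 ?mulr_ge0// exprn_ge0.
Qed.

Lemma series_approx (x : nat -> R) K : (forall n, `|x n| <= K / 2 ^+ n) ->
  forall N, `|limn (series x) - \sum_(0 <= k < N) x k| <= 2 * K / 2 ^+ N.
Proof.
move=> xK N; have K0 : 0 <= K by have := le_trans (normr_ge0 _) (xK 0%N); rewrite expr0 divr1.
have cx : cvgn (series x).
  apply: normed_cvg; apply: (@series_le_cvg _ _ (geometric K 2^-1)) => [n|n|n|].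
  - exact: normr_ge0.
  - by rewrite mulr_ge0// exprn_ge0// invr_ge0.
  - by rewrite /= exprVn.
  - by apply: is_cvg_geometric_series; rewrite ger0_norm ?invr_ge0// invf_lt1// ltr1n.
have cN : (fun M => `|series x M - \sum_(0 <= k < N) x k|) @ \oo -->
    `|limn (series x) - \sum_(0 <= k < N) x k|.
  exact: cvg_norm (cvgB cx (cvg_cst _)).
apply: (cvgr_to_le cN); exists N => // M /= NM.
rewrite /series /= (big_cat_nat (leq0n N) NM)//= addrAC subrr add0r.
apply: le_trans (ler_norm_sum _ _ _) _; apply: le_trans (sum_pow2_le N M K0).
by apply: ler_sum => k _.
Qed.

Definition csum z : C :=
  Complex (limn (series (fun n => Re (z n)))) (limn (series (fun n => Im (z n)))).

Lemma csum_approx z K : (forall n, n1 (z n) <= K / 2 ^+ n) ->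
  forall N, n1 (csum z - \sum_(0 <= k < N) z k) <= 4 * K / 2 ^+ N.
Proof.
move=> zK N; rewrite /n1 ReD ImD ReN ImN Re_sum Im_sum /=.
have -> : 4 * K / 2 ^+ N = 2 * K / 2 ^+ N + 2 * K / 2 ^+ N by rewrite -!mulrA; ring.
apply: lerD; apply: series_approx => n; apply: le_trans (zK n).
  exact: Re_le_n1.
exact: Im_le_n1.
Qed.

Lemma n1_csum_le z K : (forall n, n1 (z n) <= K / 2 ^+ n) -> n1 (csum z) <= 4 * K.
Proof.
by move=> zK; have := csum_approx zK 0; rewrite big_geq// subr0 expr0 divr1.
Qed.

Lemma csum_cmeasurable (f : nat -> Rd -> C) K : (forall n, cmeasurable (f n)) ->
  (forall n x, n1 (f n x) <= K / 2 ^+ n) -> cmeasurable (fun x => csum (f ^~ x)).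
Proof.
move=> mf fK.
have H (p : C -> R) : (forall c : C, `|p c| <= n1 c) ->
    (forall n, measurable_fun setT (fun x => p (f n x))) ->
    measurable_fun setT (fun x => limn (series (fun n => p (f n x)))).
  move=> p1 mp; apply: (measurable_fun_cvg (h := fun N x => \sum_(0 <= k < N) p (f k x))).
    by move=> N; apply: measurable_sum => k; exact: mp.
  move=> x _; apply/cvgrPdist_le => e e0; near=> N.
  have b : forall n, `|p (f n x)| <= K / 2 ^+ n by move=> n; exact: le_trans (p1 _) (fK n x).
  apply: le_trans (series_approx b N) _; near: N.
  have : (fun N => 2 * K / 2 ^+ N) @ \oo --> (0 : R).
    have := @cvg_geometric R (2 * K) 2^-1; rewrite ger0_norm ?invr_ge0// invf_lt1// ltr1n => /(_ isT).
    by apply: cvg_trans; apply: near_eq_cvg; near=> N; rewrite /= exprVn.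
  by move=> /cvgrPdist_le/(_ e e0); apply: filterS => N; rewrite sub0r normrN; apply: le_trans; exact: ler_norm.
split; apply: H.
- by move=> c; exact: Re_le_n1.
- by move=> n; have [] := mf n.
- by move=> c; exact: Im_le_n1.
- by move=> n; have [] := mf n.
Unshelve. all: by end_near. Qed.

(** Passage to the limit in estimates of partial sums. *)
Lemma n1_le_tail (X : C) (Y : nat -> C) (S c : R) : (forall N, n1 (Y N) <= S) ->
  (forall N, n1 (X - Y N) <= c / 2 ^+ N) -> n1 X <= S.
Proof.
move=> HY HX; apply: (@le_addr_pow2 _ _ c) => N.
by rewrite -(subrK (Y N) X) addrC; apply: le_trans (n1D _ _) (lerD _ _).
Qed.

Section bump_train.
Variables (phi : Rd -> C) (s : R) (y : nat -> Rd) (D0 : R).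
Hypotheses (sphi : schwartz phi) (yD : forall n, 4 ^+ n <= D0 * jb (y n)).

(** Summable by the growth of the y n, and yet a n |y n| is of order 2^n. *)
Let a n : R := 2 ^+ n / jb (y n).

Let a_gt0 n : 0 < a n. Proof. by rewrite divr_gt0// exprn_gt0. Qed.

Let D0_ge0 : 0 <= D0.
Proof.
have := yD 0; rewrite expr0 => h; rewrite -(pmulr_lge0 _ (jb_gt0 (y 0))).
exact: le_trans h.
Qed.

Let a_le n : a n <= D0 / 2 ^+ n.
Proof.
rewrite ler_pdivrMr// mulrAC ler_pdivlMr ?exprn_gt0// -exprMn -natrM.
exact: yD.
Qed.

Definition bump n x : C := Complex (a n) 0 * phi (x - y n).
Definition train x : C := csum (fun n => bump n x).
Definition phase n xi : C := Complex (a n) 0 * fker (- s) xi (- y n).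
(** Each translate of phi contributes a phase to the transform. *)
Definition train_ft xi : C := ft s phi xi * csum (fun n => phase n xi).

Lemma n1_bump n x (M : R) : n1 (phi (x - y n)) <= M -> n1 (bump n x) <= D0 * M / 2 ^+ n.
Proof.
move=> pM; rewrite n1_real ger0_norm ?(ltW (a_gt0 n))// [leRHS]mulrAC.
by apply: ler_pM (a_le n) pM; rewrite ?n1_ge0 ?(ltW (a_gt0 n)).
Qed.

Lemma n1_phase n xi : n1 (phase n xi) <= D0 * 2 / 2 ^+ n.
Proof.
rewrite n1_real ger0_norm ?(ltW (a_gt0 n))// [leRHS]mulrAC.
by apply: ler_pM (a_le n) (n1_fker _ _ _); rewrite ?n1_ge0 ?(ltW (a_gt0 n)).
Qed.

Lemma n1_train_le x (M : R) : (forall n, n1 (phi (x - y n)) <= M) -> n1 (train x) <= 4 * (D0 * M).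
Proof. by move=> pM; apply: n1_csum_le => n; exact: n1_bump. Qed.

Let phi_bound : exists2 M : R, 0 <= M & forall x, n1 (phi x) <= M.
Proof.
have [M M0 pM] := schwartz_decay 0 sphi; exists M => // x.
by apply: le_trans (pM x) _; rewrite ler_piMr ?jbi_le1.
Qed.

Lemma train_bounded : exists M, forall x, n1 (train x) <= M.
Proof. by have [M _ pM] := phi_bound; exists (4 * (D0 * M)) => x; apply: n1_train_le. Qed.

Lemma train_ft_le xi : n1 (train_ft xi) <= 8 * D0 * n1 (ft s phi xi).
Proof.
apply: le_trans (n1M _ _) _; rewrite mulrC ler_wpM2r ?n1_ge0//.
by apply: le_trans (n1_csum_le (n1_phase ^~ xi)) _; lra.
Qed.

Lemma train_lipschitz : lipschitz train.
Proof.
have [A A0 pA] := schwartz_lipschitz sphi; have [M M0 pM] := phi_bound.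
exists (2 * D0 * A) => [|x x']; first by rewrite !mulr_ge0.
apply: (n1_le_tail (Y := fun N => \sum_(0 <= k < N) bump k x - \sum_(0 <= k < N) bump k x')
   (c := 8 * (D0 * M))) => N.
  rewrite -sumrB; apply: le_trans (n1_sum _ _) _.
  apply: (@le_trans _ _ (\sum_(0 <= k < N) (D0 * A * `|x - x'|) / 2 ^+ k)).
    apply: ler_sum => k _; rewrite /bump -mulrBr n1_real ger0_norm ?(ltW (a_gt0 k))//.
    have -> : D0 * A * `|x - x'| / 2 ^+ k = D0 / 2 ^+ k * (A * `|x - x'|) by ring.
    apply: ler_pM (a_le k) _; rewrite ?n1_ge0 ?(ltW (a_gt0 k))//.
    apply: le_trans (pA _ _) _; by rewrite opprB addrA subrK.
  have q0 : 0 <= D0 * A * `|x - x'| by rewrite !mulr_ge0.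
  by apply: le_trans (sum_pow2_le 0 N q0) _; rewrite expr0 divr1 !mulrA.
have e : 8 * (D0 * M) / 2 ^+ N = 4 * (D0 * M) / 2 ^+ N + 4 * (D0 * M) / 2 ^+ N.
  by rewrite -!mulrA; ring.
rewrite e (_ : train x - train x' - _ = (train x - \sum_(0 <= k < N) bump k x) -
   (train x' - \sum_(0 <= k < N) bump k x')); last by ring.
by apply: le_trans (n1B _ _) _; apply: lerD; apply: csum_approx => n; exact: n1_bump.
Qed.

Lemma train_ft_cmeasurable : cmeasurable train_ft.
Proof.
apply: cmeasurableM; first exact/ft_measurable/schwartz_integrable.
apply: (@csum_cmeasurable _ (D0 * 2)) => [n|n x]; last exact: n1_phase.
apply: cmeasurableM; first exact: cmeasurable_cst.
rewrite (_ : (fun xi => _) = fker (- s) (- y n)); first exact: cmeasurable_fker.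
by apply/funext => xi; rewrite fkerC.
Qed.

(** train is not known to be integrable, so its transform is computed by duality:
the identity holds for partial sums, which converge uniformly on both sides. *)
Lemma train_exchange h : s != 0 -> schwartz h ->
  cintegral (fun x => train x * ft s h x) = cintegral (fun x => train_ft x * h x).
Proof.
move=> s0 sh; have [M M0 pM] := phi_bound.
have [M' pM'] := n1_ft_bound s (schwartz_integrable sphi).
have M'0 : 0 <= M' by apply: le_trans (pM' 0); exact: n1_ge0.
have ch := schwartz_integrable sh.
pose B N x := \sum_(0 <= k < N) bump k x.
pose P N x := ft s phi x * \sum_(0 <= k < N) phase k x.
have sb n : schwartz (bump n) by apply: schwartzZ; exact: schwartz_translate.
have cb n := schwartz_integrable (sb n).
have sB N : schwartz (B N) by exact: schwartz_sum.
have cB N := schwartz_integrable (sB N).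
have ftb n xi : ft s (bump n) xi = ft s phi xi * phase n xi.
  rewrite ftZ; last exact/schwartz_integrable/schwartz_translate.
  by rewrite ft_translate; [rewrite /phase; ring|exact: schwartz_integrable].
have ftB N xi : ft s (B N) xi = P N xi.
  rewrite /P mulr_sumr /B; elim: N => [|N IH].
    rewrite big_geq// (_ : (fun x => _) = fun=> 0); last by apply/funext => x; rewrite big_geq.
    by rewrite ftE -[RHS](@cintegral0 R d); apply: eq_cintegral => x; rewrite mul0r.
  rewrite big_nat_recr//= -IH -ftb -ftD//; last exact: (cB N).
  by congr ft; apply/funext => x; rewrite big_nat_recr.
have E1 N : cintegral (fun x => B N x * ft s h x) = cintegral (fun x => P N x * h x).
  by rewrite (ft_exchange _ (cB N) ch); apply: eq_cintegral => x; rewrite ftB.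
have sfh := schwartz_ft s0 sh; have cfh := schwartz_integrable sfh.
have mT : cmeasurable train := lipschitz_cmeasurable train_lipschitz.
have mF : cmeasurable train_ft := train_ft_cmeasurable.
have [T TM] := train_bounded.
have FM xi : n1 (train_ft xi) <= 8 * D0 * M'.
  by apply: le_trans (train_ft_le xi) _; rewrite ler_wpM2l// mulr_ge0.
have eT N x : n1 (train x - B N x) <= 4 * (D0 * M) / 2 ^+ N.
  by apply: csum_approx => n; exact: n1_bump.
have eF N xi : n1 (train_ft xi - P N xi) <= M' * (4 * (D0 * 2) / 2 ^+ N).
  rewrite /train_ft /P -mulrBr; apply: le_trans (n1M _ _) _.
  by apply: ler_pM; rewrite ?n1_ge0//; apply: csum_approx => n; exact: n1_phase.
have mP N : cmeasurable (P N).
  have -> : P N = ft s (B N) by apply/funext => xi; rewrite ftB.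
  exact: ft_measurable.
have ihh := rintegrable_n1 ch; have ifh := rintegrable_n1 cfh.
pose I1 := \int[mu]_x n1 (ft s h x); pose I2 := \int[mu]_x n1 (h x).
have iB N : cintegrable (fun x => B N x * ft s h x).
  exact/schwartz_integrable/schwartzM.
have iP N : cintegrable (fun x => P N x * h x).
  apply: (schwartz_dom (mP N) (M := 8 * D0 * M' + M' * (4 * (D0 * 2) / 2 ^+ N)) _ sh) => x.
  rewrite (_ : P N x = train_ft x - (train_ft x - P N x)); last by ring.
  by apply: le_trans (n1B _ _) (lerD _ _).
have iT := schwartz_dom mT TM sfh; have iF := schwartz_dom mF FM sh.
apply/eqP; rewrite -subr_eq0; apply/eqP/n1_eq0.
apply: (@le_addr_pow2 _ _ (4 * (D0 * M) * I1 + M' * (4 * (D0 * 2)) * I2)) => N.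
rewrite add0r; set X := cintegral _; set Y := cintegral _.
have -> : X - Y = (X - cintegral (fun x => B N x * ft s h x)) -
    (Y - cintegral (fun x => P N x * h x)) by rewrite E1; ring.
rewrite /X /Y -(cintegralB iT (iB N)) -(cintegralB iF (iP N)).
apply: le_trans (n1B _ _) _; rewrite mulrDl; apply: lerD.
  have -> : 4 * (D0 * M) * I1 / 2 ^+ N = \int[mu]_x (4 * (D0 * M) / 2 ^+ N * n1 (ft s h x)).
    by rewrite (RintegralZl _ measurableT ifh) mulrAC.
  apply: n1_cintegral_le; [|exact: rintegrableZ|].
    by apply: cmeasurableD; [|apply: cmeasurableN]; exact: cintegrable_measurable.
  by move=> x; rewrite -mulrBl; apply: le_trans (n1M _ _) _; rewrite ler_wpM2r ?n1_ge0.
have -> : M' * (4 * (D0 * 2)) * I2 / 2 ^+ N = \int[mu]_x (M' * (4 * (D0 * 2) / 2 ^+ N) * n1 (h x)).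
  by rewrite (RintegralZl _ measurableT ihh) -/I2; ring.
apply: n1_cintegral_le; [|exact: rintegrableZ|].
  by apply: cmeasurableD; [|apply: cmeasurableN]; exact: cintegrable_measurable.
by move=> x; rewrite -mulrBl; apply: le_trans (n1M _ _) _; rewrite ler_wpM2r ?n1_ge0.
Qed.

(** By (alpha) the bump at y n costs a factor e^(lam w (y n)), compensated by its
coefficient, and divides the rate of decay by L. *)
Lemma train_weight w (L k0 lam Cphi D : R) : 0 < L -> 0 <= lam -> 0 <= D ->
  (forall x x', w (x + x') <= L * (w x + w x') + k0) ->
  (forall x, n1 (phi x) <= Cphi * expR (- (lam * w x))) ->
  (forall n, expR (lam * w (y n)) * 4 ^+ n <= D * jb (y n)) ->
  forall x, n1 (train x) <= 4 * (D * Cphi * expR (lam / L * k0)) * expR (- (lam / L * w x)).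
Proof.
move=> L0 lam0 D'0 wL pC yw x.
have C0 : 0 <= Cphi by have := le_trans (n1_ge0 _) (pC 0); rewrite pmulr_lge0// expR_gt0.
rewrite -mulrA; apply: n1_csum_le => n.
rewrite n1_real ger0_norm ?(ltW (a_gt0 n))//.
have h1 : n1 (phi (x - y n)) <=
    Cphi * (expR (lam * w (y n)) * expR (lam / L * k0) * expR (- (lam / L * w x))).
  apply: le_trans (pC _) _; rewrite ler_wpM2l// -!expRD ler_expR.
  have := wL (x - y n) (y n); rewrite subrK => h.
  have -> : lam * w (y n) + lam / L * k0 - lam / L * w x =
    lam / L * (L * w (y n) + k0 - w x) by field; rewrite lt0r_neq0.
  have -> : - (lam * w (x - y n)) = lam / L * (- (L * w (x - y n))) by field; rewrite lt0r_neq0.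
  apply: ler_wpM2l; first by rewrite divr_ge0// ltW.
  by move: h; rewrite mulrDr; lra.
have h2 : a n * expR (lam * w (y n)) <= D / 2 ^+ n.
  rewrite /a mulrAC ler_pdivrMr// mulrAC ler_pdivlMr ?exprn_gt0//.
  by rewrite mulrAC -exprMn -natrM mulrC.
apply: le_trans (ler_wpM2l (ltW (a_gt0 n)) h1) _.
set e1 := expR (lam / L * k0); set e2 := expR (- (lam / L * w x)).
have -> : a n * (Cphi * (expR (lam * w (y n)) * e1 * e2)) =
   (a n * expR (lam * w (y n))) * (Cphi * e1 * e2) by ring.
have -> : D * Cphi * e1 * e2 / 2 ^+ n = D / 2 ^+ n * (Cphi * e1 * e2) by ring.
by rewrite ler_wpM2r// !mulr_ge0 ?expR_ge0.
Qed.

(** The y n are so far apart that at y m + x0 all other bumps together contribute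
O(1 / |y m|), while the m-th one is of order 2^m / |y m|. *)
Lemma train_not_schwartz : (forall n, 3 * `|y n| <= `|y n.+1|) ->
  (exists x, phi x != 0) -> ~ schwartz train.
Proof.
move=> y3 [x0 px0] sT.
have [M M0 pM] := schwartz_decay 1 sphi.
have [T T0 TM] := schwartz_decay 1 sT.
have ymono m n : (m < n)%N -> 3 * `|y m| <= `|y n|.
  elim: n => // n IH; rewrite ltnS leq_eqVlt => /orP[/eqP->//|/IH h].
  by apply: (le_trans h); apply: le_trans (y3 n); rewrite ler_peMl//; lra.
have sep m n : n != m -> jb (y m) <= 2 * jb (y m - y n).
  rewrite neq_lt => /orP[/ymono h|/ymono h].
    have := lerB_dist (y m) (y n); rewrite /jb; have := normr_ge0 (y n); lra.
  have := lerB_dist (y n) (y m); rewrite distrC /jb; have := normr_ge0 (y m); lra.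
pose c0 := 2 * jb x0 * M.
have c00 : 0 <= c0 by rewrite !mulr_ge0.
have far m n : n != m -> jb (y m) * n1 (phi (y m + x0 - y n)) <= c0.
  move=> nm; set v := y m + x0 - y n.
  have h : jb (y m - y n) <= jb v * jb x0.
    by rewrite -(jbN x0); apply: le_trans (jbD _ _); rewrite /v addrAC addrK.
  apply: (@le_trans _ _ (2 * (jb v * jb x0) * (M * jbi 1 v))).
    apply: ler_pM; rewrite ?n1_ge0//; apply: le_trans (sep _ _ nm) _.
    by rewrite ler_wpM2l.
  rewrite le_eqVlt; apply/orP; left; apply/eqP.
  have : jb v * jbi 1 v = 1 by rewrite /jbi expr1 mulfV// lt0r_neq0.
  rewrite /c0; set p := jb v; set q := jbi 1 v => pq.
  by rewrite (_ : _ * _ = 2 * jb x0 * M * (p * q)); [rewrite pq mulr1|ring].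
have key m : 2 ^+ m * n1 (phi x0) <= T * jb x0 + 4 * (D0 * c0).
  (* the sequence of bumps with the m-th one removed *)
  pose r n : C := if n == m then 0 else bump n (y m + x0).
  have rb n : n1 (Complex (jb (y m)) 0 * r n) <= D0 * c0 / 2 ^+ n.
    rewrite /r; case: eqP => [_|/eqP nm].
      by rewrite mulr0 n10 divr_ge0 ?mulr_ge0// exprn_ge0.
    rewrite n1_real n1_real !ger0_norm ?(ltW (a_gt0 n))// mulrCA [leRHS]mulrAC.
    exact: ler_pM (ltW (a_gt0 n)) (mulr_ge0 (jb_ge0 _) (n1_ge0 _)) (a_le n) (far _ _ nm).
  set X := y m + x0.
  have b1 : n1 (Complex (jb (y m)) 0 * train X) <= T * jb x0.
    rewrite n1_real ger0_norm//; apply: le_trans (ler_wpM2l _ (TM X)) _ => //.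
    rewrite mulrCA ler_wpM2l// /jbi expr1 ler_pdivrMr//.
    rewrite -[y m](addrK x0) -(jbN x0) mulrC; exact: jbD.
  have b2 : n1 (Complex (jb (y m)) 0 * (train X - bump m X)) <= 4 * (D0 * c0).
    apply: (n1_le_tail (Y := fun N => \sum_(0 <= k < m.+1 + N) Complex (jb (y m)) 0 * r k)
      (c := jb (y m) * (4 * (D0 * M)))) => N.
      apply: le_trans (n1_sum _ _) _.
      have q0 : 0 <= D0 * c0 by rewrite mulr_ge0.
      apply: (@le_trans _ _ (\sum_(0 <= k < m.+1 + N) (D0 * c0) / 2 ^+ k)).
        by apply: ler_sum => k _; exact: rb.
      by apply: le_trans (sum_pow2_le _ _ q0) _; rewrite expr0 divr1; lra.
    have -> : \sum_(0 <= k < m.+1 + N) Complex (jb (y m)) 0 * r k =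
        Complex (jb (y m)) 0 * (\sum_(0 <= k < m.+1 + N) bump k X - bump m X).
      rewrite -mulr_sumr; congr (_ * _).
      have -> : bump m X = \sum_(0 <= k < m.+1 + N) (if k == m then bump k X else 0).
        by rewrite -big_mkcond big_nat1_eq /= ltnS leq_addr.
      rewrite -sumrB; apply: eq_bigr => k _; rewrite /r.
      by case: eqP; rewrite ?subrr ?subr0.
    rewrite -mulrBr opprB addrA subrK n1_real ger0_norm// -mulrA ler_wpM2l//.
    have bX n : n1 (bump n X) <= D0 * M / 2 ^+ n.
      by apply: n1_bump; apply: le_trans (pM _) _; rewrite ler_piMr ?jbi_le1.
    apply: le_trans (csum_approx bX _) _; rewrite ler_wpM2l ?mulr_ge0//.
    by rewrite lef_pV2 ?posrE ?exprn_gt0// ler_weXn2l ?leq_addl// ler1n.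
  have -> : 2 ^+ m * n1 (phi x0) = n1 (Complex (jb (y m)) 0 * bump m X).
    rewrite n1_real n1_real !ger0_norm ?(ltW (a_gt0 m))// /X addrAC subrr add0r mulrA.
    by rewrite /a [jb (y m) * _]mulrC divfK// lt0r_neq0.
  have -> : Complex (jb (y m)) 0 * bump m X = Complex (jb (y m)) 0 * train X -
     Complex (jb (y m)) 0 * (train X - bump m X) by ring.
  exact: le_trans (n1B _ _) (lerD b1 b2).
move/eqP : px0; apply; apply: n1_eq0.
apply: (@le_addr_pow2 _ _ (T * jb x0 + 4 * (D0 * c0))) => N.
by rewrite add0r ler_pdivlMr ?exprn_gt0// mulrC.
Qed.

End bump_train.

End lacunary_series.

(** * Necessity of (gamma) *)

Section necessity.
Variables (R : realType) (d : nat).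
Local Notation Rd := 'rV[R]_d.
Local Notation C := R[i].
Local Notation mu := (lebesgue_rV R d).
Implicit Types (f g h F G H phi : Rd -> C) (u v : functional R d) (w eta omega : Rd -> R) (s lam : R) (y : nat -> Rd).

Lemma enorm_le (x : Rd) : enorm x <= d%:R * `|x|.
Proof.
have p0 : 0 <= d%:R * `|x| by rewrite mulr_ge0.
rewrite -[leRHS]ger0_norm// -sqrtr_sqr; apply: ler_wsqrtr.
apply: (@le_trans _ _ (\sum_(i < d) `|x| ^+ 2)).
  by apply: ler_sum => i _; rewrite -(real_normK (num_real (x ord0 i))) lerXn2r ?nnegrE// coord_le_norm.
rewrite sumr_const card_ord -[leLHS]mulr_natl exprMn ler_wpM2r ?exprn_ge0//.
by rewrite -natrX ler_nat; case: (d) => // n; rewrite leq_pmulr.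
Qed.

Definition sparse y := forall n, 3 * `|y n| <= `|y n.+1|.

(** The weight is so small along y that e^(lam w) is negligible against |x| there;
this is how a failure of (gamma) is used. *)
Definition growth w y lam := exists2 D : R, 0 <= D &
  forall n, expR (lam * w (y n)) * 4 ^+ n <= D * jb (y n).

Lemma sparse_choice (Q : nat -> Rd -> Prop) :
  (forall n r, exists x : Rd, r < `|x| /\ Q n x) ->
  exists2 y, sparse y & forall n, Q n (y n).
Proof.
move=> HQ; have /choice[f Hf] : forall p : nat * R, exists x : Rd, p.2 < `|x| /\ Q p.1 x.
  by move=> [n r]; exact: HQ.
pose fix y n : Rd := if n is k.+1 then f (n, 3 * `|y k|) else f (0%N, 0).
exists y => [n|n]; first by have [/ltW] := Hf (n.+1, 3 * `|y n|).
by case: n => [|n]; [have [] := Hf (0%N, 0)|have [] := Hf (n.+1, 3 * `|y n|)].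
Qed.

Let d1 : 1 <= 1 + d%:R :> R. Proof. by rewrite lerDl. Qed.

Let enorm_jb (x : Rd) : 1 + enorm x <= (1 + d%:R) * jb x.
Proof.
have := enorm_le x; have : 0 <= d%:R :> R by [].
by rewrite /jb; have := normr_ge0 x; nra.
Qed.

(** If no point of large norm had the wanted property at stage n, then (gamma)
would hold with A = 1 / (n + 1), a ball being absorbed in the constant B.
The property at stage n handles every lam <= n + 1. *)
Lemma not_gamma_beurling w : (forall x, 0 <= w x) -> ~ cond_gamma_beurling w ->
  exists2 y, sparse y & forall lam, growth w y lam.
Proof.
move=> w0 nw.
have e0 (x : Rd) : 0 <= enorm x by exact: sqrtr_ge0.
have [y sy yQ] : exists2 y, sparse y & forall n,
    expR (n.+1%:R * w (y n)) * 4 ^+ n <= (1 + d%:R) * jb (y n).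
  apply: (@sparse_choice (fun n x => expR (n.+1%:R * w x) * 4 ^+ n <= (1 + d%:R) * jb x)) => n r.
  apply: contrapT => nx; apply: nw.
  have n0 : 0 < n.+1%:R :> R by [].
  pose b := ln (1 + d%:R * `|r|) + n%:R * ln 4.
  have dr : 0 <= ln (1 + d%:R * `|r|) by rewrite ln_ge0// lerDl mulr_ge0.
  have l4 : 0 <= n%:R * ln 4 :> R by rewrite mulr_ge0// ln_ge0// ler1n.
  exists n.+1%:R^-1, (expR (n.+1%:R^-1 * b)); split; rewrite ?invr_gt0 ?expR_gt0// => x.
  rewrite expRK -(ler_pM2l n0) mulrA mulfV ?lt0r_neq0// mul1r mulrDr mulrA mulfV ?lt0r_neq0// mul1r.
  have nw0 : 0 <= n.+1%:R * w x by rewrite mulr_ge0.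
  have p0 : 0 < 1 + enorm x by rewrite ltr_wpDr.
  have [xr|xr] := leP `|x| r.
    apply: (@le_trans _ _ (ln (1 + d%:R * `|r|))); last by rewrite /b; lra.
    rewrite ler_ln ?posrE ?ltr_wpDr ?mulr_ge0// lerD2l (le_trans (enorm_le x))//.
    by rewrite ler_wpM2l// (le_trans xr)// ler_norm.
  have : ~ (expR (n.+1%:R * w x) * 4 ^+ n <= (1 + d%:R) * jb x).
    by move=> h; apply: nx; exists x.
  move=> /negP; rewrite -ltNge => h.
  apply: (@le_trans _ _ (n.+1%:R * w x + n%:R * ln 4)); last by rewrite /b; lra.
  rewrite -ler_expR lnK ?posrE// expRD (expRM_natl n (ln 4)) (@lnK _ 4) ?posrE//.
  by apply: le_trans (ltW h); exact: enorm_jb.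
exists y => // lam; pose N := Num.bound `|lam|.
have lN : lam <= N%:R.
  by apply: le_trans (ler_norm _) _; apply/ltW/archi_boundP; exact: normr_ge0.
(* the finitely many stages n with n + 1 < lam *)
pose S := \sum_(k < N) expR (lam * w (y k)) * 4 ^+ k.
have S0 : 0 <= S by apply: sumr_ge0 => k _; rewrite mulr_ge0 ?expR_ge0 ?exprn_ge0.
exists (1 + d%:R + S) => [|n]; first by rewrite !addr_ge0.
have j1 := jb_ge1 (y n); have [nN|Nn] := ltP n N.
  have h : expR (lam * w (y n)) * 4 ^+ n <= S.
    rewrite /S (bigD1 (Ordinal nN))//= lerDl sumr_ge0//.
  apply: (le_trans h); apply: (@le_trans _ _ (S * jb (y n))); first by rewrite ler_peMr.
  by rewrite ler_wpM2r// lerDr addr_ge0.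
apply: (@le_trans _ _ (expR (n.+1%:R * w (y n)) * 4 ^+ n)).
  rewrite ler_wpM2r ?exprn_ge0// ler_expR ler_wpM2r// (le_trans lN)// ler_nat ltnW//.
by apply: le_trans (yQ n) _; rewrite ler_wpM2r// lerDl.
Qed.

(** If w < M ln |x| for points of arbitrarily large norm, then at the rate
lam = 1 / (2 M) the factor e^(lam w) is at most the square root of |x|, and the
other half of |x| absorbs 4^n. *)
Lemma not_gamma_roumieu w : (forall x, 0 <= w x) -> ~ cond_gamma_roumieu w ->
  exists2 y, sparse y & exists2 lam, 0 < lam & growth w y lam.
Proof.
move=> w0 nw.
have [M HM] : exists M, forall r, exists x : Rd, r < enorm x /\ w x / ln (enorm x) < M.
  apply: contrapT => nM; apply: nw => M; apply: contrapT => nr; apply: nM.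
  exists M => r; apply: contrapT => nx; apply: nr; exists r => x rx.
  by rewrite leNgt; apply/negP => h; apply: nx; exists x.
pose M' := Num.max M 1; have M'0 : 0 < M' by rewrite lt_max ltr01 orbT.
pose lam := (2 * M')^-1; have lam0 : 0 < lam by rewrite invr_gt0 mulr_gt0.
have [y sy yQ] : exists2 y, sparse y & forall n,
    expR (lam * w (y n)) * 4 ^+ n <= (1 + d%:R) * jb (y n).
  apply: (@sparse_choice (fun n x => expR (lam * w x) * 4 ^+ n <= (1 + d%:R) * jb x)) => n r.
  have p16 : 1 <= 16 ^+ n :> R by rewrite exprn_ege1// ler1n.
  have dr0 : 0 <= d%:R * `|r| by rewrite mulr_ge0.
  have [x [rx xM]] := HM (d%:R * `|r| + 16 ^+ n).
  have e1 : 1 < enorm x by lra.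
  have e16 : 16 ^+ n <= enorm x by lra.
  have ln0 : 0 < ln (enorm x) by rewrite ln_gt0.
  have ep : 0 < enorm x by lra.
  exists x; split.
    rewrite ltNge; apply/negP => xr.
    have : d%:R * `|x| <= d%:R * `|r| by rewrite ler_wpM2l// (le_trans xr)// ler_norm.
    have := enorm_le x; lra.
  apply: (@le_trans _ _ (enorm x)); last by apply: le_trans (enorm_jb x); rewrite lerDr.
  have wl : 2 * (lam * w x) <= ln (enorm x).
    rewrite ltr_pdivrMr// in xM.
    have h : w x <= M' * ln (enorm x).
      by apply: le_trans (ltW xM) _; rewrite ler_wpM2r ?(ltW ln0)// le_max lexx.
    have -> : 2 * (lam * w x) = w x / M' by rewrite /lam; field; rewrite lt0r_neq0.
    by rewrite ler_pdivrMr// mulrC.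
  have sq : (expR (lam * w x) * 4 ^+ n) ^+ 2 <= enorm x ^+ 2.
    rewrite exprMn -expRM_natl -exprM mulnC exprM.
    have -> : 4 ^+ 2 = 16 :> R by ring.
    rewrite [leRHS]expr2; apply: ler_pM => //; rewrite ?expR_ge0 ?exprn_ge0//.
    by rewrite -[leRHS]lnK ?posrE// ler_expR.
  by move: sq; rewrite ler_pXn2r ?nnegrE ?mulr_ge0 ?expR_ge0 ?exprn_ge0// ltW.
by exists y => //; exists lam => //; exists (1 + d%:R) => //; rewrite addr_ge0.
Qed.

Lemma not_gamma_seq c w : (forall x, 0 <= w x) -> ~ cond_gamma c w ->
  exists2 y, sparse y & quant c (growth w y).
Proof.
move=> w0; case: c => /= nw; last exact: not_gamma_roumieu.
by have [y sy Hy] := not_gamma_beurling w0 nw; exists y.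
Qed.

Definition downward (P : R -> Prop) := forall l l', 0 < l -> l <= l' -> P l' -> P l.

Lemma quant_and c (P Q : R -> Prop) : downward P -> downward Q ->
  quant c P -> quant c Q -> quant c (fun lam => P lam /\ Q lam).
Proof.
move=> dP dQ; case: c => /=; first by move=> HP HQ lam lam0; split; [exact: HP|exact: HQ].
move=> [l l0 Pl] [l' l'0 Ql']; have m0 : 0 < Num.min l l' by rewrite lt_min l0.
exists (Num.min l l') => //; split; [apply: dP Pl => //|apply: dQ Ql' => //].
  by rewrite ge_min lexx.
by rewrite ge_min lexx orbT.
Qed.

Lemma quant_scale c (P : R -> Prop) (k : R) : 0 < k -> quant c P ->
  quant c (fun lam => P (k * lam)).
Proof.
move=> k0; case: c => /=; first by move=> H lam lam0; apply: H; rewrite mulr_gt0.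
move=> [lam lam0 Pl]; exists (lam / k); first by rewrite divr_gt0.
by rewrite mulrC divfK ?lt0r_neq0.
Qed.

Definition wbounded w f lam := exists K, forall x, n1 (f x) <= K * expR (- (lam * w x)).

Lemma wbounded_downward w f : (forall x, 0 <= w x) -> downward (wbounded w f).
Proof.
move=> w0 l l' l0 ll [K HK]; exists K => x; apply: le_trans (HK x) _.
have K0 : 0 <= K by have := le_trans (n1_ge0 _) (HK x); rewrite pmulr_lge0// expR_gt0.
by rewrite ler_wpM2l// ler_expR lerN2 ler_wpM2r.
Qed.

Lemma growth_downward w y : (forall x, 0 <= w x) -> downward (growth w y).
Proof.
move=> w0 l l' l0 ll [D D0 HD]; exists D => // n; apply: le_trans (HD n).
by rewrite ler_wpM2r ?exprn_ge0// ler_expR ler_wpM2r.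
Qed.

(** The sum of translates along a sequence violating (gamma) keeps the weighted
decay of phi, and its transform keeps that of the transform of phi. *)
Lemma not_gamma_train c w phi s : weight w -> cond_alpha w -> schwartz phi ->
  (exists x, phi x != 0) -> s != 0 -> ~ cond_gamma c w -> quant c (wbounded w phi) ->
  exists F H, [/\ lipschitz F /\ ~ schwartz F, cmeasurable H,
    exists M, forall x, n1 (F x) <= M,
    exists B, forall xi, n1 (H xi) <= B * n1 (ft s phi xi) &
    forall h, schwartz h ->
      cintegral (fun x => F x * ft s h x) = cintegral (fun x => H x * h x)] /\
    quant c (wbounded w F).
Proof.
move=> [w0 _ _] [L [K [L0 K0 wL]]] sp p0 s0 ng pw.
have [y sy gy] := not_gamma_seq w0 ng.
have pg := quant_and (wbounded_downward w0) (growth_downward w0) pw gy.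
have [D yD] : exists D : R, forall n, 4 ^+ n <= D * jb (y n).
  have [lam lam0 [D D0 HD]] : exists2 lam, 0 < lam & growth w y lam.
    by case: (c) gy => /= gy //; exists 1 => //; exact: gy.
  exists D => n; apply: le_trans (HD n); rewrite ler_peMl ?exprn_ge0//.
  by rewrite -expR0 ler_expR mulr_ge0// ltW.
exists (train phi y), (train_ft phi s y); split.
  split.
  - by split; [exact: train_lipschitz sp yD|exact: train_not_schwartz sp yD sy p0].
  - exact: train_ft_cmeasurable sp yD.
  - exact: train_bounded sp yD.
  - by exists (8 * D); exact: train_ft_le.
  - by move=> h; exact: train_exchange sp yD _ s0.
apply: quant_impl (quant_scale L0 pg) => lam lam0 [[Cp HCp] [D' D'0 HD']].
have Ll0 : 0 < L * lam by rewrite mulr_gt0.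
have := train_weight L0 (ltW Ll0) D'0 wL HCp HD'.
rewrite [L * lam / L]mulrAC mulfV ?lt0r_neq0// mul1r => h.
by eexists; exact: h.
Qed.

Lemma GS_intro c eta omega u f g : (forall x, 0 <= eta x) -> (forall x, 0 <= omega x) ->
  tempered u -> given_by u f -> given_by (td_fourier u) g ->
  quant c (wbounded eta f) -> quant c (wbounded omega g) ->
  lcs_carrier (GS c eta omega) u.
Proof.
move=> e0 o0 ut uf ug ef og; apply/GS_carrierP.
have := quant_and (wbounded_downward e0) (wbounded_downward o0) ef og.
apply: quant_impl => lam lam0 [[K HK] [K' HK']]; split=> //.
by rewrite /gs_norm lte_add_pinfty//; [exact: dsup_fin uf HK|exact: dsup_fin ug HK'].
Qed.

Lemma GS0 c eta omega : (forall x, 0 <= eta x) -> (forall x, 0 <= omega x) ->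
  lcs_carrier (GS c eta omega) 0.
Proof.
move=> e0 o0; pose z : Rd -> C := fun _ => 0.
have zE : (0 : functional R d) = regular z.
  apply/funext => g; rewrite /regular /on_schwartz; case: asboolP => // sg.
  by rewrite -[LHS](@cintegral0 R d); apply: eq_cintegral => x; rewrite mul0r.
have sz : schwartz z := schwartz0 R d.
have wb w : quant c (wbounded w z).
  case: (c) => /= [lam lam0|]; last exists 1 => //; exists 0 => x; by rewrite n10 mul0r.
have fz : fourier z = z.
  rewrite ft1_fourier; apply/funext => x.
  by rewrite ftE -[RHS](@cintegral0 R d); apply: eq_cintegral => t; rewrite mul0r.
rewrite zE; apply: (GS_intro e0 o0 _ (given_by_schwartz sz) (given_by_schwartz_fourier sz)).
- by apply: schwartz_distr_tempered; exists z.
- exact: wb.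
- by rewrite fz; exact: wb.
Qed.

(** The pointwise bounds on phi come from those of unknown representatives,
through the Lipschitz one. *)
Lemma schwartz_distr_bounds c eta omega phi : weight eta -> weight omega ->
  cond_alpha eta -> cond_alpha omega -> schwartz phi ->
  lcs_carrier (GS c eta omega) (regular phi) ->
  quant c (wbounded eta phi) /\ quant c (wbounded omega (fourier phi)).
Proof.
move=> We Wo ae ao sp /GS_carrierP uG.
have [L [E [de [we wo]]]] := wloc_common We ae Wo ao.
have L1 := wloc_L we; have L0 : 0 < L by lra.
have lip f : schwartz f -> lipschitz f by move=> /schwartz_lipschitz.
have H lam : 0 < lam -> tempered (regular phi) /\ (gs_norm eta omega (L * lam) (regular phi) < +oo)%E ->
    wbounded eta phi lam /\ wbounded omega (fourier phi) lam.
  move=> lam0 [_ /(ereal_fin_bound (gs_norm_ge0 _ _ _ _))[P P0]].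
  move=> /gs_norm_lt[[f1 u1 f1P] [f2 u2 f2P]].
  have Ll : 0 <= L * lam by rewrite ltW// mulr_gt0.
  have lE : L * lam / L = lam by rewrite mulrC mulKf// lt0r_neq0.
  have := given_by_lipschitz_bound we Ll (lip _ sp) (given_by_schwartz sp) u1 f1P.
  have := given_by_lipschitz_bound wo Ll (lip _ (schwartz_fourier sp)) (given_by_schwartz_fourier sp) u2 f2P.
  by rewrite lE => h2 h1; split; eexists; [exact: h1|exact: h2].
have HH := quant_scale L0 uG.
by split; apply: quant_impl HH => lam lam0 /(H lam lam0)[].
Qed.

Lemma quant_wbounded_le c w f g (B : R) : (forall x, n1 (f x) <= B * n1 (g x)) ->
  quant c (wbounded w g) -> quant c (wbounded w f).
Proof.
move=> fg; apply: quant_impl => lam lam0 [K HK]; exists (`|B| * K) => x.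
apply: le_trans (fg x) _; rewrite -mulrA; apply: (@le_trans _ _ (`|B| * n1 (g x))).
  by rewrite ler_wpM2r ?n1_ge0// ler_norm.
by rewrite ler_wpM2l.
Qed.

Lemma schwartz_bounded f : schwartz f -> exists M, forall x, n1 (f x) <= M.
Proof.
move=> sf; have [M M0 fM] := schwartz_decay 0 sf; exists M => x.
by apply: le_trans (fM x) _; rewrite ler_piMr ?jbi_le1.
Qed.

Section nontrivial_space.
Variables (c : regime) (eta omega : Rd -> R).
Hypotheses (We : weight eta) (Wo : weight omega) (ae : cond_alpha eta) (ao : cond_alpha omega).
Hypothesis GS_schwartz : lcs_carrier (GS c eta omega) `<=` @schwartz_distr R d.

Let e0 : forall x, 0 <= eta x. Proof. by case: We. Qed.
Let o0 : forall x, 0 <= omega x. Proof. by case: Wo. Qed.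

Lemma schwartz_rep_unique v F G (M : R) : lipschitz F -> (forall x, n1 (F x) <= M) ->
  given_by v F -> given_by v G -> schwartz G -> schwartz F.
Proof.
move=> lF FM vF vG sG; have [N GN] := schwartz_bounded sG.
by rewrite (lipschitz_rep_unique lF (schwartz_lipschitz sG) FM GN vF vG).
Qed.

(** Otherwise a sum of translates of phi would belong to the space. *)
Lemma gamma_time phi : schwartz phi -> (exists x, phi x != 0) ->
  quant c (wbounded eta phi) -> quant c (wbounded omega (fourier phi)) -> cond_gamma c eta.
Proof.
move=> sp p0 pe po; apply: contrapT => ng.
have n11 := oner_neq0 R.
have [F [G [[[lF nF] mG [M FM] [B GB] FG] qF]]] := not_gamma_train We ae sp p0 n11 ng pe.
have [N ftN] := schwartz_bounded (schwartz_ft n11 sp).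
have GM x : n1 (G x) <= `|B| * N.
  apply: le_trans (GB x) _; apply: (@le_trans _ _ (`|B| * n1 (ft 1 phi x))).
    by rewrite ler_wpM2r ?n1_ge0// ler_norm.
  by rewrite ler_wpM2l.
have mF := lipschitz_cmeasurable lF.
have uF := given_by_regular_self mF FM.
have uG : given_by (td_fourier (regular F)) G.
  apply: (given_by_bounded mG GM) => g sg.
  by rewrite td_fourierE// regularE; [exact: FG|exact: schwartz_ft].
have qG : quant c (wbounded omega G).
  by apply: (quant_wbounded_le GB); rewrite -ft1_fourier.
have /GS_schwartz[F' sF' E] := GS_intro e0 o0 (regular_tempered mF FM) uF uG qF qG.
apply: nF; apply: (schwartz_rep_unique lF FM uF _ sF').
by rewrite -E; exact: given_by_schwartz.
Qed.

(** Otherwise a sum of translates of the transform of phi would be the transform of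
an element of the space. *)
Lemma gamma_frequency phi : schwartz phi -> (exists x, phi x != 0) ->
  quant c (wbounded eta phi) -> quant c (wbounded omega (fourier phi)) -> cond_gamma c omega.
Proof.
move=> sp p0 pe po; apply: contrapT => ng.
have n10 : - 1 != 0 :> R by rewrite oppr_eq0 oner_eq0.
have inv : ft (- 1) (fourier phi) = phi by rewrite ft1_fourier ft_inversion// mulr1.
have q0 : exists x, fourier phi x != 0.
  apply: contrapT => nx; have [x /eqP] := p0; apply; rewrite -inv ftE -[RHS](@cintegral0 R d).
  apply: eq_cintegral => t; suff -> : fourier phi t = 0 by rewrite mul0r.
  by apply/eqP/negPn/negP => h; apply: nx; exists t.
have [F [G [[[lF nF] mG [M FM] [B GB] FG] qF]]] :=
  not_gamma_train Wo ao (schwartz_fourier sp) q0 n10 ng po.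
rewrite inv in GB.
have [N pN] := schwartz_bounded sp.
have GM x : n1 (G x) <= `|B| * N.
  apply: le_trans (GB x) _; apply: (@le_trans _ _ (`|B| * n1 (phi x))).
    by rewrite ler_wpM2r ?n1_ge0// ler_norm.
  by rewrite ler_wpM2l.
have mF := lipschitz_cmeasurable lF.
have uG := given_by_regular_self mG GM.
have uF : given_by (td_fourier (regular G)) F.
  apply: (given_by_bounded mF FM) => g sg; have sg' := schwartz_ft (oner_neq0 R) sg.
  by rewrite td_fourierE// regularE// -FG// ft_inversion// mulr1.
have /GS_schwartz[G' sG' E] :=
  GS_intro e0 o0 (regular_tempered mG GM) uG uF (quant_wbounded_le GB pe) qF.
apply: nF; apply: (schwartz_rep_unique lF FM uF _ (schwartz_fourier sG')).
by rewrite -E; exact: given_by_schwartz_fourier.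
Qed.

Lemma GS_schwartz_gamma : lcs_carrier (GS c eta omega) <> [set 0] ->
  cond_gamma c omega /\ cond_gamma c eta.
Proof.
move=> ntr; have [u uG u0] : exists2 u, lcs_carrier (GS c eta omega) u & u <> 0.
  apply: contrapT => nu; apply: ntr; apply/seteqP; split=> [u uG|_ ->]; last exact: GS0.
  by apply: contrapT => u0; apply: nu; exists u.
have [phi sp E] := GS_schwartz uG.
have p0 : exists x, phi x != 0.
  apply: contrapT => nx; apply: u0; rewrite -E; apply/funext => g.
  rewrite /regular /on_schwartz; case: asboolP => // sg; rewrite -[RHS](@cintegral0 R d).
  apply: eq_cintegral => x; suff -> : phi x = 0 by rewrite mul0r.
  by apply/eqP/negPn/negP => h; apply: nx; exists x.
rewrite -E in uG; have [pe po] := schwartz_distr_bounds We Wo ae ao sp uG.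
by split; [exact: gamma_frequency sp p0 pe po|exact: gamma_time sp p0 pe po].
Qed.

End nontrivial_space.

End necessity.

(** * The equivalence *)

Theorem theorem2p1 (R : realType) (d : nat) (omega eta : 'rV[R]_d -> R)
    (w_omega : weight omega) (w_eta : weight eta)
    (alpha_omega : cond_alpha omega) (alpha_eta : cond_alpha eta)
    (c : regime)
    (nontrivial : lcs_carrier (GS c eta omega) <> [set 0]) :
  [<-> (* i *)
       cond_gamma c omega /\ cond_gamma c eta;
       (* ii *)
       lcs_eq (GS c eta omega) (GSt c eta omega);
       (* iii *)
       lcs_carrier (GS c eta omega) =
         [set u | tempered u /\ quant c (fun lambda =>
            forall a : multiindex d,
              (dsup a eta lambda u < +oo)%E /\
              (dsup a omega lambda (td_fourier u) < +oo)%E)];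
       (* iv *)
       lcs_carrier (GS c eta omega) =
         [set u | tempered u /\ quant c (fun lambda =>
            forall a : multiindex d,
              (dint eta lambda (td_deriv a u) < +oo)%E /\
              (dint omega lambda (td_deriv a (td_fourier u)) < +oo)%E)];
       (* v *)
       lcs_carrier (GS c eta omega) `<=` @schwartz_distr R d ].

Proof.
have eta0 : forall x, 0 <= eta x by case: w_eta.
have omega0 : forall x, 0 <= omega x by case: w_omega.
have [L [E [de [we wo]]]] := wloc_common w_eta alpha_eta w_omega alpha_omega.
have adm : cond_gamma c omega /\ cond_gamma c eta -> admissible c eta /\ admissible c omega.
  by move=> [go ge]; split; exact: cond_gamma_admissible.
have v_i : lcs_carrier (GS c eta omega) `<=` @schwartz_distr R d ->
    cond_gamma c omega /\ cond_gamma c eta.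
  by move=> Hv; exact: GS_schwartz_gamma Hv nontrivial.
have ii_v : lcs_eq (GS c eta omega) (GSt c eta omega) ->
    lcs_carrier (GS c eta omega) `<=` @schwartz_distr R d.
  move=> [-> _] u /GSt_carrierP; case: (c) => /= [H|[lam _ []//]].
  by have [] := H 1 ltr01.
have qt (P : R -> Prop) : quant c P -> exists2 lam, 0 < lam & P lam.
  by case: (c) => //= H; exists 1 => //; exact: H.
have i_iii : cond_gamma c omega /\ cond_gamma c eta -> lcs_carrier (GS c eta omega) =
    [set u | tempered u /\ quant c (fun lambda => forall a : multiindex d,
       (dsup a eta lambda u < +oo)%E /\ (dsup a omega lambda (td_fourier u) < +oo)%E)].
  move=> /adm[ae ao]; apply/seteqP; split=> [u uG|u [ut H]]; last exact: dsup_GS.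
  by split; [exact: GS_tempered uG|apply: GSt_dsup; exact: GS_sub_GSt we wo _ _ ae ao uG].
have iii_v : lcs_carrier (GS c eta omega) =
    [set u | tempered u /\ quant c (fun lambda => forall a : multiindex d,
       (dsup a eta lambda u < +oo)%E /\ (dsup a omega lambda (td_fourier u) < +oo)%E)] ->
    lcs_carrier (GS c eta omega) `<=` @schwartz_distr R d.
  by move=> -> u [ut /qt[lam lam0 H]]; exact: dsup_schwartz eta0 omega0 (ltW lam0) ut H.
have i_iv : cond_gamma c omega /\ cond_gamma c eta -> lcs_carrier (GS c eta omega) =
    [set u | tempered u /\ quant c (fun lambda => forall a : multiindex d,
       (dint eta lambda (td_deriv a u) < +oo)%E /\
       (dint omega lambda (td_deriv a (td_fourier u)) < +oo)%E)].
  move=> /adm[ae ao]; apply/seteqP; split=> [u uG|u [ut H]]; last exact: dint_GS we wo ae ao ut H.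
  by split; [exact: GS_tempered uG|apply: GSt_dint; exact: GS_sub_GSt we wo _ _ ae ao uG].
have iv_v : lcs_carrier (GS c eta omega) =
    [set u | tempered u /\ quant c (fun lambda => forall a : multiindex d,
       (dint eta lambda (td_deriv a u) < +oo)%E /\
       (dint omega lambda (td_deriv a (td_fourier u)) < +oo)%E)] ->
    lcs_carrier (GS c eta omega) `<=` @schwartz_distr R d.
  by move=> -> u [ut /qt[lam lam0 H]]; exact: dint_schwartz eta0 omega0 (ltW lam0) ut H.
tfae.
- by move=> /adm[ae ao]; exact: GS_eq_GSt we wo _ ae ao.
- by move=> /ii_v/v_i/i_iii.
- by move=> /iii_v/v_i/i_iv.
- exact: iv_v.
- exact: v_i.
Qed.
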